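(* Let $(M,g)$ be Minkowski space-time and $n\ge2$. Let $\phi_{A\dots F}$ ($n$ indices) be a smooth spinor field with $\phi_{AB\dots F}=\phi_{(AB\dots F)}$ solving $$\nabla^{AA'}\phi_{AB\dots F}=0\text{ on }\mathcal{J}^+(p_0),\qquad \phi_{AB\dots F}=\theta_{AB\dots F}\text{ on }\mathcal{C}^+(p_0).$$ Then, for every $q\in\mathcal{J}^+(p_0)$, $$\phi_{A\dots F}(q)=(-1)^n\int_{\sigma(q)}\big(\nabla_l\phi_0-(n+1)\rho\,\phi_0\big)\,\iota_A\cdots\iota_F\,\frac{\mu_{\sigma(q)}}{2\pi r},$$ where $\phi_0=\phi_{AB\dots F}\,o^Ao^B\cdots o^F$ on $\mathcal{C}^+(p_0)$.
   Context: Signature $(+,-,-,-)$; spinors: $\mathbb{S}_A$ with symplectic form $\varepsilon$, $g_{ab}=\varepsilon_{AB}\varepsilon_{A'B'}$, $\kappa^A=\varepsilon^{AB}\kappa_B$, $\kappa_B=\kappa^A\varepsilon_{AB}$ (same for primed indices), vectors written $u^a=u^{AA'}$. $p_0$ is a fixed point; $\mathcal{C}^\pm(p)$ (resp. $\mathcal{J}^\pm(p)$) is the set of points on a future/past null (resp. timelike) geodesic from $p$; $\sigma(q)=\mathcal{C}^+(p_0)\cap\mathcal{C}^-(q)$, with positive induced area measure $\mu_{\sigma(q)}$. For each generator (future null direction $\omega$ at $p_0$) a spinor $o^A=o^A(\omega)$, constant along the generator, is chosen with $l^a=o^A\overline o^{A'}$ a future null vector in direction $\omega$ ($l$ depending smoothly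 on $\omega$); $r_0$ is the affine parameter with respect to $l$ measured from $p_0$. For $q\in\mathcal{J}^+(p_0)$ let $p\in\sigma(q)$ be the point where $\mathcal{C}^-(q)$ meets the generator; $\iota^A$ is chosen with $n^a=\iota^A\overline\iota^{A'}$ collinear to $\vec{pq}$ and $o_A\iota^A=1$, and $r>0$ is the affine parameter with respect to $n$, so that $q=p_0+r_0l^a+rn^a$. (The phase of $o^A$ is immaterial.) $m^a=o^A\overline\iota^{A'}$, $\overline m^a=\iota^A\overline o^{A'}$ span $T_p\sigma(q)\otimes\mathbb{C}$, and $\rho=-g(l,\nabla_{\overline m}m)$ (real). $\nabla_l$ is the derivative along the generators; the integrand is evaluated at $p\in\sigma(q)$ and spinors are identified by flat parallel transport. The data $\theta$ is smooth and compactly supported on the cone. *)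

(* Defs.v *)
From HB Require Import structures.
From mathcomp Require Import all_boot all_order all_algebra all_fingroup.
From mathcomp Require Import all_classical all_reals all_analysis.
From mathcomp Require Import complex ring.

Set Implicit Arguments.
Unset Strict Implicit.
Unset Printing Implicit Defensive.

Import Order.TTheory GRing.Theory Num.Theory.
Import numFieldNormedType.Exports.

Local Open Scope classical_set_scope.
Local Open Scope ring_scope.
Local Open Scope complex_scope.

(* Minkowski space-time is 'rV[R]_4 in inertial coordinates (t, x, y, z);
   complexified vectors are in 'rV[R[i]]_4. *)
Definition mink_form (K : comNzRingType) (u v : 'rV[K]_4) : K :=
  u 0 0 * v 0 0 - \sum_(j < 3) u 0 (lift ord0 j) * v 0 (lift ord0 j).

Definition inv_metric (K : comNzRingType) (a : 'I_4) : K :=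
  if a == ord0 then 1 else - 1.

Fixpoint Ck (R : realType) (V : normedModType R) (k : nat) (U : set V)
    (f : V -> R) : Prop :=
  if k is k'.+1 then
    (forall x, U x -> differentiable f x) /\
    (forall v, Ck k' U (fun x => 'D_v f x))
  else forall x, U x -> {for x, continuous f}.

(* C^infinity on an open set U. *)
Definition smooth_in (R : realType) (V : normedModType R) (U : set V)
    (f : V -> R) : Prop :=
  forall k, Ck k U f.

Definition csmooth_in (R : realType) (V : normedModType R) (U : set V)
    (f : V -> R[i]) : Prop :=
  smooth_in U (fun x => complex.Re (f x)) /\ smooth_in U (fun x => complex.Im (f x)).

(* The partial derivative in the a-th inertial coordinate. *)
Definition pd (R : realType) (a : 'I_4) (f : 'rV[R]_4 -> R[i])
    (x : 'rV[R]_4) : R[i] :=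
  'D_(delta_mx 0 a) (fun y => complex.Re (f y)) x +i*
  'D_(delta_mx 0 a) (fun y => complex.Im (f y)) x.

(* The flat connection, extended complex-linearly in X. *)
Definition nabla (R : realType) (X : 'rV[R[i]]_4)
    (V : 'rV[R]_4 -> 'rV[R[i]]_4) (x : 'rV[R]_4) : 'rV[R[i]]_4 :=
  \row_b \sum_(a < 4) X 0 a * pd a (fun y => V y 0 b) x.

(* A constant spin frame is fixed; 'rV[R[i]]_2 holds the components kappa^A. *)

(* epsilon_{AB}, with epsilon_{01} = 1; the same matrix is epsilon^{AB}. *)
Definition epsilon (R : realType) : 'M[R[i]]_2 :=
  delta_mx 0 1 - delta_mx 1 0.

(* kappa_A = kappa^B epsilon_{BA} *)
Definition lower (R : realType) (k : 'rV[R[i]]_2) : 'rV[R[i]]_2 :=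
  k *m epsilon R.

(* kappa_A mu^A *)
Definition spair (R : realType) (k m : 'rV[R[i]]_2) : R[i] :=
  \sum_(A < 2) lower k 0 A * m 0 A.

Definition cconj (R : realType) m n (A : 'M[R[i]]_(m, n)) : 'M[R[i]]_(m, n) :=
  map_mx (fun z : R[i] => complex.Re z -i* complex.Im z) A.

(* Infeld-van der Waerden symbols sigma_a^{AA'}: u^{AA'} is
   2^(-1/2) [[t + z, x + i y], [x - i y, t - z]]. *)
Definition infeld (R : realType) (a : 'I_4) : 'M[R[i]]_2 :=
  ((Num.sqrt 2)^-1)%:C *:
  match val a with
  | 0%N => 1%:M
  | 1%N => delta_mx 0 1 + delta_mx 1 0
  | 2%N => (0 +i* 1) *: (delta_mx 0 1 - delta_mx 1 0)
  | _ => delta_mx 0 0 - delta_mx 1 1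
  end.

(* The vector u with u^{AA'} = M^{AA'}: the matrices infeld a are orthonormal for
   the Hilbert-Schmidt product. *)
Definition vec_of_mx (R : realType) (M : 'M[R[i]]_2) : 'rV[R[i]]_4 :=
  \row_a \sum_(A < 2) \sum_(A' < 2) cconj (infeld R a) A A' * M A A'.

(* The vector kappa^A bar(mu)^{A'}. *)
Definition svec (R : realType) (k m : 'rV[R[i]]_2) : 'rV[R[i]]_4 :=
  vec_of_mx (k^T *m cconj m).

(* The real null vector kappa^A bar(kappa)^{A'}; its components are real. *)
Definition flag (R : realType) (k : 'rV[R[i]]_2) : 'rV[R]_4 :=
  map_mx (@complex.Re R) (svec k k).

Definition cplx (R : realType) (u : 'rV[R]_4) : 'rV[R[i]]_4 :=
  map_mx (fun x : R => x%:C) u.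

Lemma sqrt2V2 (R : realType) :
  (Num.sqrt 2)^-1 * (Num.sqrt 2)^-1 *+ 2 = 1 :> R.
Proof. by rewrite -invfM -expr2 sqr_sqrtr ?ler0n// -mulr_natl mulfV. Qed.

Lemma svecE (R : realType) (k m : 'rV[R[i]]_2) :
  let cj z := complex.Re z -i* complex.Im z in
  svec k m = \row_a (((Num.sqrt 2)^-1)%:C *
    match val a with
    | 0%N => k 0 0 * cj (m 0 0) + k 0 1 * cj (m 0 1)
    | 1%N => k 0 0 * cj (m 0 1) + k 0 1 * cj (m 0 0)
    | 2%N => (0 -i* 1) * (k 0 0 * cj (m 0 1) - k 0 1 * cj (m 0 0))
    | _ => k 0 0 * cj (m 0 0) - k 0 1 * cj (m 0 1)
    end).
Proof.
move=> cj.
have e1 : lift ord0 ord0 = 1 :> 'I_2 by apply/val_inj.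
apply/rowP => a; rewrite !mxE !(big_ord_recl, big_ord0) !mxE.
rewrite !(big_ord_recl, big_ord0) !mxE e1 /infeld /cj.
move: (Num.sqrt 2)^-1 => t.
case: (k 0 0) => x x'; case: (k 0 1) => y y'.
case: (m 0 0) => z z'; case: (m 0 1) => w w'.
case: a => [[|[|[|[|//]]]] ?] /=; rewrite !mxE /=; apply/eqP;
  rewrite eq_complex /=; by apply/andP; split; apply/eqP; ring.
Qed.

(* u = svec k m satisfies u^{AA'} = k^A bar(m)^{A'}. *)
Lemma svecP (R : realType) (k m : 'rV[R[i]]_2) :
  \sum_(a < 4) svec k m 0 a *: infeld R a = k^T *m cconj m.
Proof.
have I2 (A : 'I_2) : A = 0 \/ A = 1.
  by case: A => [[|[|//]] ?]; [left|right]; apply/val_inj.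
have t2 := sqrt2V2 R.
apply/matrixP => A A'; rewrite summxE.
under eq_bigr => a _ do rewrite mxE svecE mxE.
rewrite [RHS]mxE big_ord1 [X in _ = X * _]mxE [X in _ = _ * X]mxE.
rewrite /infeld !(big_ord_recl, big_ord0) /=; move: t2; move: (Num.sqrt 2)^-1 => t t2.
case: (I2 A) => ->; case: (I2 A') => ->; rewrite !mxE /=;
  case: (k 0 0) => x x'; case: (k 0 1) => y y';
  case: (m 0 0) => z z'; case: (m 0 1) => w w'; apply/eqP;
  rewrite eq_complex /=; apply/andP; split; apply/eqP;
  rewrite -[RHS]mul1r -[X in _ = X * _]t2; ring.
Qed.

Lemma cplx_flag (R : realType) (k : 'rV[R[i]]_2) : cplx (flag k) = svec k k.
Proof.
apply/rowP => a; rewrite mxE mxE svecE mxE /=.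
move: (Num.sqrt 2)^-1 => t.
case: (k 0 0) => x x'; case: (k 0 1) => y y'.
case: a => [[|[|[|[|//]]]] ?] /=; apply/eqP; rewrite eq_complex /=;
  by apply/andP; split; apply/eqP; ring.
Qed.

(* g_{ab} = epsilon_{AB} epsilon_{A'B'} *)
Lemma mink_form_svec (R : realType) (k m k' m' : 'rV[R[i]]_2) :
  let cj z := complex.Re z -i* complex.Im z in
  mink_form (svec k m) (svec k' m') = spair k k' * cj (spair m m').
Proof.
move=> cj; rewrite /mink_form /spair /lower !(big_ord_recl, big_ord0).
rewrite !svecE !mxE /= !(big_ord_recl, big_ord0) !mxE /=.
have e1 : lift ord0 ord0 = 1 :> 'I_2 by apply/val_inj.
have := sqrt2V2 R; rewrite !e1 /cj; move: (Num.sqrt 2)^-1 => t t2.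
case: (k 0 0) => x x'; case: (k 0 1) => y y'.
case: (m 0 0) => z z'; case: (m 0 1) => w w'.
case: (k' 0 0) => X X'; case: (k' 0 1) => Y Y'.
case: (m' 0 0) => Z Z'; case: (m' 0 1) => W W'.
rewrite /=; apply/eqP; rewrite eq_complex /=.
by apply/andP; split; apply/eqP; rewrite -[RHS]mul1r -[X in _ = X * _]t2; ring.
Qed.

Notation spindex n := {ffun 'I_n -> 'I_2}.

(* Components Phi_{AB...F} of covariant spinors with n indices. *)
Definition spinor_tensor (R : realType) (n : nat) := spindex n -> R[i].

Definition symmetrization (R : realType) n (Phi : spinor_tensor R n) :
    spinor_tensor R n :=
  fun I => (n`!%:R)^-1 * \sum_(s : 'S_n) Phi [ffun k => I (s k)].

(* Phi_{AB...F} kappa^A kappa^B ... kappa^F *)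
Definition contract_all (R : realType) n (Phi : spinor_tensor R n)
    (k : 'rV[R[i]]_2) : R[i] :=
  \sum_(I : spindex n) Phi I * \prod_(j < n) k 0 (I j).

Definition set_index n (I : spindex n) (j : 'I_n) (A : 'I_2) : spindex n :=
  [ffun k => if k == j then A else I k].

(* nabla^{AA'} f = sigma_a^{AA'} g^{ab} partial_b f *)
Definition spinor_nabla (R : realType) (A A' : 'I_2) (f : 'rV[R]_4 -> R[i])
    (x : 'rV[R]_4) : R[i] :=
  \sum_(a < 4) infeld R a A A' * inv_metric _ a * pd a f x.

(* nabla^{AA'} phi_{AB...F} = 0 at x; j is the position of the first index, and
   the value I j is irrelevant. *)
Definition massless_at (R : realType) n (phi : 'rV[R]_4 -> spinor_tensor R n)
    (x : 'rV[R]_4) : Prop :=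
  forall (j : 'I_n) (I : spindex n) (A' : 'I_2), val j = 0%N ->
    \sum_(A < 2) spinor_nabla A A' (fun y => phi y (set_index I j A)) x = 0.

Definition smooth_field (R : realType) n (phi : 'rV[R]_4 -> spinor_tensor R n) :
    Prop :=
  forall I, csmooth_in setT (fun x => phi x I).

(* Smoothness on a subset A means being the restriction of a smooth field. *)
Definition smooth_data (R : realType) n (A : set 'rV[R]_4)
    (theta : 'rV[R]_4 -> spinor_tensor R n) : Prop :=
  exists Theta : 'rV[R]_4 -> spinor_tensor R n,
    smooth_field Theta /\ forall x, A x -> theta x = Theta x.

(* The support is relatively compact in space-time: it may reach the vertex. *)
Definition compactly_supported (R : realType) n (A : set 'rV[R]_4)
    (theta : 'rV[R]_4 -> spinor_tensor R n) : Prop :=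
  exists2 K : set 'rV[R]_4, compact K &
    forall x, A x -> ~ K x -> forall I, theta x I = 0.

Definition future_null (R : realType) (k : 'rV[R]_4) : Prop :=
  mink_form k k = 0 /\ 0 < k 0 0.

Definition future_timelike (R : realType) (k : 'rV[R]_4) : Prop :=
  0 < mink_form k k /\ 0 < k 0 0.

(* Geodesics are straight lines; the point p itself is not included. *)
Definition cone_future (R : realType) (p : 'rV[R]_4) : set 'rV[R]_4 :=
  [set x | exists k s, [/\ future_null k, 0 < s & x = p + s *: k]].

Definition cone_past (R : realType) (p : 'rV[R]_4) : set 'rV[R]_4 :=
  [set x | exists k s, [/\ future_null k, 0 < s & x = p - s *: k]].

Definition chrono_future (R : realType) (p : 'rV[R]_4) : set 'rV[R]_4 :=
  [set x | exists k s, [/\ future_timelike k, 0 < s & x = p + s *: k]].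

Definition sigma (R : realType) (p0 q : 'rV[R]_4) : set 'rV[R]_4 :=
  cone_future p0 `&` cone_past q.

Definition enorm (R : realType) (x : 'rV[R]_3) : R :=
  Num.sqrt (\sum_(j < 3) x 0 j ^+ 2).

Definition normalize (R : realType) (x : 'rV[R]_3) : 'rV[R]_3 :=
  (enorm x)^-1 *: x.

(* Future null directions, i.e. generators of the cone, are labelled by the unit
   vectors w of R^3, through the null vector (1, w). *)
Definition unit_sphere (R : realType) : set 'rV[R]_3 := [set w | enorm w = 1].

Definition null_direction (R : realType) (w : 'rV[R]_3) : 'rV[R]_4 :=
  row_mx (1%:M : 'rV_1) w.

(* The direction of the spatial part of x - p0; on the cone of p0 this is the
   label of the generator through x. *)
Definition dir (R : realType) (p0 x : 'rV[R]_4) : 'rV[R]_3 :=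
  normalize (rsubmx (x - p0 : 'rV_(1 + 3))).

(* The spinors o, given on each generator by their constant components: l is
   future null in the direction w and depends smoothly on w, while no regularity
   is asked from the phase of o (o cannot be continuous on the whole sphere). *)
Record generator_spinors (R : realType) (o : 'rV[R]_3 -> 'rV[R[i]]_2) : Prop := {
  generator_dir : forall w, unit_sphere w ->
    exists2 c : R, 0 < c & flag (o w) = c *: null_direction w;
  generator_smooth : forall a : 'I_4,
    smooth_in [set x | x != 0] (fun x => flag (o (normalize x)) 0 a) }.

(* r0 w *: l is the vector from p0 to the point of sigma p0 q on the generator w,
   and q = p0 + r0 l + r n. *)
Record adapted_to (R : realType) (p0 q : 'rV[R]_4)
    (o iota : 'rV[R]_3 -> 'rV[R[i]]_2) (r0 r : 'rV[R]_3 -> R) : Prop := {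
  adapted_r0 : forall w, unit_sphere w -> 0 < r0 w;
  adapted_sigma : forall w, unit_sphere w ->
    sigma p0 q (p0 + r0 w *: flag (o w));
  adapted_r : forall w, unit_sphere w -> 0 < r w;
  adapted_q : forall w, unit_sphere w ->
    q = p0 + r0 w *: flag (o w) + r w *: flag (iota w);
  adapted_dyad : forall w, unit_sphere w -> spair (o w) (iota w) = 1 }.

(* Phase turning k' into the phase of k: hphase k k' *: k' has a positive
   Hermitian product with k. *)
Definition hphase (R : realType) (k k' : 'rV[R[i]]_2) : R[i] :=
  let h := \sum_(A < 2) k 0 A * (cconj k') 0 A in h / `|h|.

(* m = o bar(iota) near the generator w, extended off the cone along dir p0.
   Since o need not be continuous, its phase is fixed by comparison with o w,
   which makes it smooth near w; o |-> u o forces iota |-> bar(u) iota, and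
   hence m |-> u^2 m. *)
Definition mfield (R : realType) (p0 : 'rV[R]_4)
    (o iota : 'rV[R]_3 -> 'rV[R[i]]_2) (w : 'rV[R]_3) (x : 'rV[R]_4) :
    'rV[R[i]]_4 :=
  (hphase (o w) (o (dir p0 x))) ^+ 2 *: svec (o (dir p0 x)) (iota (dir p0 x)).

(* rho = - g(l, nabla_{bar m} m) at the point x on the generator w. As bar m is
   tangent to sigma p0 q, the extension of m off that surface is irrelevant. *)
Definition rho (R : realType) (p0 : 'rV[R]_4)
    (o iota : 'rV[R]_3 -> 'rV[R[i]]_2) (w : 'rV[R]_3) (x : 'rV[R]_4) : R[i] :=
  - mink_form (cplx (flag (o w)))
      (nabla (svec (iota w) (o w)) (mfield p0 o iota w) x).

(* phi_0 at the affine parameter s of the generator w. *)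
Definition phi0 (R : realType) n (phi : 'rV[R]_4 -> spinor_tensor R n)
    (p0 : 'rV[R]_4) (o : 'rV[R]_3 -> 'rV[R[i]]_2) (w : 'rV[R]_3) (s : R) : R[i] :=
  contract_all (phi (p0 + s *: flag (o w))) (o w).

Definition cderive1 (R : realType) (f : R -> R[i]) (s : R) : R[i] :=
  derive1 (fun t => complex.Re (f t)) s +i*
  derive1 (fun t => complex.Im (f t)) s.

(* The unit vector of colatitude a and longitude b. *)
Definition spherical (R : realType) (a b : R) : 'rV[R]_3 :=
  \row_j match val j with
         | 0%N => sin a * cos b
         | 1%N => sin a * sin b
         | _ => cos a
         end.

(* Area density, in the coordinates (a, b), of the positive definite metric
   induced by - g on the spacelike surface parametrized by X. *)
Definition area_density (R : realType) (X : R -> R -> 'rV[R]_4) (a b : R) : R :=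
  let Xa := derive1 (fun t => X t b) a in
  let Xb := derive1 (fun t => X a t) b in
  Num.sqrt (mink_form Xa Xa * mink_form Xb Xb - mink_form Xa Xb ^+ 2).

(* The integral of f with respect to the induced area measure of the sphere
   { P w | w in unit_sphere }, f w being the value of the integrand at P w. *)
Definition sphere_integral (R : realType) (P : 'rV[R]_3 -> 'rV[R]_4)
    (f : 'rV[R]_3 -> R) : R :=
  (\int[@lebesgue_measure R]_(a in `[0, pi])
     \int[@lebesgue_measure R]_(b in `[0, pi *+ 2])
       (f (spherical a b) * area_density (fun s t => P (spherical s t)) a b))%R.

Definition csphere_integral (R : realType) (P : 'rV[R]_3 -> 'rV[R]_4)
    (f : 'rV[R]_3 -> R[i]) : R[i] :=
  sphere_integral P (fun w => complex.Re (f w)) +i* sphere_integral P (fun w => complex.Im (f w)).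

(* Main.v *)
Require Import Defs.
From mathcomp Require Import all_boot all_order all_algebra all_fingroup.
From mathcomp Require Import all_classical all_reals all_analysis.
From mathcomp Require Import complex ring lra.
Import Order.TTheory GRing.Theory Num.Theory.
Import numFieldNormedType.Exports.
Local Open Scope classical_set_scope.
Local Open Scope ring_scope.
Local Open Scope complex_scope.

Set Implicit Arguments.
Unset Strict Implicit.
Unset Printing Implicit Defensive.

(** Write [Q = q - p0]. The cut sigma(q) is parametrized by the angles [a], [b]
    through [p0 + kap Q a b], where [kap = r0 l]; the vector [Q - kap = r n] is
    null as well. All integrals are over the rectangle of angles, with the
    density [area_weight], which is [4 / Q^2] times the area density of the cut.
    The formula comes from integrations by parts on the sphere of angles: a
    derivative in [b] integrates to zero by periodicity, and a derivative in [a]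
    of something that vanishes at both poles as well.

    Kirchhoff formula. The massless equation implies that every component [f] of
    the field solves the wave equation in the chronological future of [p0]
    ([massless_wave]). Contract the sphere to the vertex [q] along the null
    segments [q - s (Q - kap)], and consider the integral of the weight times
    [s D_kap f + f]. Since [kap], [Q - kap] and the two tangent vectors [kap_a],
    [kap_b] span space-time ([rank2_completeness]), the wave equation turns the
    derivative in [s] into a divergence on the sphere, so the integral is the
    same on the cut ([s = 1]) and at the vertex ([s = 0]). At the vertex it is
    [f q] times the total weight, which is [4 pi] ([total_weight]). Hence the
    integral of [D_kap phi + phi] against the weight is [4 pi phi(q)]
    ([kirchhoff]).

    Ladder. The matrix [- o^A iota_B] ([slot_proj_dyad]) projects an index on the
    dyad. Let [rung i] be the weighted integral of [D_kap phi + (i + 1) phi] in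
    which the first [i] indices are projected. Then [rung i = rung (i + 1)]
    ([rung_step]), because the difference of the integrands is again a
    divergence: the massless equation disposes of the derivative of the field,
    and the derivatives of the projectors already present are handled by the
    symmetry of [phi] and the Fierz identity; each of them adds one to the
    coefficient of [phi]. So [rung n], where all indices are contracted with [o]
    and replaced by [iota], is the Kirchhoff integral [rung 0].

    Comparison. The integrand of [rung n] is that of the formula, since
    [D_kap = r0 D_l], since [rho = - 1 / r0] ([rho_eq]: a light cone is shear-free
    and expands like the affine distance), and since the weight times [r0] is
    [2 / r] times the area density, by [Q^2 = 2 r0 r]. Each projector brings a
    minus sign, whence [(-1)^n]. *)

(** * Integrals over the rectangle of angles *)

Section interval_integrals.
Context {R : realType}.
Local Notation mu := (@lebesgue_measure R).

Lemma continuous_integrable (f : R -> R) (x y : R) :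
  continuous f -> mu.-integrable `[x, y] (EFin \o f).
Proof.
move=> cf; apply: continuous_compact_integrable; first exact: segment_compact.
exact: continuous_subspaceT.
Qed.

Lemma continuous2_snd (T U V : topologicalType) (F : T -> U -> V) t :
  continuous (fun p : T * U => F p.1 p.2) -> continuous (F t).
Proof.
move=> cF u; apply: (@continuous_comp _ _ _ (fun u => (t, u)) (fun p => F p.1 p.2)).
  by apply: cvg_pair; [exact: cvg_cst|exact: cvg_id].
exact: cF.
Qed.

Lemma continuous_pair (T U V : topologicalType) (f : T -> U) (g : T -> V) :
  continuous f -> continuous g -> continuous (fun x => (f x, g x)).
Proof. by move=> cf cg x; apply: cvg_pair; [exact: cf|exact: cg]. Qed.

(** By compactness of the interval, continuity in the parameter is uniform in
    the variable of integration. *)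
Lemma tube (T : topologicalType) (F : T -> R -> R) (x y : R) (t : T) (e : R) : 0 < e ->
  continuous (fun p : T * R => F p.1 p.2) ->
  \forall t' \near t, forall b, `[x, y]%classic b -> `|F t' b - F t b| < e.
Proof.
move=> e0 cF.
have /compact_near_coveringP K := @segment_compact R x y.
apply: (K _ (nbhs t) (fun t' b => `|F t' b - F t b| < e)) => b _.
have e20 : 0 < e / 2 by rewrite divr_gt0.
have /cvgrPdist_lt/(_ _ e20) := cF (t, b).
have /cvgrPdist_lt/(_ _ e20) := @continuous2_snd _ _ _ F t cF b.
move=> H1 [[U V]/= [tU bV] UV].
exists (V `&` [set b' | `|F t b - F t b'| < e / 2], U) => /=.
  by split; [exact: filterI|].
move=> [b' t'] /= [[Vb' H] Ut'].
have := UV (t', b') (conj Ut' Vb') => /= H2.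
rewrite (splitr e) -(subrKA (F t b)).
apply: le_lt_trans (ler_normD _ _) _.
by rewrite ltrD// distrC.
Qed.

Lemma continuous_integral (T : topologicalType) (F : T -> R -> R) (x y : R) :
  x <= y -> continuous (fun p : T * R => F p.1 p.2) ->
  continuous (fun t => \int[mu]_(b in `[x, y]) F t b).
Proof.
move=> xy cF t; apply/cvgrPdist_le => e e0.
pose d := e / (y - x + 1).
have d0 : 0 < d by rewrite divr_gt0// ltr_wpDl// subr_ge0.
near=> t'.
have iF u : mu.-integrable `[x, y] (EFin \o F u).
  by apply: continuous_integrable; exact: continuous2_snd.
have iD : mu.-integrable `[x, y] (EFin \o (fun b => F t b - F t' b)).
  apply: continuous_integrable => b; apply: continuousB;
    exact: (continuous2_snd cF).
rewrite -RintegralB//.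
apply: le_trans (le_normr_Rintegral _ iD) _ => //.
apply: (@le_trans _ _ (\int[mu]_(b in `[x, y]) d)).
  apply: le_Rintegral => //.
  - apply: continuous_integrable => b; apply: cvg_norm.
    apply: continuousB; exact: (continuous2_snd cF).
  - by apply: continuous_integrable => b; exact: cvg_cst.
  - move=> b xyb; apply: ltW; rewrite distrC; move: b xyb.
    by near: t'; exact: tube.
rewrite Rintegral_cst//= lebesgue_measure_itv/= lte_fin.
case: ltP => [_|_]; last by rewrite mulr0 ltW.
rewrite -EFinB /= /d -mulrA ler_piMr ?(ltW e0)// mulrC ler_pdivrMr; last first.
  by rewrite ltr_wpDl// subr_ge0.
by rewrite mul1r lerDl.
Unshelve. all: by end_near. Qed.

(** Domination by the values at [t] plus one, which is legitimate near [t] by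
    [tube]. *)
Lemma is_derive_integral (F dF : R -> R -> R) (x y : R) (t : R) : x <= y ->
  continuous (fun p : R * R => F p.1 p.2) ->
  continuous (fun p : R * R => dF p.1 p.2) ->
  (forall s b : R, is_derive s 1 (F ^~ b) (dF s b)) ->
  is_derive t 1 (fun s => \int[mu]_(b in `[x, y]) F s b)
    (\int[mu]_(b in `[x, y]) dF t b).
Proof.
move=> xy cF cdF dFE.
have [e /= e0 He] := tube x y t ltr01 cdF.
have pF s b : partial1of2 F s b = dF s b.
  by rewrite partial1of2E; apply: derive_val; exact: dFE.
pose G (b : R) : R := `|dF t b| + 1.
have cG : continuous G.
  move=> b; apply: cvgD; last exact: cvg_cst.
  by apply: cvg_norm; exact: (continuous2_snd cdF).
have tI : [set` `]t - e, t + e[] t.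
  by rewrite /= in_itv /= ltrBlDr ltrDl e0.
have intf (s : R) : [set` `]t - e, t + e[] s -> mu.-integrable `[x, y] (EFin \o F s).
  by move=> _; apply: continuous_integrable; exact: continuous2_snd.
have Gub (s b : R) : [set` `]t - e, t + e[] s -> `[x, y]%classic b -> `|partial1of2 F s b| <= G b.
  move=> /= ts xyb; rewrite pF /G.
  have ets : `|t - s| < e by move: ts; rewrite in_itv /= ltr_distl; lra.
  have := He s ets b xyb => h.
  rewrite -[dF s b](subrK (dF t b)) addrC; apply: le_trans (ler_normD _ _) _.
  by rewrite lerD2l ltW.
have mI : measurable ([set` `[x, y]] : set (measurableTypeR R)) by [].
have df1 (s b : R) : [set` `]t - e, t + e[] s -> `[x, y]%classic b -> derivable (F ^~ b) s 1.
  by move=> _ _; apply: ex_derive; exact: dFE.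
have iG : mu.-integrable `[x, y] (EFin \o G) by exact: continuous_integrable.
have G0 b : 0 <= G b by rewrite addr_ge0.
apply: DeriveDef.
  exact: (derivable_under_integral mI tI intf df1 G0 iG Gub).
rewrite -derive1E.
rewrite (differentiation_under_integral mI tI intf df1 G0 iG Gub).
by apply: eq_Rintegral => b _; rewrite pF.
Qed.

Lemma integral_derive (F f : R -> R) (x y : R) : x <= y -> continuous f ->
  (forall t : R, is_derive t 1 F (f t)) ->
  \int[mu]_(t in `[x, y]) f t = F y - F x.
Proof.
rewrite le_eqVlt => /predU1P[->|xy] cf dF.
  by rewrite set_itv1 Rintegral_set1 subrr.
have cF : continuous F.
  move=> t; apply: differentiable_continuous; apply/derivable1_diffP.
  by apply: ex_derive; exact: dF.
rewrite /Rintegral (@continuous_FTC2 _ f F)//.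
- exact: continuous_subspaceT.
- split; first by move=> t _; apply: ex_derive; exact: dF.
  + by apply: cvg_at_right_filter; exact: cF.
  + by apply: cvg_at_left_filter; exact: cF.
- by move=> t _; rewrite derive1E; apply: derive_val; exact: dF.
Qed.

End interval_integrals.

Section rectangle_integral.
Context {R : realType}.
Local Notation mu := (@lebesgue_measure R).
Implicit Types f g : R -> R -> R.

Definition rect_integral f : R :=
  \int[mu]_(a in `[0, pi]) \int[mu]_(b in `[0, pi *+ 2]) f a b.

Definition continuous2 f := continuous (fun p : R * R => f p.1 p.2).

Lemma pi2_ge0 : 0 <= pi *+ 2 :> R.
Proof. by rewrite mulrn_wge0// pi_ge0. Qed.

Lemma continuous_inner f : continuous2 f ->
  continuous (fun a => \int[mu]_(b in `[0, pi *+ 2]) f a b).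
Proof. by move=> cf; apply: continuous_integral => //; exact: pi2_ge0. Qed.

(** Agreement is required only where the sine of the colatitude is nonnegative,
    so that the square root in the area density simplifies. *)
Lemma rect_integral_eq f g :
  (forall a b, 0 <= sin a -> f a b = g a b) -> rect_integral f = rect_integral g.
Proof.
move=> fg; apply: eq_Rintegral => a; rewrite inE /= in_itv/= => api.
by apply: eq_Rintegral => b _; apply: fg; apply: sin_ge0_pi.
Qed.

Lemma rect_integralD f g : continuous2 f -> continuous2 g ->
  rect_integral (fun a b => f a b + g a b) = rect_integral f + rect_integral g.
Proof.
move=> cf cg; rewrite /rect_integral.
rewrite -RintegralD//; last 2 first.
- by apply: continuous_integrable; exact: continuous_inner.
- by apply: continuous_integrable; exact: continuous_inner.
apply: eq_Rintegral => a _; rewrite RintegralD//.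
- by apply: continuous_integrable; exact: (continuous2_snd cf).
- by apply: continuous_integrable; exact: (continuous2_snd cg).
Qed.

Lemma rect_integralZ f r : continuous2 f ->
  rect_integral (fun a b => r * f a b) = r * rect_integral f.
Proof.
move=> cf; rewrite /rect_integral -RintegralZl//; last first.
  by apply: continuous_integrable; exact: continuous_inner.
apply: eq_Rintegral => a _; rewrite RintegralZl//.
by apply: continuous_integrable; exact: (continuous2_snd cf).
Qed.

(** Divergence theorem in longitude: the boundary terms cancel by periodicity. *)
Lemma rect_integral_db (F f : R -> R -> R) : continuous2 f ->
  (forall a b : R, is_derive b 1 (F a) (f a b)) ->
  (forall a, F a (pi *+ 2) = F a 0) -> rect_integral f = 0.
Proof.
move=> cf dF FE; rewrite /rect_integral.
under eq_Rintegral => a _.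
  rewrite (@integral_derive _ (F a))//; [|exact: pi2_ge0|exact: (continuous2_snd cf)].
  rewrite FE subrr; over.
by rewrite Rintegral_cst// mul0r.
Qed.

(** Divergence theorem in colatitude: there is no boundary term when the
    integrand vanishes at the two poles. *)
Lemma rect_integral_da (F f : R -> R -> R) : continuous2 F -> continuous2 f ->
  (forall a b : R, is_derive a 1 (F ^~ b) (f a b)) ->
  (forall b, F 0 b = 0) -> (forall b, F pi b = 0) -> rect_integral f = 0.
Proof.
move=> cF cf dF F0 Fpi; rewrite /rect_integral.
pose I (h : R -> R -> R) (a : R) := \int[mu]_(b in `[0, pi *+ 2]) h a b.
have dI (a : R) : is_derive a 1 (I F) (I f a).
  by apply: is_derive_integral => //; exact: pi2_ge0.
rewrite -[LHS]/(\int[mu]_(a in `[0, pi]) I f a).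
rewrite (integral_derive (pi_ge0 R) (continuous_inner cf) dI) /I.
under eq_Rintegral do rewrite Fpi.
under [X in _ - X]eq_Rintegral do rewrite F0.
by rewrite subrr.
Qed.

Lemma is_derive_rect_integral (F f : R -> R -> R -> R) (t : R) :
  continuous (fun p : R * R * R => F p.1.1 p.1.2 p.2) ->
  continuous (fun p : R * R * R => f p.1.1 p.1.2 p.2) ->
  (forall s a b : R, is_derive s 1 (fun s => F s a b) (f s a b)) ->
  is_derive t 1 (fun s => rect_integral (F s)) (rect_integral (f t)).
Proof.
move=> cF cf dF.
apply: (@is_derive_integral _
  (fun s a => \int[mu]_(b in `[0, pi *+ 2]) F s a b)
  (fun s a => \int[mu]_(b in `[0, pi *+ 2]) f s a b)).
- exact: pi_ge0.
- by apply: (@continuous_integral _ _ (fun p : R * R => F p.1 p.2)) => //;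
    exact: pi2_ge0.
- by apply: (@continuous_integral _ _ (fun p : R * R => f p.1 p.2)) => //;
    exact: pi2_ge0.
- move=> s a.
  apply: (@is_derive_integral _ (fun s b => F s a b) (fun s b => f s a b)) => //.
  + exact: pi2_ge0.
  + move=> p; apply: (@continuous_comp _ _ _ (fun p : R * R => (p.1, a, p.2))
      (fun p : R * R * R => F p.1.1 p.1.2 p.2)); last exact: cF.
    apply: continuous_pair => [q|q]; last exact: cvg_snd.
    by apply: continuous_pair => [{}q|{}q]; [exact: cvg_fst|exact: cvg_cst].
  + move=> p; apply: (@continuous_comp _ _ _ (fun p : R * R => (p.1, a, p.2))
      (fun p : R * R * R => f p.1.1 p.1.2 p.2)); last exact: cf.
    apply: continuous_pair => [q|q]; last exact: cvg_snd.
    by apply: continuous_pair => [{}q|{}q]; [exact: cvg_fst|exact: cvg_cst].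
Qed.

End rectangle_integral.

(** * Complex-valued functions of real variables *)

Section pointwise_derivation_rules.
Context {R : realType}.
Implicit Types (f g : R -> R) (t df dg : R).

Lemma is_deriveD_fun f g t df dg : is_derive t 1 f df -> is_derive t 1 g dg ->
  is_derive t 1 (fun x => f x + g x) (df + dg).
Proof. by move=> ? ?; exact: (@is_deriveD _ _ _ f g). Qed.

Lemma is_deriveB_fun f g t df dg : is_derive t 1 f df -> is_derive t 1 g dg ->
  is_derive t 1 (fun x => f x - g x) (df - dg).
Proof. by move=> ? ?; exact: (@is_deriveB _ _ _ f g). Qed.

Lemma is_deriveM_fun f g t df dg : is_derive t 1 f df -> is_derive t 1 g dg ->
  is_derive t 1 (fun x => f x * g x) (df * g t + f t * dg).
Proof.
move=> fd gd; have fgd := is_deriveM fd gd.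
apply: is_derive_eq fgd _.
by rewrite /GRing.scale /=; ring.
Qed.

End pointwise_derivation_rules.

Section complex_valued.
Context {R : realType}.
Local Notation Re := (@complex.Re R).
Local Notation Im := (@complex.Im R).

Lemma complex_ext (z w : R[i]) : Re z = Re w -> Im z = Im w -> z = w.
Proof. by case: z => a b; case: w => c d /= -> ->. Qed.

Lemma complexReD (z w : R[i]) : Re (z + w) = Re z + Re w.
Proof. by case: z; case: w. Qed.

Lemma complexImD (z w : R[i]) : Im (z + w) = Im z + Im w.
Proof. by case: z; case: w. Qed.

Lemma complexReM (z w : R[i]) : Re (z * w) = Re z * Re w - Im z * Im w.
Proof. by case: z => a b; case: w. Qed.

Lemma complexImM (z w : R[i]) : Im (z * w) = Re z * Im w + Im z * Re w.
Proof. by case: z => a b; case: w. Qed.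

(** Taken on real and imaginary parts, as in [pd]. *)
Definition is_cderive (f : R -> R[i]) (t : R) (d : R[i]) : Prop :=
  is_derive t 1 (fun x => Re (f x)) (Re d) /\
  is_derive t 1 (fun x => Im (f x)) (Im d).

Definition ccontinuous (T : topologicalType) (f : T -> R[i]) : Prop :=
  continuous (fun x => Re (f x)) /\ continuous (fun x => Im (f x)).

Lemma is_cderive_eq f t d d' : is_cderive f t d -> d = d' -> is_cderive f t d'.
Proof. by move=> ? <-. Qed.

Lemma is_cderive_unique f t d d' : is_cderive f t d -> is_cderive f t d' -> d = d'.
Proof.
move=> [r1 i1] [r2 i2]; apply: complex_ext.
  by rewrite -(@derive_val _ _ _ _ _ _ _ r1) -(@derive_val _ _ _ _ _ _ _ r2).
by rewrite -(@derive_val _ _ _ _ _ _ _ i1) -(@derive_val _ _ _ _ _ _ _ i2).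
Qed.

Lemma is_cderive_cst z t : is_cderive (fun=> z) t 0.
Proof. by split; apply: is_derive_cst. Qed.

Lemma is_cderive_real (f : R -> R) (t d : R) :
  is_derive t 1 f d -> is_cderive (fun x => (f x)%:C) t d%:C.
Proof. by move=> fd; split => //=; exact: is_derive_cst. Qed.

Lemma is_cderiveD f g t df dg : is_cderive f t df -> is_cderive g t dg ->
  is_cderive (fun x => f x + g x) t (df + dg).
Proof.
move=> [fr fi] [gr gi]; split.
  by rewrite complexReD; under eq_fun do rewrite complexReD; exact: is_deriveD_fun.
by rewrite complexImD; under eq_fun do rewrite complexImD; exact: is_deriveD_fun.
Qed.

Lemma is_cderiveM f g t df dg : is_cderive f t df -> is_cderive g t dg ->
  is_cderive (fun x => f x * g x) t (df * g t + f t * dg).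
Proof.
move=> [fr fi] [gr gi]; split.
  under eq_fun do rewrite complexReM.
  apply: is_derive_eq (is_deriveB_fun (is_deriveM_fun fr gr) (is_deriveM_fun fi gi)) _.
  by rewrite !complexReD !complexReM; ring.
under eq_fun do rewrite complexImM.
apply: is_derive_eq (is_deriveD_fun (is_deriveM_fun fr gi) (is_deriveM_fun fi gr)) _.
by rewrite !complexImD !complexImM; ring.
Qed.

Lemma is_cderiveZ z f t d : is_cderive f t d -> is_cderive (fun x => z * f x) t (z * d).
Proof.
move=> fd; apply: is_cderive_eq; first by apply: is_cderiveM fd; exact: is_cderive_cst.
by rewrite mul0r add0r.
Qed.

Lemma is_cderive_sum (I : Type) (r : seq I) (P : pred I) (f : I -> R -> R[i]) t
    (d : I -> R[i]) : (forall i, is_cderive (f i) t (d i)) ->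
  is_cderive (fun x => \sum_(i <- r | P i) f i x) t (\sum_(i <- r | P i) d i).
Proof.
move=> fd; elim: r => [|i r IH].
  by rewrite big_nil; under eq_fun do rewrite big_nil; exact: is_cderive_cst.
rewrite big_cons; under eq_fun do rewrite big_cons.
by case: (P i) => //; exact: is_cderiveD.
Qed.

Lemma is_cderive_prod (I : finType) (f : I -> R -> R[i]) t (d : I -> R[i]) :
  (forall i, is_cderive (f i) t (d i)) ->
  is_cderive (fun x => \prod_i f i x) t
    (\sum_k \prod_i (if i == k then d i else f i t)).
Proof.
move=> fd.
suff H (r : seq I) : uniq r -> is_cderive (fun x => \prod_(i <- r) f i x) t
    (\sum_(k <- r) \prod_(i <- r) (if i == k then d i else f i t)).
  have := H (index_enum I) (index_enum_uniq I).
  by [].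
elim: r => [|j r IH] /=.
  by rewrite big_nil => _; under eq_fun do rewrite big_nil; exact: is_cderive_cst.
move=> /andP[jr ur]; under eq_fun do rewrite big_cons.
apply: is_cderive_eq; first exact: is_cderiveM (fd j) (IH ur).
rewrite big_cons big_cons eqxx; congr (_ * _ + _).
  rewrite big_seq [RHS]big_seq; apply: eq_bigr => i ir.
  by case: eqP => // ij; rewrite -ij ir in jr.
rewrite mulr_sumr big_seq [RHS]big_seq; apply: eq_bigr => k kr.
rewrite big_cons; case: eqP => // jk.
by rewrite jk kr in jr.
Qed.

Lemma ccontinuous_cst (T : topologicalType) z : ccontinuous (fun _ : T => z).
Proof. by split => x; exact: cvg_cst. Qed.

Lemma ccontinuous_real (T : topologicalType) (f : T -> R) :
  continuous f -> ccontinuous (fun x => (f x)%:C).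
Proof. by move=> cf; split => //= x; exact: cvg_cst. Qed.

Lemma ccontinuousD (T : topologicalType) (f g : T -> R[i]) :
  ccontinuous f -> ccontinuous g -> ccontinuous (fun x => f x + g x).
Proof.
move=> [fr fi] [gr gi]; split.
  by under eq_fun do rewrite complexReD; move=> x; apply: cvgD; [exact: fr|exact: gr].
by under eq_fun do rewrite complexImD; move=> x; apply: cvgD; [exact: fi|exact: gi].
Qed.

Lemma ccontinuousM (T : topologicalType) (f g : T -> R[i]) :
  ccontinuous f -> ccontinuous g -> ccontinuous (fun x => f x * g x).
Proof.
move=> [fr fi] [gr gi]; split.
  under eq_fun do rewrite complexReM; move=> x; apply: cvgB; apply: cvgM;
    by [exact: fr|exact: gr|exact: fi|exact: gi].
under eq_fun do rewrite complexImM; move=> x; apply: cvgD; apply: cvgM;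
  by [exact: fr|exact: gr|exact: fi|exact: gi].
Qed.

Lemma ccontinuous_sum (T : topologicalType) (I : Type) (r : seq I) (P : pred I)
    (f : I -> T -> R[i]) : (forall i, ccontinuous (f i)) ->
  ccontinuous (fun x => \sum_(i <- r | P i) f i x).
Proof.
move=> cf; elim: r => [|i r IH].
  by under eq_fun do rewrite big_nil; exact: ccontinuous_cst.
under eq_fun do rewrite big_cons.
by case: (P i) => //; exact: ccontinuousD.
Qed.

Lemma ccontinuous_prod (T : topologicalType) (I : Type) (r : seq I) (P : pred I)
    (f : I -> T -> R[i]) : (forall i, ccontinuous (f i)) ->
  ccontinuous (fun x => \prod_(i <- r | P i) f i x).
Proof.
move=> cf; elim: r => [|i r IH].
  by under eq_fun do rewrite big_nil; exact: ccontinuous_cst.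
under eq_fun do rewrite big_cons.
by case: (P i) => //; exact: ccontinuousM.
Qed.

Lemma ccontinuous_comp (T U : topologicalType) (h : T -> U) (f : U -> R[i]) :
  continuous h -> ccontinuous f -> ccontinuous (fun x => f (h x)).
Proof.
move=> ch [fr fi]; split => x.
  exact: (@continuous_comp _ _ _ h (fun u => Re (f u)) x (ch x) (fr (h x))).
exact: (@continuous_comp _ _ _ h (fun u => Im (f u)) x (ch x) (fi (h x))).
Qed.

Definition ccontinuous2 (f : R -> R -> R[i]) :=
  ccontinuous (fun p : R * R => f p.1 p.2).

Definition rect_cintegral (f : R -> R -> R[i]) : R[i] :=
  rect_integral (fun a b => Re (f a b)) +i* rect_integral (fun a b => Im (f a b)).

Lemma rect_cintegral_eq f g :
  (forall a b, 0 <= sin a -> f a b = g a b) -> rect_cintegral f = rect_cintegral g.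
Proof.
move=> fg; apply: complex_ext.
  by apply: rect_integral_eq => a b a0; rewrite (fg a b a0).
by apply: rect_integral_eq => a b a0; rewrite (fg a b a0).
Qed.

Lemma rect_cintegralD f g : ccontinuous2 f -> ccontinuous2 g ->
  rect_cintegral (fun a b => f a b + g a b) = rect_cintegral f + rect_cintegral g.
Proof.
move=> [fr fi] [gr gi]; apply: complex_ext => /=.
  rewrite -(rect_integralD fr gr).
  by apply: rect_integral_eq => a b _; exact: complexReD.
rewrite -(rect_integralD fi gi).
by apply: rect_integral_eq => a b _; exact: complexImD.
Qed.

Lemma continuous2Z r (f : R -> R -> R) :
  continuous2 f -> continuous2 (fun a b => r * f a b).
Proof. by move=> cf x; apply: cvgM; [exact: cvg_cst|exact: cf]. Qed.

Lemma rect_cintegralZ z f : ccontinuous2 f ->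
  rect_cintegral (fun a b => z * f a b) = z * rect_cintegral f.
Proof.
move=> [fr fi]; apply: complex_ext; rewrite ?complexReM ?complexImM /=.
  rewrite -mulNr -(rect_integralZ (Re z) fr) -(rect_integralZ (- Im z) fi).
  rewrite -(rect_integralD (continuous2Z (r := Re z) fr) (continuous2Z (r := - Im z) fi)).
  by apply: rect_integral_eq => a b _; rewrite complexReM mulNr.
rewrite -(rect_integralZ (Re z) fi) -(rect_integralZ (Im z) fr).
rewrite -(rect_integralD (continuous2Z (r := Re z) fi) (continuous2Z (r := Im z) fr)).
by apply: rect_integral_eq => a b _; exact: complexImM.
Qed.

Lemma rect_cintegral_db (F f : R -> R -> R[i]) : ccontinuous2 f ->
  (forall a b, is_cderive (F a) b (f a b)) ->
  (forall a, F a (pi *+ 2) = F a 0) -> rect_cintegral f = 0.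
Proof.
move=> [fr fi] dF FE; apply: complex_ext => /=.
  apply: (@rect_integral_db _ (fun a b => Re (F a b))) => //.
  - by move=> a b; exact: (dF a b).1.
  - by move=> a; rewrite FE.
apply: (@rect_integral_db _ (fun a b => Im (F a b))) => //.
- by move=> a b; exact: (dF a b).2.
- by move=> a; rewrite FE.
Qed.

Lemma rect_cintegral_da (F f : R -> R -> R[i]) :
  ccontinuous2 F -> ccontinuous2 f ->
  (forall a b, is_cderive (F ^~ b) a (f a b)) ->
  (forall b, F 0 b = 0) -> (forall b, F pi b = 0) -> rect_cintegral f = 0.
Proof.
move=> [Fr Fi] [fr fi] dF F0 Fpi; apply: complex_ext => /=.
  apply: (@rect_integral_da _ (fun a b => Re (F a b))) => //.
  - by move=> a b; exact: (dF a b).1.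
  - by move=> b; rewrite F0.
  - by move=> b; rewrite Fpi.
apply: (@rect_integral_da _ (fun a b => Im (F a b))) => //.
- by move=> a b; exact: (dF a b).2.
- by move=> b; rewrite F0.
- by move=> b; rewrite Fpi.
Qed.

Lemma is_cderive_rect_cintegral (F f : R -> R -> R -> R[i]) t :
  ccontinuous (fun p : R * R * R => F p.1.1 p.1.2 p.2) ->
  ccontinuous (fun p : R * R * R => f p.1.1 p.1.2 p.2) ->
  (forall s a b, is_cderive (fun s => F s a b) s (f s a b)) ->
  is_cderive (fun s => rect_cintegral (F s)) t (rect_cintegral (f t)).
Proof.
move=> [Fr Fi] [fr fi] dF; split => /=.
  apply: (@is_derive_rect_integral _ (fun s a b => Re (F s a b))
    (fun s a b => Re (f s a b))) => // s a b; exact: (dF s a b).1.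
apply: (@is_derive_rect_integral _ (fun s a b => Im (F s a b))
    (fun s a b => Im (f s a b))) => // s a b; exact: (dF s a b).2.
Qed.

End complex_valued.

(** * Infeld-van der Waerden matrices and contractions of spinor tensors *)

Section minkowski_matrices.
Context {R : realType}.
Local Notation C := R[i].
Local Notation S := (infeld R).
Local Notation g_ := (@inv_metric C).

(** Entries indexed by plain numbers, so that they reduce by computation. *)
Definition pauli (a A A' : nat) : C :=
  match a with
  | 0%N => (A == A')%:R
  | 1%N => (A != A')%:R
  | 2%N => if A == A' then 0 else if A == 0%N then 0 +i* 1 else - (0 +i* 1)
  | _ => if A != A' then 0 else if A == 0%N then 1 else - 1
  end.

Lemma ord2 (A : 'I_2) : A = 0 \/ A = 1.
Proof. by case: A => [[|[|//]] ?]; [left|right]; apply/val_inj. Qed.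

Lemma infeldE (a : 'I_4) (A A' : 'I_2) : S a A A' = ((Num.sqrt 2)^-1)%:C * pauli a A A'.
Proof.
rewrite mxE; congr (_ * _).
case: a => [[|[|[|[|//]]]] ?]; case: (ord2 A) => ->; case: (ord2 A') => ->;
  rewrite /= !mxE /= /pauli /= ?mulr1 ?mulr0 ?mulrN1 ?subr0 ?sub0r ?addr0 ?add0r ?subrr ?mulr0 ?mulr1 ?mulrN1//.
all: try by apply/eqP; rewrite eq_complex /= !(mulr0, mulr1, mul0r, addr0, subr0, oppr0, sub0r, opprK, add0r, mulrN1, mul1r, eqxx).
Qed.

(** The Clifford relation of [u^{AA'}] with its adjugate, which encodes
    [g_{ab} = epsilon_{AB} epsilon_{A'B'}]. *)
Lemma infeld_clifford (b c : 'I_4) :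
  g_ c *: (S b *m S c) + g_ b *: (S c *m S b) = ((b == c)%:R * g_ b)%:M.
Proof.
have t2 : ((Num.sqrt 2)^-1)%:C * ((Num.sqrt 2)^-1)%:C * 2 = 1 :> C.
  by rewrite mulr_natr -rmorphM -rmorphMn sqrt2V2.
have e1 : lift ord0 ord0 = 1 :> 'I_2 by apply/val_inj.
apply/matrixP => A A'; rewrite !mxE !(big_ord_recl, big_ord0) e1 !infeldE /inv_metric.
set t := _%:C in t2 *.
have ii : (0 +i* 1) * (0 +i* 1) = - 1 :> C.
  by apply/eqP; rewrite eq_complex /= !(mulr0, mulr1, mul0r, addr0, subr0, oppr0, sub0r, add0r, eqxx).
rewrite /pauli; move: (0 +i* 1) ii => im ii.
rewrite -!val_eqE.
case: b => [[|[|[|[|//]]]] ?]; case: c => [[|[|[|[|//]]]] ?];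
case: (ord2 A) => ->; case: (ord2 A') => ->; rewrite /= ?mulr1n ?mulr0n.
all: by [ring: ii t2 | apply: oppr_inj; ring: ii t2].
Qed.
(** The metric [g^{ab}] becomes [epsilon^{AB} epsilon^{A'B'}], which is
    antisymmetric in the pair of unprimed indices. *)
Lemma infeld_fierz (A A' B B' : 'I_2) :
  \sum_c g_ c * (S c A A' * S c B B' + S c B A' * S c A B') = 0.
Proof.
under eq_bigr do rewrite !infeldE.
move: ((Num.sqrt 2)^-1)%:C => t; rewrite !(big_ord_recl, big_ord0) /inv_metric /pauli.
have ii : (0 +i* 1) * (0 +i* 1) = - 1 :> C.
  by apply/eqP; rewrite eq_complex /= !(mulr0, mulr1, mul0r, addr0, subr0, oppr0, sub0r, add0r, eqxx).
move: (0 +i* 1) ii => im ii.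
case: (ord2 A) => ->; case: (ord2 A') => ->; case: (ord2 B) => ->; case: (ord2 B') => ->;
 rewrite /=; ring: ii.
Qed.
End minkowski_matrices.

Section spinor_matrices.
Context {R : realType}.
Local Notation C := R[i].
Local Notation S := (infeld R).
Local Notation g_ := (@inv_metric C).
(** The spinor form [x^{AA'}]. *)
Definition mat (x : 'rV[C]_4) : 'M[C]_2 := \sum_a x 0 a *: S a.
(** The adjugate of [mat x]: reversing the spatial components lowers both indices. *)
Definition comat (x : 'rV[C]_4) : 'M[C]_2 := \sum_a (x 0 a * g_ a) *: S a.

Lemma matD x y : mat (x + y) = mat x + mat y.
Proof.
by rewrite /mat -big_split; apply: eq_bigr => a _; rewrite mxE scalerDl.
Qed.

Lemma matZ z x : mat (z *: x) = z *: mat x.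
Proof.
by rewrite /mat scaler_sumr; apply: eq_bigr => a _; rewrite mxE scalerA.
Qed.

Lemma comatD x y : comat (x + y) = comat x + comat y.
Proof.
by rewrite /comat -big_split; apply: eq_bigr => a _; rewrite mxE mulrDl scalerDl.
Qed.

Lemma comatZ z x : comat (z *: x) = z *: comat x.
Proof.
by rewrite /comat scaler_sumr; apply: eq_bigr => a _; rewrite mxE scalerA mulrA.
Qed.

Lemma mink_formE (K : comNzRingType) (x y : 'rV[K]_4) :
  mink_form x y = \sum_a @inv_metric K a * (x 0 a * y 0 a).
Proof.
rewrite /mink_form [RHS]big_ord_recl {1}/inv_metric /= mul1r; congr (_ + _).
by rewrite -sumrN; apply: eq_bigr => a _; rewrite /inv_metric /= mulN1r.
Qed.

Lemma mat_comatD x y : mat x *m comat y + mat y *m comat x = (mink_form x y)%:M.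
Proof.
rewrite /mat /comat !mulmx_suml.
rewrite (eq_bigr (fun b => \sum_c (x 0 b * y 0 c) *: (g_ c *: (S b *m S c)))); last first.
  move=> b _; rewrite mulmx_sumr; apply: eq_bigr => c _.
  by rewrite -scalemxAl -scalemxAr !scalerA; congr (_ *: _); ring.
rewrite [X in _ + X = _](eq_bigr (fun c =>
    \sum_b (x 0 b * y 0 c) *: (g_ b *: (S c *m S b)))); last first.
  move=> c _; rewrite mulmx_sumr; apply: eq_bigr => b _.
  by rewrite -scalemxAl -scalemxAr !scalerA; congr (_ *: _); ring.
rewrite [X in _ + X = _]exchange_big -big_split mink_formE /=.
rewrite raddf_sum /=; apply: eq_bigr => b _.
rewrite -big_split /=; under eq_bigr do rewrite -scalerDr infeld_clifford.
rewrite (bigD1 b)//= big1 ?addr0 => [|c /negbTE cb].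
  by rewrite eqxx mul1r scale_scalar_mx; congr (_%:M); ring.
by rewrite eq_sym cb mul0r raddf0 scaler0.
Qed.

Lemma mat_comat x : mat x *m comat x = (mink_form x x / 2)%:M.
Proof.
have two0 : 2 != 0 :> C by rewrite pnatr_eq0.
have /matrixP E := mat_comatD x x; apply/matrixP => i j.
apply: (mulIf two0); rewrite mulr_natr mulr2n.
have := E i j; rewrite mxE => ->; rewrite !mxE mulrnAl.
by rewrite divfK.
Qed.

Lemma mink_formC (K : comNzRingType) (x y : 'rV[K]_4) : mink_form x y = mink_form y x.
Proof. by rewrite !mink_formE; apply: eq_bigr => a _; rewrite [x _ _ * _]mulrC. Qed.

Lemma mink_formDl (K : comNzRingType) (x y z : 'rV[K]_4) :
  mink_form (x + y) z = mink_form x z + mink_form y z.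
Proof.
by rewrite !mink_formE -big_split; apply: eq_bigr => a _; rewrite mxE /=; ring.
Qed.

Lemma mink_formZl (K : comNzRingType) r (x z : 'rV[K]_4) :
  mink_form (r *: x) z = r * mink_form x z.
Proof.
by rewrite !mink_formE mulr_sumr; apply: eq_bigr => a _; rewrite mxE /=; ring.
Qed.

Lemma mink_formDr (K : comNzRingType) (x y z : 'rV[K]_4) :
  mink_form z (x + y) = mink_form z x + mink_form z y.
Proof. by rewrite mink_formC mink_formDl !(mink_formC z). Qed.

Lemma mink_formZr (K : comNzRingType) r (x z : 'rV[K]_4) :
  mink_form z (r *: x) = r * mink_form z x.
Proof. by rewrite mink_formC mink_formZl (mink_formC z). Qed.

Lemma mink_form_cplx (x y : 'rV[R]_4) :
  mink_form (cplx x) (cplx y) = (mink_form x y)%:C.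
Proof.
rewrite !mink_formE rmorph_sum; apply: eq_bigr => a _; rewrite !mxE /= !rmorphM.
by congr (_ * _); rewrite /inv_metric; case: ifP; rewrite ?rmorphN ?rmorph1.
Qed.

Lemma cplxD (x y : 'rV[R]_4) : cplx (x + y) = cplx x + cplx y.
Proof. by apply/rowP => a; rewrite !mxE rmorphD. Qed.

Lemma cplxZ r (x : 'rV[R]_4) : cplx (r *: x) = r%:C *: cplx x.
Proof. by apply/rowP => a; rewrite !mxE rmorphM. Qed.

End spinor_matrices.

Section tensors.
Context {R : realType} {n : nat}.
Local Notation C := R[i].
Local Notation S := (infeld R).
Local Notation g_ := (@inv_metric C).
Implicit Types (Phi : spinor_tensor R n) (A : 'I_n -> 'M[C]_2) (I J : spindex n).

Definition upd A (j : 'I_n) (X : 'M[C]_2) : 'I_n -> 'M[C]_2 :=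
  fun k => if k == j then X else A k.

Definition transvect Phi A : spinor_tensor R n :=
  fun I => \sum_J Phi J * \prod_k A k (J k) (I k).

Lemma transvect_upd Phi A j X I :
  transvect Phi (upd A j X) I =
  \sum_J Phi J * (X (J j) (I j) * \prod_(k | k != j) A k (J k) (I k)).
Proof.
apply: eq_bigr => J _; congr (_ * _).
rewrite (bigD1 j)//= /upd eqxx; congr (_ * _).
by apply: eq_bigr => k /negbTE ->.
Qed.

Lemma eq_transvect Phi A B I : A =1 B -> transvect Phi A I = transvect Phi B I.
Proof.
by move=> AB; apply: eq_bigr => J _; congr (_ * _); apply: eq_bigr => k _; rewrite AB.
Qed.

Lemma upd_upd A j X Y : upd (upd A j X) j Y =1 upd A j Y.
Proof. by move=> k; rewrite /upd; case: eqP. Qed.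

Lemma upd_updC A j k X Y : j != k -> upd (upd A j X) k Y =1 upd (upd A k Y) j X.
Proof.
move=> jk l; rewrite /upd; case: eqP => [->|//].
by rewrite eq_sym (negbTE jk).
Qed.

Lemma transvectD Phi A j X Y I :
  transvect Phi (upd A j (X + Y)) I =
  transvect Phi (upd A j X) I + transvect Phi (upd A j Y) I.
Proof.
by rewrite !transvect_upd -big_split; apply: eq_bigr => J _; rewrite mxE /=; ring.
Qed.

Lemma transvectZ Phi A j z X I :
  transvect Phi (upd A j (z *: X)) I = z * transvect Phi (upd A j X) I.
Proof.
by rewrite !transvect_upd mulr_sumr; apply: eq_bigr => J _; rewrite mxE /=; ring.
Qed.

Lemma transvect0 Phi A j I : transvect Phi (upd A j 0) I = 0.
Proof. by rewrite -(scale0r 0) transvectZ mul0r. Qed.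

Lemma transvect_sum Phi A j (T : Type) (r : seq T) (X : T -> 'M[C]_2) I :
  transvect Phi (upd A j (\sum_(c <- r) X c)) I =
  \sum_(c <- r) transvect Phi (upd A j (X c)) I.
Proof.
elim: r => [|c r IH]; first by rewrite !big_nil transvect0.
by rewrite !big_cons transvectD IH.
Qed.

Lemma transvect_mat Phi A j x (Y : 'M[C]_2) I :
  transvect Phi (upd A j (mat x *m Y)) I =
  \sum_c x 0 c * transvect Phi (upd A j (S c *m Y)) I.
Proof.
rewrite /mat mulmx_suml transvect_sum; apply: eq_bigr => c _.
by rewrite -scalemxAl transvectZ.
Qed.

Lemma transvect_suml (x : 'rV[C]_4) (Phi : 'I_4 -> spinor_tensor R n) A I :
  transvect (fun J => \sum_b x 0 b * Phi b J) A I =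
  \sum_b x 0 b * transvect (Phi b) A I.
Proof.
under [RHS]eq_bigr do rewrite mulr_sumr.
rewrite exchange_big; apply: eq_bigr => J _; rewrite mulr_suml.
by apply: eq_bigr => b _; rewrite mulrA.
Qed.

Lemma transvectZl z Phi A I :
  transvect (fun J => z * Phi J) A I = z * transvect Phi A I.
Proof. by rewrite mulr_sumr; apply: eq_bigr => J _; rewrite mulrA. Qed.

Lemma sum_set_index (F : spindex n -> C) j :
  \sum_J F J = \sum_(J : spindex n | J j == 0) \sum_(A < 2) F (set_index J j A).
Proof.
rewrite (partition_big (fun J : spindex n => J j) predT)//= exchange_big /=.
apply: eq_bigr => A _.
rewrite (reindex_onto (fun J => set_index J j A) (fun J => set_index J j 0)) /=.
  apply: eq_bigl => J; rewrite !ffunE !eqxx /=.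
  apply/eqP/eqP => [<-|J0]; first by rewrite !ffunE eqxx.
  by apply/ffunP => k; rewrite !ffunE; case: eqP => [->|].
move=> J /eqP JA; apply/ffunP => k; rewrite !ffunE.
by case: eqP => [->|].
Qed.

(** Contracting the gradient with an index of the field through [infeld] is the
    massless operator, whatever is done to the primed index and the other slots. *)
Lemma transvect_massless (Phi : 'I_4 -> spinor_tensor R n) A (j : 'I_n)
    (Y : 'M[C]_2) I :
  (forall J (A' : 'I_2), \sum_(A < 2) \sum_(a < 4)
     S a A A' * g_ a * Phi a (set_index J j A) = 0) ->
  \sum_a g_ a * transvect (Phi a) (upd A j (S a *m Y)) I = 0.
Proof.
move=> H.
under eq_bigr => a _ do
  rewrite transvect_upd (sum_set_index _ j) mulr_sumr.
rewrite exchange_big /= big1// => J _.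
under eq_bigr do rewrite mulr_sumr.
rewrite exchange_big /=.
pose P : C := \prod_(k | k != j) A k (J k) (I k).
transitivity (\sum_(A' < 2) (Y A' (I j) * P) * \sum_(A < 2) \sum_(a < 4)
     S a A A' * g_ a * Phi a (set_index J j A)); last first.
  by rewrite big1// => A' _; rewrite H mulr0.
under [RHS]eq_bigr do rewrite mulr_sumr.
rewrite [RHS]exchange_big; apply: eq_bigr => B _.
under [RHS]eq_bigr do rewrite mulr_sumr.
rewrite [RHS]exchange_big; apply: eq_bigr => a _ /=.
have -> : \prod_(k | k != j) A k (set_index J j B k) (I k) = P.
  by apply: eq_bigr => k /negbTE kj; rewrite ffunE kj.
rewrite ffunE eqxx mxE mulr_suml !mulr_sumr; apply: eq_bigr => A' _.
by ring.
Qed.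

(** The trace over a pair of slots is antisymmetric in their unprimed indices by
    [infeld_fierz], while the tensor is symmetric. *)
Lemma transvect_fierz Phi A (j k : 'I_n) (X Y : 'M[C]_2) I : j != k ->
  (forall J, Phi [ffun l => J (tperm j k l)] = Phi J) ->
  \sum_c g_ c * transvect Phi (upd (upd A j (S c *m Y)) k (S c *m X)) I = 0.
Proof.
move=> jk sPhi.
pose P J : C := \prod_(l | (l != k) && (l != j)) A l (J l) (I l).
pose G J : C := \sum_c g_ c * ((S c *m X) (J k) (I k) * ((S c *m Y) (J j) (I j))).
have -> : \sum_c g_ c * transvect Phi (upd (upd A j (S c *m Y)) k (S c *m X)) I =
    \sum_J Phi J * (G J * P J).
  under eq_bigr do rewrite transvect_upd mulr_sumr.
  rewrite exchange_big; apply: eq_bigr => J _ /=.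
  rewrite /G mulr_suml mulr_sumr; apply: eq_bigr => c _.
  rewrite (bigD1 j)//= /upd eqxx.
  rewrite (eq_bigr (fun l => A l (J l) (I l))); first by rewrite /P; ring.
  by move=> l /andP[_ /negbTE ->].
pose tau J : spindex n := [ffun l => J (tperm j k l)].
have tauK : involutive tau.
  by move=> J; apply/ffunP => l; rewrite !ffunE tpermK.
(* Exchanging the two indices changes the sum into its opposite. *)
have E : \sum_J Phi J * (G J * P J) = - \sum_J Phi J * (G J * P J).
  rewrite {1}(reindex_inj (inv_inj tauK)) -sumrN; apply: eq_bigr => J _.
  rewrite sPhi -mulrN; congr (_ * _).
  have -> : P (tau J) = P J.
    apply: eq_bigr => l /andP[lk lj].
    by rewrite ffunE tpermD// eq_sym.
  rewrite -mulNr; congr (_ * _).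
  apply/eqP; rewrite -addr_eq0; apply/eqP.
  rewrite /G -big_split /=.
  transitivity (\sum_(A' < 2) \sum_(B' < 2) (X A' (I k) * Y B' (I j)) *
    \sum_c g_ c * (S c (J j) A' * S c (J k) B' + S c (J k) A' * S c (J j) B')).
    under [RHS]eq_bigr do under eq_bigr do rewrite mulr_sumr.
    under [RHS]eq_bigr do rewrite exchange_big.
    rewrite [RHS]exchange_big; apply: eq_bigr => c _ /=.
    rewrite /tau !ffunE tpermL tpermR !mxE -mulrDr.
    rewrite !mulr_suml -big_split mulr_sumr; apply: eq_bigr => A' _ /=.
    rewrite !mulr_sumr -big_split mulr_sumr; apply: eq_bigr => B' _ /=.
    by ring.
  by rewrite big1// => A' _; rewrite big1// => B' _; rewrite infeld_fierz mulr0.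
have /eqP : (\sum_J Phi J * (G J * P J)) *+ 2 = 0 by rewrite mulr2n {1}E addNr.
by rewrite mulrn_eq0 => /eqP.
Qed.

Lemma is_cderive_transvect (Phi : R -> spinor_tensor R n) (dPhi : spinor_tensor R n)
    (A : R -> 'I_n -> 'M[C]_2) (dA : 'I_n -> 'M[C]_2) I t :
  (forall J, is_cderive (fun s => Phi s J) t (dPhi J)) ->
  (forall k p q, is_cderive (fun s => A s k p q) t (dA k p q)) ->
  is_cderive (fun s => transvect (Phi s) (A s) I) t
    (transvect dPhi (A t) I + \sum_k transvect (Phi t) (upd (A t) k (dA k)) I).
Proof.
move=> dP dAE; apply: is_cderive_eq.
  apply: is_cderive_sum => J; apply: is_cderiveM; first exact: dP.
  by apply: is_cderive_prod => k; exact: dAE.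
rewrite [X in _ + X]exchange_big -big_split; apply: eq_bigr => J _ /=.
congr (_ + _); rewrite mulr_sumr; apply: eq_bigr => k _; congr (_ * _).
by apply: eq_bigr => l _; rewrite /upd; case: eqP => [->|].
Qed.

Lemma ccontinuous_transvect (T : topologicalType) (Phi : T -> spinor_tensor R n)
    (A : T -> 'I_n -> 'M[C]_2) I :
  (forall J, ccontinuous (fun s => Phi s J)) ->
  (forall k p q, ccontinuous (fun s => A s k p q)) ->
  ccontinuous (fun s => transvect (Phi s) (A s) I).
Proof.
move=> cP cA; apply: ccontinuous_sum => J; apply: ccontinuousM => //.
exact: ccontinuous_prod.
Qed.

End tensors.

(** * The light-cone cut and its tangent frame *)

Section frame.
Context {R : realType}.
Implicit Types (a b : R) (Q : 'rV[R]_4) (c e : 'I_4).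
Local Notation g_ := (@inv_metric R).

Definition vec4 (x y z w : R) : 'rV[R]_4 :=
  \row_c match val c with 0%N => x | 1%N => y | 2%N => z | _ => w end.

Definition time_vec : 'rV[R]_4 := vec4 1 0 0 0.
Definition null_vec a b := vec4 1 (sin a * cos b) (sin a * sin b) (cos a).
(** With [long_vec], the orthonormal frame of the unit sphere; it is the
    derivative of the null vector in colatitude. *)
Definition colat_vec a b := vec4 0 (cos a * cos b) (cos a * sin b) (- sin a).
Definition long_vec b := vec4 0 (- sin b) (cos b) 0.

Lemma cosM_sinM (x : R) : cos x * cos x = 1 - sin x * sin x.
Proof. by rewrite -!expr2 cos2sin2. Qed.

Lemma null_vec_da a b c : is_derive a 1 (fun x => null_vec x b 0 c) (colat_vec a b 0 c).
Proof.
rewrite mxE; under eq_fun do rewrite mxE.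
case: c => [[|[|[|[|//]]]] ?] /=; apply: is_derive_eq; by rewrite /GRing.scale /=; ring.
Qed.

Lemma null_vec_db a b c : is_derive b 1 (fun x => null_vec a x 0 c) (sin a * long_vec b 0 c).
Proof.
rewrite mxE; under eq_fun do rewrite mxE.
case: c => [[|[|[|[|//]]]] ?] /=; apply: is_derive_eq; by rewrite /GRing.scale /=; ring.
Qed.

Lemma colat_vec_da a b c :
  is_derive a 1 (fun x => colat_vec x b 0 c) (time_vec 0 c - null_vec a b 0 c).
Proof.
rewrite !mxE; under eq_fun do rewrite mxE.
case: c => [[|[|[|[|//]]]] ?] /=; apply: is_derive_eq; by rewrite /GRing.scale /=; ring.
Qed.

Lemma long_vec_db a b c : is_derive b 1 (fun x => long_vec x 0 c)
  (sin a * (time_vec 0 c - null_vec a b 0 c) - cos a * colat_vec a b 0 c).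
Proof.
rewrite !mxE; under eq_fun do rewrite mxE.
have := cosM_sinM a; move=> h.
case: c => [[|[|[|[|//]]]] ?] /=; apply: is_derive_eq;
  by rewrite /GRing.scale /=; ring: h.
Qed.

(** The four vectors [time_vec], [null_vec - time_vec], [colat_vec], [long_vec]
    are orthonormal for the metric. *)
Lemma frame_completeness a b c e :
  colat_vec a b 0 c * colat_vec a b 0 e + long_vec b 0 c * long_vec b 0 e =
  time_vec 0 c * time_vec 0 e -
  (null_vec a b 0 c - time_vec 0 c) * (null_vec a b 0 e - time_vec 0 e) -
  (c == e)%:R * g_ c.
Proof.
have ha := cosM_sinM a; have hb := cosM_sinM b.
rewrite !mxE /inv_metric -!val_eqE.
case: c => [[|[|[|[|//]]]] ?]; case: e => [[|[|[|[|//]]]] ?];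
  rewrite /=; ring: ha hb.
Qed.

Lemma mink_vec4 x y z w x' y' z' w' :
  mink_form (vec4 x y z w) (vec4 x' y' z' w') = x * x' - y * y' - z * z' - w * w'.
Proof.
rewrite mink_formE !(big_ord_recl, big_ord0) /inv_metric /= !mxE /=.
by ring.
Qed.

Lemma mink_time Q : mink_form Q time_vec = Q 0 0.
Proof.
rewrite mink_formE !(big_ord_recl, big_ord0) /inv_metric /= !mxE /=.
by rewrite !mulr0 !addr0 mulr1 mul1r; congr (Q 0 _); apply/val_inj.
Qed.

Lemma mink_null_null a b : mink_form (null_vec a b) (null_vec a b) = 0.
Proof.
have ha := cosM_sinM a; have hb := cosM_sinM b.
rewrite mink_vec4; ring: ha hb.
Qed.

Lemma mink_null_colat a b : mink_form (null_vec a b) (colat_vec a b) = 0.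
Proof.
have hb := cosM_sinM b.
rewrite mink_vec4; ring: hb.
Qed.

Lemma mink_null_long a b : mink_form (null_vec a b) (long_vec b) = 0.
Proof. by rewrite mink_vec4; ring. Qed.

Lemma mink_colat_colat a b : mink_form (colat_vec a b) (colat_vec a b) = - 1.
Proof.
have ha := cosM_sinM a; have hb := cosM_sinM b.
rewrite mink_vec4; ring: ha hb.
Qed.

Lemma mink_colat_long a b : mink_form (colat_vec a b) (long_vec b) = 0.
Proof. by rewrite mink_vec4; ring. Qed.

Lemma mink_long_long b : mink_form (long_vec b) (long_vec b) = - 1.
Proof.
have hb := cosM_sinM b.
rewrite mink_vec4; ring: hb.
Qed.

Lemma inv_metricK c : g_ c * g_ c = 1.
Proof. by rewrite /inv_metric; case: ifP => _; ring. Qed.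

Lemma frame_expansion Q a b e :
  mink_form Q (colat_vec a b) * colat_vec a b 0 e +
  mink_form Q (long_vec b) * long_vec b 0 e =
  Q 0 0 * time_vec 0 e -
  (mink_form Q (null_vec a b) - Q 0 0) * (null_vec a b 0 e - time_vec 0 e) - Q 0 e.
Proof.
transitivity (\sum_c g_ c * Q 0 c * (colat_vec a b 0 c * colat_vec a b 0 e +
    long_vec b 0 c * long_vec b 0 e)).
  rewrite !mink_formE !mulr_suml -big_split; apply: eq_bigr => c _ /=; ring.
under eq_bigr do rewrite frame_completeness.
rewrite -(mink_time Q) !mink_formE.
have -> : Q 0 e = \sum_c g_ c * Q 0 c * ((c == e)%:R * g_ c).
  rewrite (bigD1 e)//= big1 => [|c /negbTE ->]; last by rewrite mul0r mulr0.
  by rewrite eqxx addr0 mul1r mulrAC inv_metricK mul1r.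
rewrite -[X in _ - X * _ - _]sumrB !mulr_suml -[X in _ = X - _]sumrB -[RHS]sumrB.
by apply: eq_bigr => c _ /=; ring.
Qed.

Lemma frame_expansion2 Q a b :
  mink_form Q (colat_vec a b) ^+ 2 + mink_form Q (long_vec b) ^+ 2 =
  Q 0 0 ^+ 2 - (mink_form Q (null_vec a b) - Q 0 0) ^+ 2 - mink_form Q Q.
Proof.
pose A := mink_form Q (colat_vec a b); pose B := mink_form Q (long_vec b).
pose D := mink_form Q (null_vec a b) - Q 0 0.
transitivity (\sum_e g_ e * (Q 0 e * (A * colat_vec a b 0 e + B * long_vec b 0 e))).
  rewrite !expr2 {2}[mink_form Q (colat_vec a b)]mink_formE.
  rewrite {2}[mink_form Q (long_vec b)]mink_formE.
  by rewrite !mulr_sumr -big_split; apply: eq_bigr => c _ /=; rewrite -/A -/B; ring.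
under eq_bigr do rewrite frame_expansion.
transitivity (Q 0 0 * mink_form Q time_vec -
   D * (mink_form Q (null_vec a b) - mink_form Q time_vec) - mink_form Q Q).
  rewrite !mink_formE -[X in _ = _ - _ * X - _]sumrB !mulr_sumr.
  rewrite -[X in _ = X - _]sumrB -[RHS]sumrB.
  by apply: eq_bigr => c _ /=; rewrite -mink_formE -/D; ring.
by rewrite mink_time -/D !expr2.
Qed.

(** The radius at which the generator meets the past cone of [Q]: the solution of
    [(Q - s k)^2 = 0] for the null vector [k]. *)
Definition kap_radius Q a b : R := mink_form Q Q / (2 * mink_form Q (null_vec a b)).
Definition kap Q a b := kap_radius Q a b *: null_vec a b.
Definition kap_a Q a b := kap_radius Q a b *: (colat_vec a b -
  (mink_form Q (colat_vec a b) / mink_form Q (null_vec a b)) *: null_vec a b).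
(** Derivative in longitude divided by [sin a], hence regular at the poles. *)
Definition kap_b Q a b := kap_radius Q a b *: (long_vec b -
  (mink_form Q (long_vec b) / mink_form Q (null_vec a b)) *: null_vec a b).
(** The area density of the cut multiplied by [4 / Q^2]. With this factor the
    total mass does not depend on [Q]. *)
Definition area_weight Q a b : R :=
  mink_form Q Q * sin a / mink_form Q (null_vec a b) ^+ 2.

Lemma area_weightE Q a b : mink_form Q Q != 0 ->
  area_weight Q a b * mink_form Q Q = 4 * (sin a * kap_radius Q a b ^+ 2).
Proof.
move=> q0; rewrite /area_weight /kap_radius.
have [->|d0] := eqVneq (mink_form Q (null_vec a b)) 0.
  by rewrite !(mulr0, expr0n, invr0, mul0r)/=.
by field.
Qed.

(** The algebraic core of [rank2_completeness], with the inner products abstracted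
    so that only field operations remain. *)
Lemma completeness_scalar (F : realFieldType) (u v k t q u' v' k' t' q' A B D Q0 q2 r G : F) :
  D != 0 -> r != 0 ->
  u * u' + v * v' = t * t' - (k - t) * (k' - t') - G ->
  A * u + B * v = Q0 * t - (D - Q0) * (k - t) - q ->
  A * u' + B * v' = Q0 * t' - (D - Q0) * (k' - t') - q' ->
  A ^+ 2 + B ^+ 2 = Q0 ^+ 2 - (D - Q0) ^+ 2 - q2 ->
  q2 = r * D * 2 ->
  r * (u - A / D * k) * (r * (u' - A / D * k')) +
  r * (v - B / D * k) * (r * (v' - B / D * k')) =
  r ^+ 2 * (2 / q2 * (r * k * (q' - r * k') + (q - r * k) * (r * k')) - G).
Proof.
move=> Dn rn E1 E2 E3 E4 E5.
transitivity (r ^+ 2 * ((u * u' + v * v') - (k' * (A * u + B * v) +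
    k * (A * u' + B * v')) / D + (A ^+ 2 + B ^+ 2) * k * k' / D ^+ 2)); first by field.
rewrite E1 E2 E3 E4 E5; field; by rewrite Dn rn.
Qed.

Section timelike.
Variable Q : 'rV[R]_4.
Hypothesis Qt : future_timelike Q.
Local Notation q2 := (mink_form Q Q).
Local Notation d a b := (mink_form Q (null_vec a b)).

(** Otherwise [frame_expansion2] would make a sum of two squares negative. *)
Lemma timelike_null_gt0 a b : 0 < d a b.
Proof.
case: Qt => q0 Q0; rewrite ltNge; apply/negP => d0.
have := frame_expansion2 Q a b.
have := sqr_ge0 (mink_form Q (colat_vec a b)).
have := sqr_ge0 (mink_form Q (long_vec b)).
nra.
Qed.

Let dn0 a b : d a b != 0. Proof. by rewrite gt_eqF// timelike_null_gt0. Qed.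
Let q20 : q2 != 0. Proof. by case: Qt => /gt_eqF ->. Qed.

Lemma kap_radius_gt0 a b : 0 < kap_radius Q a b.
Proof. by rewrite divr_gt0 ?mulr_gt0 ?timelike_null_gt0//; case: Qt. Qed.

(** The null vectors [kap] and [Q - kap], whose product is [Q^2 / 2], span the
    plane orthogonal to the tangent plane of the cut; this is the resulting
    decomposition of the inverse metric. *)
Lemma rank2_completeness a b c e :
  kap_a Q a b 0 c * kap_a Q a b 0 e + kap_b Q a b 0 c * kap_b Q a b 0 e =
  kap_radius Q a b ^+ 2 * (2 / q2 * (kap Q a b 0 c * (Q - kap Q a b) 0 e +
      (Q - kap Q a b) 0 c * kap Q a b 0 e) - (c == e)%:R * g_ c).
Proof.
have E1 := frame_completeness a b c e.
have E2 := frame_expansion Q a b c; have E3 := frame_expansion Q a b e.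
have E4 := frame_expansion2 Q a b.
have dn := dn0 a b.
have rd : q2 = kap_radius Q a b * d a b * 2 by rewrite /kap_radius; field.
have rn : kap_radius Q a b != 0 by rewrite gt_eqF// kap_radius_gt0.
have := completeness_scalar dn rn E1 E2 E3 E4 rd.
by rewrite /kap_a /kap_b /kap !(mxE _ _ 0) => <-; ring.
Qed.

Lemma mink_kap_kap a b : mink_form (kap Q a b) (kap Q a b) = 0.
Proof. by rewrite mink_formZl mink_formZr mink_null_null !mulr0. Qed.

Lemma mink_kap_a_kap_a a b :
  mink_form (kap_a Q a b) (kap_a Q a b) = - kap_radius Q a b ^+ 2.
Proof.
rewrite mink_formZl mink_formZr -scaleNr !mink_formDl !mink_formDr.
rewrite !mink_formZl !mink_formZr mink_colat_colat mink_null_null.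
by rewrite (mink_formC (colat_vec a b)) mink_null_colat; ring.
Qed.

Lemma mink_kap_b_kap_b a b :
  mink_form (kap_b Q a b) (kap_b Q a b) = - kap_radius Q a b ^+ 2.
Proof.
rewrite mink_formZl mink_formZr -scaleNr !mink_formDl !mink_formDr.
rewrite !mink_formZl !mink_formZr mink_long_long mink_null_null.
by rewrite (mink_formC (long_vec b)) mink_null_long; ring.
Qed.

Lemma mink_kap_a_kap_b a b : mink_form (kap_a Q a b) (kap_b Q a b) = 0.
Proof.
rewrite mink_formZl mink_formZr -!scaleNr !mink_formDl !mink_formDr.
rewrite !mink_formZl !mink_formZr mink_colat_long mink_null_null.
by rewrite (mink_formC (colat_vec a b) (null_vec a b)) mink_null_colat mink_null_long; ring.
Qed.

Lemma mink_Q_kap a b : mink_form Q (kap Q a b) = q2 / 2.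
Proof. by rewrite mink_formZr /kap_radius; have dn := dn0 a b; field. Qed.

Lemma is_derive_mink (v : R -> 'rV[R]_4) (dv : 'rV[R]_4) (t : R) :
  (forall c, is_derive t 1 (fun x => v x 0 c) (dv 0 c)) ->
  is_derive t 1 (fun x => mink_form Q (v x)) (mink_form Q dv).
Proof.
move=> dvE; rewrite mink_formE; under eq_fun do rewrite mink_formE.
have H c : is_derive t 1 (fun x => g_ c * (Q 0 c * v x 0 c)) (g_ c * (Q 0 c * dv 0 c)).
  have := is_deriveM_fun (is_derive_cst (g_ c * Q 0 c) t 1) (dvE c).
  under eq_fun do rewrite -mulrA.
  by move/is_derive_eq; apply; rewrite mul0r add0r mulrA.
have := is_derive_sum H; rewrite (_ : (\sum_(i < 4) _) =
  (fun x => \sum_c g_ c * (Q 0 c * v x 0 c)))//.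
by apply/funext => x; rewrite fct_sumE.
Qed.

(** The components of [kap], [kap_a] and [kap_b] all have this shape, with [D] the
    product of [Q] and the null vector. *)
Lemma is_derive_kap_form (u A D k : R -> R) (u' A' D' k' t : R) : D t != 0 ->
  is_derive t 1 u u' -> is_derive t 1 A A' -> is_derive t 1 D D' ->
  is_derive t 1 k k' ->
  is_derive t 1 (fun x => q2 / (2 * D x) * (u x - A x / D x * k x))
    (q2 / 2 * (u' / D t - u t * D' / D t ^+ 2
       - (A' * k t + A t * k') / D t ^+ 2 + 2 * A t * k t * D' / D t ^+ 3)).
Proof.
move=> Dn du dA dD dk.
have dDV := is_deriveV Dn dD.
have H := is_deriveM_fun (is_deriveM_fun (is_derive_cst (q2 / 2) t 1) dDV)
  (is_deriveB_fun du (is_deriveM_fun (is_deriveM_fun dA dDV) dk)).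
have -> : (fun x => q2 / (2 * D x) * (u x - A x / D x * k x)) =
   (fun x => q2 / 2 * (D x)^-1 * (u x - A x * (D x)^-1 * k x)).
  by apply/funext => x; rewrite invfM; ring.
apply: is_derive_eq H _.
by rewrite /GRing.scale /=; field.
Qed.

Lemma kap_da a b c : is_derive a 1 (fun x => kap Q x b 0 c) (kap_a Q a b 0 c).
Proof.
have := @is_derive_kap_form (fun x => null_vec x b 0 c) (fun=> 0) (fun x => d x b)
  (fun=> 0) _ 0 _ 0 a (dn0 a b) (null_vec_da a b c) (is_derive_cst _ _ _)
  (is_derive_mink (null_vec_da a b)) (is_derive_cst _ _ _).
under eq_fun do rewrite mul0r mul0r subr0.
move/is_derive_eq => H; under eq_fun do rewrite mxE.
by apply: H; rewrite !mxE /kap_radius; have dn := dn0 a b; field.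
Qed.

Lemma kap_db a b c : is_derive b 1 (fun x => kap Q a x 0 c) (sin a * kap_b Q a b 0 c).
Proof.
have dm : is_derive b 1 (fun x => d a x) (mink_form Q (sin a *: long_vec b)).
  by apply: is_derive_mink => e; rewrite mxE; exact: null_vec_db.
have := @is_derive_kap_form (fun x => null_vec a x 0 c) (fun=> 0) (fun x => d a x)
  (fun=> 0) _ 0 _ 0 b (dn0 a b) (null_vec_db a b c) (is_derive_cst _ _ _)
  dm (is_derive_cst _ _ _).
under eq_fun do rewrite mul0r mul0r subr0.
move/is_derive_eq => H; under eq_fun do rewrite mxE.
by apply: H; rewrite mink_formZr !mxE /kap_radius; have dn := dn0 a b; field.
Qed.

End timelike.
End frame.

(** * Divergence of the tangent frame *)

Section continuity_rules.
Context {R : realType} {T : topologicalType}.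
Implicit Types (f g : T -> R).

Lemma cont_cst (r : R) : continuous (fun _ : T => r).
Proof. by move=> x; exact: cvg_cst. Qed.

Lemma contD f g : continuous f -> continuous g -> continuous (fun x => f x + g x).
Proof. by move=> cf cg x; apply: cvgD; [exact: cf|exact: cg]. Qed.

Lemma contB f g : continuous f -> continuous g -> continuous (fun x => f x - g x).
Proof. by move=> cf cg x; apply: cvgB; [exact: cf|exact: cg]. Qed.

Lemma contM f g : continuous f -> continuous g -> continuous (fun x => f x * g x).
Proof. by move=> cf cg x; apply: cvgM; [exact: cf|exact: cg]. Qed.

Lemma contN f : continuous f -> continuous (fun x => - f x).
Proof. by move=> cf x; apply: cvgN; exact: cf. Qed.

Lemma contV f : (forall x, f x != 0) -> continuous f -> continuous (fun x => (f x)^-1).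
Proof. by move=> f0 cf x; apply: cvgV; [exact: f0|exact: cf]. Qed.

Lemma contX f n : continuous f -> continuous (fun x => f x ^+ n).
Proof.
move=> cf; elim: n => [|n IH]; first by under eq_fun do rewrite expr0; exact: cont_cst.
by under eq_fun do rewrite exprS; exact: contM.
Qed.

Lemma cont_sin f : continuous f -> continuous (fun x => sin (f x)).
Proof. by move=> cf x; apply: continuous_comp; [exact: cf|exact: continuous_sin]. Qed.

Lemma cont_cos f : continuous f -> continuous (fun x => cos (f x)).
Proof. by move=> cf x; apply: continuous_comp; [exact: cf|exact: continuous_cos]. Qed.

Lemma cont_sum (n : nat) (f : 'I_n -> T -> R) :
  (forall i, continuous (f i)) -> continuous (fun x => \sum_i f i x).
Proof.
move=> cf; elim: (index_enum _) => [|i r IH].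
  by under eq_fun do rewrite big_nil; exact: cont_cst.
by under eq_fun do rewrite big_cons; exact: contD.
Qed.

End continuity_rules.

Definition vcontinuous {R : realType} {T : topologicalType} (v : T -> 'rV[R]_4) :=
  forall c, continuous (fun x => v x 0 c).

Definition is_vderive {R : realType} (v : R -> 'rV[R]_4) (t : R) (dv : 'rV[R]_4) :=
  forall c, is_derive t 1 (fun x => v x 0 c) (dv 0 c).

Section frame_continuity.
Context {R : realType} {T : topologicalType}.
Implicit Types (u v Q : T -> 'rV[R]_4) (f h : T -> R).
Local Notation g_ := (@inv_metric R).

Lemma vcont_cst (x : 'rV[R]_4) : vcontinuous (fun _ : T => x).
Proof. by move=> c; exact: cont_cst. Qed.

Lemma vcontD u v : vcontinuous u -> vcontinuous v -> vcontinuous (fun x => u x + v x).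
Proof. by move=> cu cv c; under eq_fun do rewrite mxE; exact: contD. Qed.

Lemma vcontB u v : vcontinuous u -> vcontinuous v -> vcontinuous (fun x => u x - v x).
Proof. by move=> cu cv c; under eq_fun do rewrite !mxE; exact: contB. Qed.

Lemma vcontZ f v : continuous f -> vcontinuous v -> vcontinuous (fun x => f x *: v x).
Proof. by move=> cf cv c; under eq_fun do rewrite mxE; exact: contM. Qed.

Lemma cont_mink u v : vcontinuous u -> vcontinuous v ->
  continuous (fun x => mink_form (u x) (v x)).
Proof.
move=> cu cv; under eq_fun do rewrite mink_formE.
apply: cont_sum => c; apply: contM; first exact: cont_cst.
exact: contM.
Qed.

Lemma vcont_null f h : continuous f -> continuous h ->
  vcontinuous (fun x => null_vec (f x) (h x)).
Proof.
move=> cf ch c; under eq_fun do rewrite mxE.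
case: c => [[|[|[|[|//]]]] ?] /=.
- exact: cont_cst.
- by apply: contM; [exact: cont_sin|exact: cont_cos].
- by apply: contM; exact: cont_sin.
- exact: cont_cos.
Qed.

Lemma vcont_colat f h : continuous f -> continuous h ->
  vcontinuous (fun x => colat_vec (f x) (h x)).
Proof.
move=> cf ch c; under eq_fun do rewrite mxE.
case: c => [[|[|[|[|//]]]] ?] /=.
- exact: cont_cst.
- by apply: contM; exact: cont_cos.
- by apply: contM; [exact: cont_cos|exact: cont_sin].
- by apply: contN; exact: cont_sin.
Qed.

Lemma vcont_long h : continuous h -> vcontinuous (fun x => long_vec (h x)).
Proof.
move=> ch c; under eq_fun do rewrite mxE.
case: c => [[|[|[|[|//]]]] ?] /=.
- exact: cont_cst.
- by apply: contN; exact: cont_sin.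
- exact: cont_cos.
- exact: cont_cst.
Qed.

Section with_Q.
Variables (Q : T -> 'rV[R]_4) (f h : T -> R).
Hypotheses (cQ : vcontinuous Q) (cf : continuous f) (ch : continuous h).
Hypothesis Qt : forall x, future_timelike (Q x).

Let d0 x : mink_form (Q x) (null_vec (f x) (h x)) != 0.
Proof. by rewrite gt_eqF// timelike_null_gt0. Qed.

Lemma cont_null_pairing : continuous (fun x => mink_form (Q x) (null_vec (f x) (h x))).
Proof. by apply: cont_mink => //; exact: vcont_null. Qed.

Lemma cont_rad : continuous (fun x => kap_radius (Q x) (f x) (h x)).
Proof.
apply: contM; first exact: cont_mink.
apply: contV => [x|]; first by rewrite mulf_neq0// pnatr_eq0.
by apply: contM; [exact: cont_cst|exact: cont_null_pairing].
Qed.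

Lemma vcont_kap : vcontinuous (fun x => kap (Q x) (f x) (h x)).
Proof. by apply: vcontZ; [exact: cont_rad|exact: vcont_null]. Qed.

Lemma vcont_kap_a : vcontinuous (fun x => kap_a (Q x) (f x) (h x)).
Proof.
apply: vcontZ; first exact: cont_rad.
apply: vcontB; first exact: vcont_colat.
apply: vcontZ; last exact: vcont_null.
apply: contM; first by apply: cont_mink => //; exact: vcont_colat.
by apply: contV => //; exact: cont_null_pairing.
Qed.

Lemma vcont_kap_b : vcontinuous (fun x => kap_b (Q x) (f x) (h x)).
Proof.
apply: vcontZ; first exact: cont_rad.
apply: vcontB; first exact: vcont_long.
apply: vcontZ; last exact: vcont_null.
apply: contM; first by apply: cont_mink => //; exact: vcont_long.
by apply: contV => //; exact: cont_null_pairing.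
Qed.

Lemma cont_weight : continuous (fun x => area_weight (Q x) (f x) (h x)).
Proof.
apply: contM; first by apply: contM; [exact: cont_mink|exact: cont_sin].
apply: contV => [x|]; first by rewrite expf_neq0.
by apply: contX; exact: cont_null_pairing.
Qed.

End with_Q.
End frame_continuity.

Section divergence.
Context {R : realType}.
Implicit Types (a b : R) (c : 'I_4).
Local Notation g_ := (@inv_metric R).

Section one_vector.
Variable Q : 'rV[R]_4.
Local Notation q2 := (mink_form Q Q).
Local Notation d a b := (mink_form Q (null_vec a b)).

(** Derivative in [a] of [sin a *: kap_a]: the factor [sin a] is the one that
    makes a divergence on the sphere. *)
Definition kap_aa a b : 'rV[R]_4 := cos a *: kap_a Q a b +
  (sin a * (q2 / 2)) *: ((d a b)^-1 *: (time_vec - null_vec a b)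
   - (mink_form Q (colat_vec a b) / d a b ^+ 2 *+ 2) *: colat_vec a b
   - ((Q 0 0 - d a b) / d a b ^+ 2
      - 2 * mink_form Q (colat_vec a b) ^+ 2 / d a b ^+ 3) *: null_vec a b).

(** Derivative in [b] of [kap_b]. *)
Definition kap_bb a b : 'rV[R]_4 := - (cos a *: kap_a Q a b) +
  (sin a * (q2 / 2)) *: ((d a b)^-1 *: (time_vec - null_vec a b)
   - (mink_form Q (long_vec b) / d a b ^+ 2 *+ 2) *: long_vec b
   - ((Q 0 0 - d a b) / d a b ^+ 2
      - 2 * mink_form Q (long_vec b) ^+ 2 / d a b ^+ 3) *: null_vec a b).

Hypothesis Qt : future_timelike Q.

Let dn0 a b : d a b != 0. Proof. by rewrite gt_eqF// timelike_null_gt0. Qed.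

Lemma kap_vda a b : is_vderive (fun x => kap Q x b) a (kap_a Q a b).
Proof. by move=> c; exact: kap_da. Qed.

Lemma kap_vdb a b : is_vderive (kap Q a) b (sin a *: kap_b Q a b).
Proof. by move=> c; rewrite mxE; exact: kap_db. Qed.

Lemma mink_Q_diff a b :
  mink_form Q (time_vec - null_vec a b) = Q 0 0 - d a b.
Proof. by rewrite mink_formDr mink_time -scaleN1r mink_formZr mulN1r. Qed.

Lemma kap_a_vda a b :
  is_vderive (fun x => sin x *: kap_a Q x b) a (kap_aa a b).
Proof.
move=> c; have dn := dn0 a b.
have dA : is_derive a 1 (fun x => mink_form Q (colat_vec x b))
    (mink_form Q (time_vec - null_vec a b)).
  apply: is_derive_mink => e; have := colat_vec_da a b e.
  by move/is_derive_eq; apply; rewrite !mxE.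
have H := is_derive_kap_form Q (D := fun x => d x b) (t := a) dn (colat_vec_da a b c) dA
  (is_derive_mink Q (null_vec_da ^~ b a)) (null_vec_da a b c).
have := is_deriveM_fun (is_derive_sin a) H.
have -> : (fun x => sin x * (q2 / (2 * d x b) * (colat_vec x b 0 c -
    mink_form Q (colat_vec x b) / d x b * null_vec x b 0 c))) =
  (fun x => (sin x *: kap_a Q x b) 0 c).
  by apply/funext => x; rewrite /kap_a /kap_radius; rewrite !(mxE _ _ 0).
move/is_derive_eq; apply.
rewrite mink_Q_diff /kap_aa /kap_a /kap_radius !(mxE _ _ 0).
by field.
Qed.

Lemma kap_b_vdb a b : is_vderive (kap_b Q a) b (kap_bb a b).
Proof.
move=> c; have dn := dn0 a b.
have dm : is_derive b 1 (fun x => d a x) (mink_form Q (sin a *: long_vec b)).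
  by apply: is_derive_mink => e; rewrite mxE; exact: null_vec_db.
have dA : is_derive b 1 (fun x => mink_form Q (long_vec x))
    (mink_form Q (sin a *: (time_vec - null_vec a b) + - cos a *: colat_vec a b)).
  apply: is_derive_mink => e; have := long_vec_db a b e.
  by move/is_derive_eq; apply; rewrite !(mxE _ _ 0); ring.
have H := is_derive_kap_form Q (D := fun x => d a x) (t := b) dn (long_vec_db a b c) dA dm (null_vec_db a b c).
move: H.
have -> : (fun x => q2 / (2 * d a x) * (long_vec x 0 c -
    mink_form Q (long_vec x) / d a x * null_vec a x 0 c)) =
  (fun x => kap_b Q a x 0 c).
  by apply/funext => x; rewrite /kap_b /kap_radius; rewrite !(mxE _ _ 0).
move/is_derive_eq; apply.
rewrite mink_formDr !mink_formZr mink_Q_diff /kap_bb /kap_a /kap_radius !(mxE _ _ 0).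
by field.
Qed.

(** The left-hand side is the Laplacian of the embedding of the cut, that is, its
    mean curvature vector up to a density; hence it is normal to the cut, namely
    along [(Q - kap) - kap]. *)
Lemma kap_divergence a b :
  kap_aa a b + kap_bb a b = area_weight Q a b *: (Q - 2 *: kap Q a b).
Proof.
apply/rowP => c.
have E := frame_expansion Q a b c; have E2 := frame_expansion2 Q a b.
have dn := dn0 a b.
rewrite /kap_aa /kap_bb /area_weight /kap /kap_radius; move: E E2 dn.
move: (mink_form Q (colat_vec a b)) (mink_form Q (long_vec b)) => A B.
move: (mink_form Q (null_vec a b)) (Q 0 0) (mink_form Q Q) => D Q0 qq.
move: (kap_a Q a b) (colat_vec a b) (long_vec b) (null_vec a b) time_vec (cos a) (sin a).
move=> ka u v k t ca sa E E2 dn; rewrite !mxE.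
move: (ka 0 c) (u 0 c) (v 0 c) (k 0 c) (t 0 c) (Q 0 c) E.
move=> {}ka {}u {}v {}k {}t q E.
transitivity (sa * qq / 2 * (2 * (t - k) / D - 2 * (A * u + B * v) / D ^+ 2 -
  (2 * (Q0 - D) / D ^+ 2 - 2 * (A ^+ 2 + B ^+ 2) / D ^+ 3) * k)); first by field.
by rewrite E E2; field.
Qed.

End one_vector.

Lemma vcont_kap_aa (T : topologicalType) (f h : T -> R) (Q : 'rV[R]_4) :
  continuous f -> continuous h -> future_timelike Q ->
  vcontinuous (fun x => kap_aa Q (f x) (h x)).
Proof.
move=> cf ch Qt.
have d0 x : mink_form Q (null_vec (f x) (h x)) != 0.
  by rewrite gt_eqF// timelike_null_gt0.
have cd : continuous (fun x => mink_form Q (null_vec (f x) (h x))).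
  by apply: cont_mink; [exact: vcont_cst|exact: vcont_null].
have cA : continuous (fun x => mink_form Q (colat_vec (f x) (h x))).
  by apply: cont_mink; [exact: vcont_cst|exact: vcont_colat].
apply: vcontD; first apply: vcontZ; first exact: cont_cos.
  by apply: vcont_kap_a => //; exact: vcont_cst.
apply: vcontZ; first by apply: contM; [exact: cont_sin|exact: cont_cst].
have ck := vcont_null cf ch.
apply: vcontB; first apply: vcontB.
- apply: vcontZ; first exact: contV.
  by apply: vcontB => //; exact: vcont_cst.
- under eq_fun do rewrite mulr2n; apply: vcontZ; last exact: vcont_colat.
  by apply: contD; apply: contM => //; apply: contV => [x|]; rewrite ?expf_neq0//;
    exact: contX.
apply: vcontZ => //; apply: contB; apply: contM.
- by apply: contB => //; exact: cont_cst.
- by apply: contV => [x|]; rewrite ?expf_neq0//; exact: contX.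
- by apply: contM; [exact: cont_cst|exact: contX].
- by apply: contV => [x|]; rewrite ?expf_neq0//; exact: contX.
Qed.

(** By [kap_divergence], continuity follows from that of the other summand. *)
Lemma vcont_kap_bb (T : topologicalType) (f h : T -> R) (Q : 'rV[R]_4) :
  continuous f -> continuous h -> future_timelike Q ->
  vcontinuous (fun x => kap_bb Q (f x) (h x)).
Proof.
move=> cf ch Qt.
have -> : (fun x => kap_bb Q (f x) (h x)) = (fun x =>
    area_weight Q (f x) (h x) *: (Q - 2 *: kap Q (f x) (h x)) - kap_aa Q (f x) (h x)).
  by apply/funext => x; rewrite -kap_divergence// addrC addKr.
apply: vcontB; last exact: vcont_kap_aa.
apply: vcontZ; first by apply: cont_weight => //; exact: vcont_cst.
apply: vcontB; first exact: vcont_cst.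
apply: vcontZ; first exact: cont_cst.
by apply: vcont_kap => //; exact: vcont_cst.
Qed.

End divergence.

(** * Chain rule and symmetry of second derivatives *)

Section calculus.
Context {R : realType}.
Implicit Types (f : 'rV[R]_4 -> R) (F : 'rV[R]_4 -> R[i]).
Local Notation e_ a := (delta_mx 0 a : 'rV[R]_4).

Lemma is_derive_unique (f : R -> R) (t d d' : R) :
  is_derive t 1 f d -> is_derive t 1 f d' -> d = d'.
Proof. by move=> [_ <-] [_ <-]. Qed.

Lemma vcontinuous_continuous (T : topologicalType) (v : T -> 'rV[R]_4) :
  vcontinuous v -> continuous v.
Proof.
move=> cv; rewrite (_ : v = (fun x => \sum_c v x 0 c *: e_ c)); last first.
  by apply/funext => x; exact: row_sum_delta.
elim: (index_enum _) => [|c r IH].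
  by under eq_fun do rewrite big_nil; move=> x; exact: cvg_cst.
under eq_fun do rewrite big_cons.
by move=> x; apply: cvgD; [apply: cvgZ; [exact: cv|exact: cvg_cst]|exact: IH].
Qed.

Lemma is_vderive_differentiable (v : R -> 'rV[R]_4) (t : R) (dv : 'rV[R]_4) :
  is_vderive v t dv -> differentiable v t /\ 'd v t 1 = dv.
Proof.
move=> dvE.
have dv1 : derivable v t 1.
  by apply/derivable_mxP => i j; rewrite (ord1 i); apply: ex_derive; exact: dvE.
have dfv : differentiable v t by apply/derivable1_diffP.
split => //; rewrite -deriveE// derive_mx//; apply/rowP => c; rewrite mxE.
by apply: derive_val; exact: dvE.
Qed.

Lemma diff_partial f x v : differentiable f x ->
  'd f x v = \sum_a v 0 a * 'D_(e_ a) f x.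
Proof.
move=> df; rewrite {1}(row_sum_delta v) linear_sum; apply: eq_bigr => a _.
by rewrite linearZ /= deriveE.
Qed.

Lemma chain_rule_real f (v : R -> 'rV[R]_4) (t : R) (dv : 'rV[R]_4) :
  differentiable f (v t) -> is_vderive v t dv ->
  is_derive t 1 (fun s => f (v s)) (\sum_a dv 0 a * 'D_(e_ a) f (v t)).
Proof.
move=> df /is_vderive_differentiable[dv1 dvE].
have dfv : differentiable (f \o v) t by exact: differentiable_comp.
apply: DeriveDef; first exact/derivable1_diffP.
rewrite -[LHS]/('D_1 (f \o v) t) deriveE// diff_comp//= dvE.
exact: diff_partial.
Qed.

Definition ddir F x (v : 'rV[R]_4) : R[i] := \sum_a (v 0 a)%:C * pd a F x.

Lemma smooth_differentiable f x : smooth_in setT f -> differentiable f x.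
Proof. by move=> /(_ 1%N)[+ _]; apply. Qed.

Lemma smooth_partial f v : smooth_in setT f -> smooth_in setT ('D_v f).
Proof. by move=> fs k; have [_] := fs k.+1; apply. Qed.

Lemma csmooth_pd F a : csmooth_in setT F -> csmooth_in setT (pd a F).
Proof. by move=> [Fr Fi]; split; exact: smooth_partial. Qed.

Lemma csmooth_ccontinuous F : csmooth_in setT F -> ccontinuous F.
Proof. by move=> [Fr Fi]; split => x; [exact: (Fr 0%N)|exact: (Fi 0%N)]. Qed.

Lemma Re_ddir F x v : complex.Re (ddir F x v) =
  \sum_a v 0 a * 'D_(e_ a) (fun y => complex.Re (F y)) x.
Proof.
rewrite /ddir; elim/big_rec2 : _ => [//|a y1 y2 _ <-].
by rewrite complexReD complexReM /= mul0r subr0.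
Qed.

Lemma Im_ddir F x v : complex.Im (ddir F x v) =
  \sum_a v 0 a * 'D_(e_ a) (fun y => complex.Im (F y)) x.
Proof.
rewrite /ddir; elim/big_rec2 : _ => [//|a y1 y2 _ <-].
by rewrite complexImD complexImM /= mul0r addr0.
Qed.

Lemma chain_rule F (v : R -> 'rV[R]_4) (t : R) (dv : 'rV[R]_4) :
  csmooth_in setT F -> is_vderive v t dv ->
  is_cderive (fun s => F (v s)) t (ddir F (v t) dv).
Proof.
move=> [Fr Fi] dvE; split; rewrite ?Re_ddir ?Im_ddir; apply: chain_rule_real => //;
  exact: smooth_differentiable.
Qed.

(** The increment of [f] along [e_b] is the integral of its derivative.
    Differentiating along [e_a] under the integral and then in the upper bound
    exchanges the two derivatives. *)
Lemma partial_derivativeC f x (a b : 'I_4) : smooth_in setT f ->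
  'D_(e_ b) ('D_(e_ a) f) x = 'D_(e_ a) ('D_(e_ b) f) x.
Proof.
move=> fs.
(* With this base point, [x] is reached at the parameter 1, inside the
   interval of integration. *)
pose y := x - e_ b.
pose w (s t : R) := y + s *: e_ a + t *: e_ b.
have wx : w 0 1 = x by rewrite /w scale0r addr0 scale1r subrK.
have cw (T : topologicalType) (h k : T -> R) : continuous h -> continuous k ->
    continuous (fun p => w (h p) (k p)).
  move=> ch ck; apply: vcontinuous_continuous; apply: vcontD; first apply: vcontD.
  - exact: vcont_cst.
  - by apply: vcontZ => //; exact: vcont_cst.
  - by apply: vcontZ => //; exact: vcont_cst.
have dws s t : is_vderive (w ^~ t) s (e_ a).
  move=> c; rewrite /w.
  have H := is_derive_cst ((y + t *: e_ b) 0 c) s 1.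
  have := is_deriveD_fun H (is_deriveM_fun (is_derive_id s 1) (is_derive_cst (e_ a 0 c) s 1)).
  under eq_fun do rewrite /= !mxE.
  under [X in _ -> is_derive _ _ X _]eq_fun do rewrite !mxE addrAC.
  by move/is_derive_eq; apply; rewrite mulr0 mul1r add0r addr0.
have dwt s t : is_vderive (w s) t (e_ b).
  move=> c; rewrite /w.
  have H := is_derive_cst ((y + s *: e_ a) 0 c) t 1.
  have := is_deriveD_fun H (is_deriveM_fun (is_derive_id t 1) (is_derive_cst (e_ b 0 c) t 1)).
  under eq_fun do rewrite /= !mxE.
  under [X in _ -> is_derive _ _ X _]eq_fun do rewrite !mxE.
  by move/is_derive_eq; apply; rewrite mulr0 mul1r add0r addr0.
have chain (h : 'rV[R]_4 -> R) c v s : smooth_in setT h -> is_vderive v s (e_ c) ->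
    is_derive s 1 (fun r => h (v r)) ('D_(e_ c) h (v s)).
  move=> hs vc; have := chain_rule_real (smooth_differentiable (v s) hs) vc.
  rewrite (bigD1 c)//= big1 => [|d /negbTE dc]; last by rewrite mxE dc andbF mul0r.
  by rewrite mxE !eqxx mul1r addr0.
have ch (h : 'rV[R]_4 -> R) : smooth_in setT h -> continuous h.
  by move=> hs; move=> z; exact: (hs 0%N).
have cfst : continuous (fun p : R * R => p.1) by move=> p; exact: cvg_fst.
have csnd : continuous (fun p : R * R => p.2) by move=> p; exact: cvg_snd.
have ch2 (h : 'rV[R]_4 -> R) : smooth_in setT h ->
    continuous (fun p : R * R => h (w p.1 p.2)).
  move=> hs p; apply: (@continuous_comp _ _ _ (fun p : R * R => w p.1 p.2) h).
    exact: cw.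
  exact: ch.
pose fb := 'D_(e_ b) f; pose fab := 'D_(e_ a) fb.
have sfb : smooth_in setT fb by exact: smooth_partial.
have sfab : smooth_in setT fab by exact: smooth_partial.
have sfa : smooth_in setT ('D_(e_ a) f) by exact: smooth_partial.
pose mu := @lebesgue_measure R.
have E (t : R) : 0 <= t -> 'D_(e_ a) f (w 0 t) - 'D_(e_ a) f (w 0 0) =
    \int[mu]_(r in `[0, t]) fab (w 0 r).
  move=> t0.
  have d1 : is_derive (0 : R) 1 (fun s => \int[mu]_(r in `[0, t]) fb (w s r))
      (\int[mu]_(r in `[0, t]) fab (w 0 r)).
    apply: (@is_derive_integral _ (fun s r => fb (w s r)) (fun s r => fab (w s r)) 0 t 0 t0
      (ch2 _ sfb) (ch2 _ sfab)).
    by move=> s r; apply: (chain _ _ (w ^~ r)).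
  have d2 := is_deriveB_fun (chain _ _ (w ^~ t) 0 fs (dws 0 t))
                            (chain _ _ (w ^~ 0) 0 fs (dws 0 0)).
  have FE : (fun s => f (w s t) - f (w s 0)) = (fun s => \int[mu]_(r in `[0, t]) fb (w s r)).
    apply/funext => s; symmetry.
    apply: (@integral_derive _ (fun r => f (w s r)) (fun r => fb (w s r)) 0 t t0
      (@continuous2_snd _ _ _ (fun s r => fb (w s r)) s (ch2 _ sfb))).
    by move=> r; apply: (chain _ _ (w s)).
  rewrite FE in d2.
  exact: (is_derive_unique d2 d1).
have cab : continuous (fun r => fab (w 0 r)) by exact: (@continuous2_snd _ _ _ (fun s r => fab (w s r)) 0 (ch2 _ sfab)).
have [G1 G2] := @continuous_FTC1_closed R (fun r => fab (w 0 r)) 0 1 2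
  ltac:(by rewrite ltr1n) (@continuous_integrable _ _ _ _ cab) ltr01 (cab 1).
have d3 := chain _ _ (w 0) 1 sfa (dwt 0 1).
pose c0 : R := 'D_(e_ a) f (w 0 0).
pose H (t : R) : R := \int[mu]_(r in `[0, t]) fab (w 0 r).
have d4 : is_derive (1 : R) 1 (fun t => H t + c0) (fab (w 0 1)).
  have dH : is_derive (1 : R) 1 H (fab (w 0 1)).
    exact: (DeriveDef G1 (etrans (esym (derive1E _ _)) G2)).
  by apply: is_derive_eq (is_deriveD_fun dH (is_derive_cst c0 _ _)) _; rewrite addr0.
have d5 : is_derive (1 : R) 1 (fun t => 'D_(e_ a) f (w 0 t)) (fab (w 0 1)).
  apply: near_eq_is_derive d4.
  near=> t; rewrite -[RHS](subrK c0) /c0 E//.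
  apply: ltW; near: t; exact: lt_nbhsr.
by rewrite -wx; exact: (is_derive_unique d3 d5).
Unshelve. all: by end_near. Qed.

Lemma pdC F x (a b : 'I_4) : csmooth_in setT F ->
  pd b (pd a F) x = pd a (pd b F) x.
Proof.
move=> [Fr Fi]; apply: complex_ext => /=.
  exact: (@partial_derivativeC (fun y => complex.Re (F y))).
exact: (@partial_derivativeC (fun y => complex.Im (F y))).
Qed.

End calculus.

(** * Massless fields and the wave equation *)

Section massless_fields.
Context {R : realType} {n : nat}.
Local Notation C := R[i].
Local Notation S := (infeld R).
Local Notation g_ := (@inv_metric C).
Implicit Types (phi : 'rV[R]_4 -> spinor_tensor R n) (J I : spindex n) (j : 'I_n).

Lemma symmetrization_perm (Phi : spinor_tensor R n) (s : 'S_n) J :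
  Phi = symmetrization Phi -> Phi [ffun k => J (s k)] = Phi J.
Proof.
move=> E; rewrite E /symmetrization; congr (_ * _).
rewrite [RHS](reindex_inj (mulIg s)); apply: eq_bigr => t _; congr (Phi _).
by apply/ffunP => k; rewrite !ffunE permM.
Qed.

Definition divergence_free phi x j := forall J (A' : 'I_2),
  \sum_(A < 2) \sum_(a < 4)
    S a A A' * g_ a * pd a (fun y => phi y (set_index J j A)) x = 0.

(** The equation is given for the first index; the symmetry of the field moves it
    to any other one. *)
Lemma massless_divergence_free phi x j : (0 < n)%N ->
  (forall y, phi y = symmetrization (phi y)) -> massless_at phi x ->
  divergence_free phi x j.
Proof.
move=> n0 sym mphi J A'; pose j0 := Ordinal n0.
have := mphi j0 [ffun k => J (tperm j0 j k)] A' erefl.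
rewrite /spinor_nabla => H; rewrite -[RHS]H; apply: eq_bigr => A _; apply: eq_bigr => a _.
congr (_ * pd a _ x); apply/funext => y.
rewrite -(symmetrization_perm (tperm j0 j) _ (sym y)); congr (phi y _).
apply/ffunP => k; rewrite !ffunE.
by rewrite -[X in _ == X](tpermL j0 j) (inj_eq perm_inj).
Qed.

Lemma continuous_eq0_right (f : R -> R) : continuous f ->
  (forall t, 0 < t -> f t = 0) -> f 0 = 0.
Proof.
move=> cf f0.
have c1 : f x @[x --> 0^'+] --> f 0 by apply: cvg_at_right_filter; exact: cf.
have c2 : f x @[x --> 0^'+] --> (0 : R).
  apply: cvg_near_cst; near=> x; apply/f0.
  by near: x; exact: nbhs_right_gt.
exact: (cvg_unique _ c1 c2).
Unshelve. all: by end_near. Qed.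

Lemma ccontinuous_eq0_right (f : R -> C) : ccontinuous f ->
  (forall t, 0 < t -> f t = 0) -> f 0 = 0.
Proof.
move=> [cr ci] f0; apply: complex_ext.
  by apply: (@continuous_eq0_right (fun t => complex.Re (f t))) => // t /f0 ->.
by apply: (@continuous_eq0_right (fun t => complex.Im (f t))) => // t /f0 ->.
Qed.

Lemma chrono_futureE (p0 x : 'rV[R]_4) : future_timelike x -> chrono_future p0 (p0 + x).
Proof. by exists x, 1; rewrite scale1r; split. Qed.

Lemma chrono_future_sub (p0 x : 'rV[R]_4) : chrono_future p0 x -> future_timelike (x - p0).
Proof.
case=> k [s [[kk k0] s0 ->]]; rewrite addrC addKr; split.
  by rewrite mink_formZl mink_formZr !mulr_gt0.
by rewrite mxE mulr_gt0.
Qed.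

Lemma line_vderive (x v : 'rV[R]_4) (t : R) : is_vderive (fun s => x + s *: v) t v.
Proof.
move=> c.
have := is_deriveD_fun (is_derive_cst (x 0 c) t 1)
  (is_deriveM_fun (is_derive_id t 1) (is_derive_cst (v 0 c) t 1)).
under [X in _ -> is_derive _ _ X _]eq_fun do rewrite !mxE.
by move/is_derive_eq; apply; rewrite mulr0 mul1r add0r addr0.
Qed.

Lemma line_vcontinuous (T : topologicalType) (x v : 'rV[R]_4) (f : T -> R) :
  continuous f -> vcontinuous (fun s => x + f s *: v).
Proof.
by move=> cf; apply: vcontD; [exact: vcont_cst|apply: vcontZ => //; exact: vcont_cst].
Qed.

(** The equation is assumed only in the open future; on the cone it follows by
    continuity along a timelike ray. *)
Lemma divergence_free_closed phi p0 v Q j : smooth_field phi ->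
  (forall t : R, 0 < t -> divergence_free phi (p0 + v + t *: Q) j) ->
  divergence_free phi (p0 + v) j.
Proof.
move=> sphi dphi J A'.
pose f t := \sum_(A < 2) \sum_(a < 4)
    S a A A' * g_ a * pd a (fun y => phi y (set_index J j A)) (p0 + v + t *: Q).
suff : f 0 = 0 by rewrite /f scale0r addr0.
apply: ccontinuous_eq0_right; last by move=> t t0; exact: dphi.
apply: ccontinuous_sum => A; apply: ccontinuous_sum => a.
apply: ccontinuousM; first exact: ccontinuous_cst.
apply: (@ccontinuous_comp _ _ _ (fun t : R => p0 + v + t *: Q)
  (pd a (fun y => phi y (set_index J j A)))).
  apply: vcontinuous_continuous; apply: line_vcontinuous => t; exact: cvg_id.
by apply: csmooth_ccontinuous; exact: csmooth_pd.
Qed.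

Lemma ddir_delta (F : 'rV[R]_4 -> C) x a : ddir F x (delta_mx 0 a) = pd a F x.
Proof.
rewrite /ddir (bigD1 a)//= big1 => [|b /negbTE ba]; last by rewrite mxE ba andbF mul0r.
by rewrite mxE !eqxx mul1r addr0.
Qed.

Lemma pd_cderive (F : 'rV[R]_4 -> C) x a : csmooth_in setT F ->
  is_cderive (fun s => F (x + s *: delta_mx 0 a)) 0 (pd a F x).
Proof.
move=> sF; have := chain_rule sF (line_vderive x (delta_mx 0 a) 0).
by rewrite ddir_delta scale0r addr0.
Qed.

Lemma is_cderive_near0 (f : R -> C) (t : R) d : is_cderive f t d ->
  (\forall s \near t, f s = 0) -> d = 0.
Proof.
move=> fd f0; apply: (is_cderive_unique fd).
have [c1 c2] := @is_cderive_cst R 0 t; split.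
  by apply: near_eq_is_derive c1; near=> s; rewrite (near f0 s).
by apply: near_eq_is_derive c2; near=> s; rewrite (near f0 s).
Unshelve. all: by end_near. Qed.

Lemma timelike_line_near (x v : 'rV[R]_4) : future_timelike x ->
  \forall s \near (0 : R), future_timelike (x + s *: v).
Proof.
move=> [xx x0].
have cl : vcontinuous (fun s : R => x + s *: v).
  by apply: line_vcontinuous => t; exact: cvg_id.
near=> s; split.
- near: s; have /(_ 0) := cont_mink cl cl.
  move/cvgr_gt; apply; by rewrite scale0r addr0.
- near: s; have /(_ 0) := cl 0.
  move/cvgr_gt; apply; by rewrite scale0r addr0.
Unshelve. all: by end_near. Qed.

Lemma infeld_clifford_swap (a b : 'I_4) :
  g_ a *: (S a *m S b) + g_ b *: (S b *m S a) = ((a == b)%:R * g_ a)%:M.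
Proof.
have gK c : g_ c * g_ c = 1 by rewrite /inv_metric; case: ifP => _; ring.
have H := congr1 (fun M : 'M[C]_2 => (g_ a * g_ b) *: M) (infeld_clifford a b).
rewrite /= scalerDr !scalerA -mulrA gK mulr1 mulrAC gK mul1r in H; rewrite H.
rewrite scale_scalar_mx; congr (_%:M).
by case: eqP => [<-|_]; rewrite ?mul0r ?mulr0// gK !mul1r.
Qed.

(** Apply a second gradient to the massless equation and contract the primed
    indices: as second derivatives commute, only the symmetric part of the product
    of two [infeld] matrices survives, and it is the metric by the Clifford
    relation. *)
Lemma massless_wave phi p0 x J j : smooth_field phi ->
  (forall y, chrono_future p0 y -> divergence_free phi y j) ->
  chrono_future p0 x ->
  \sum_a g_ a * pd a (pd a (fun y => phi y J)) x = 0.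
Proof.
move=> sphi dphi px.
pose f A y := phi y (set_index J j A).
have sf A : csmooth_in setT (f A) by exact: sphi.
(* The equation holds in a neighbourhood of [x], so it may be differentiated. *)
have E (b : 'I_4) (A' : 'I_2) :
    \sum_(A < 2) \sum_(a < 4) S a A A' * g_ a * pd b (pd a (f A)) x = 0.
  apply: (@is_cderive_near0 (fun s => \sum_(A < 2) \sum_(a < 4)
      S a A A' * g_ a * pd a (f A) (x + s *: delta_mx 0 b)) 0).
    apply: is_cderive_sum => A; apply: is_cderive_sum => a; apply: is_cderiveZ.
    by apply: pd_cderive; exact: csmooth_pd.
  have := timelike_line_near (delta_mx 0 b) (chrono_future_sub px).
  apply: filterS => s hs; apply: dphi.
  have := chrono_futureE p0 hs.
  by rewrite addrCA addrA subrK addrC.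
(* contraction of the primed indices *)
have H (B : 'I_2) : \sum_(A < 2) \sum_(a < 4) \sum_(b < 4)
    g_ a * (S a *m S b) A B * pd b (pd a (f A)) x = 0.
  transitivity (\sum_(b < 4) \sum_(A' < 2) S b A' B *
     \sum_(A < 2) \sum_(a < 4) S a A A' * g_ a * pd b (pd a (f A)) x).
    under [RHS]eq_bigr do under eq_bigr do rewrite mulr_sumr.
    under [RHS]eq_bigr do rewrite exchange_big.
    rewrite [RHS]exchange_big; apply: eq_bigr => A _ /=.
    under [RHS]eq_bigr do under eq_bigr do rewrite mulr_sumr.
    under [RHS]eq_bigr do rewrite exchange_big.
    rewrite [RHS]exchange_big; apply: eq_bigr => a _ /=.
    apply: eq_bigr => b _; rewrite mxE mulr_sumr mulr_suml.
    by apply: eq_bigr => A' _; ring.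
  by rewrite big1// => b _; rewrite big1// => A' _; rewrite E mulr0.
have H2 (B : 'I_2) : \sum_(A < 2) \sum_(a < 4) \sum_(b < 4)
    ((a == b)%:R * g_ a)%:M A B * pd b (pd a (f A)) x = 0.
  transitivity (\sum_(A < 2) \sum_(a < 4) \sum_(b < 4)
    (g_ a * (S a *m S b) A B * pd b (pd a (f A)) x) +
    \sum_(A < 2) \sum_(a < 4) \sum_(b < 4)
    (g_ b * (S b *m S a) A B * pd b (pd a (f A)) x)).
    rewrite -big_split; apply: eq_bigr => A _; rewrite -big_split.
    apply: eq_bigr => a _; rewrite -big_split; apply: eq_bigr => b _ /=.
    rewrite -infeld_clifford_swap [in LHS]mxE [X in (X + _) * _]mxE [X in (_ + X) * _]mxE.
    by rewrite mulrDl.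
  rewrite H add0r -[RHS](H B); apply: eq_bigr => A _.
  rewrite exchange_big; apply: eq_bigr => a _; apply: eq_bigr => b _.
  by rewrite pdC.
have := H2 (J j); rewrite (bigD1 (J j))//= [X in _ + X]big1 ?addr0; last first.
  move=> A /negbTE AJ; rewrite big1// => a _; rewrite big1// => b _.
  by rewrite mxE AJ mulr0n mul0r.
have fJ : f (J j) = (fun y => phi y J).
  apply/funext => y; congr (phi y _); apply/ffunP => k; rewrite ffunE.
  by case: eqP => [->|].
rewrite fJ => H3; rewrite -[RHS]H3; apply: eq_bigr => a _.
rewrite (bigD1 a)//= big1 ?addr0; first by rewrite mxE !eqxx mul1r mulr1n.
by move=> b /negbTE ba; rewrite eq_sym ba mul0r mxE mul0rn mul0r.
Qed.

End massless_fields.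

Section bilinear_completeness.
Context {R : realType}.
Local Notation C := R[i].
Local Notation g_ := (@inv_metric C).

Definition bilin (B : 'I_4 -> 'I_4 -> C) (x y : 'rV[R]_4) : C :=
  \sum_c \sum_e (x 0 c)%:C * (y 0 e)%:C * B c e.

Lemma bilinZl B r u v : bilin B (r *: u) v = r%:C * bilin B u v.
Proof.
rewrite /bilin mulr_sumr; apply: eq_bigr => c _; rewrite mulr_sumr; apply: eq_bigr => e _.
by rewrite mxE rmorphM -!mulrA.
Qed.

Lemma bilinZr B r u v : bilin B u (r *: v) = r%:C * bilin B u v.
Proof.
rewrite /bilin mulr_sumr; apply: eq_bigr => c _; rewrite mulr_sumr; apply: eq_bigr => e _.
by rewrite mxE rmorphM -!mulrA mulrCA.
Qed.

Lemma bilin_completeness B (Q : 'rV[R]_4) a b : future_timelike Q ->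
  bilin B (kap_a Q a b) (kap_a Q a b) + bilin B (kap_b Q a b) (kap_b Q a b) =
  (kap_radius Q a b ^+ 2)%:C * ((2 / mink_form Q Q)%:C *
    (bilin B (kap Q a b) (Q - kap Q a b) + bilin B (Q - kap Q a b) (kap Q a b))
    - \sum_c g_ c * B c c).
Proof.
move=> Qt.
have -> : \sum_c g_ c * B c c = \sum_c \sum_e ((c == e)%:R * inv_metric R c)%:C * B c e.
  apply: eq_bigr => c _; rewrite (bigD1 c)//= big1 ?addr0 => [|e /negbTE ec].
    by rewrite eqxx mul1r; congr (_ * _); rewrite /inv_metric; case: ifP; rewrite ?rmorphN ?rmorph1.
  by rewrite eq_sym ec mul0r mul0r.
rewrite /bilin -!big_split /= mulr_sumr -sumrB mulr_sumr; apply: eq_bigr => c _.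
rewrite -!big_split /= mulr_sumr -sumrB mulr_sumr; apply: eq_bigr => e _.
rewrite -!mulrDl mulrA -mulrBl mulrA; congr (_ * _).
by rewrite -!rmorphM -!rmorphD -!rmorphM -!rmorphB -rmorphM rank2_completeness.
Qed.

End bilinear_completeness.

Section matrix_derivatives.
Context {R : realType}.
Local Notation C := R[i].

Definition is_mderive (M : R -> 'M[C]_2) (t : R) (dM : 'M[C]_2) :=
  forall p q, is_cderive (fun x => M x p q) t (dM p q).

Definition mcontinuous (T : topologicalType) (M : T -> 'M[C]_2) :=
  forall p q, ccontinuous (fun x => M x p q).

Lemma is_mderive_mat (v : R -> 'rV[R]_4) t dv :
  is_vderive v t dv -> is_mderive (fun x => mat (cplx (v x))) t (mat (cplx dv)).
Proof.
move=> dvE p q; rewrite summxE; under eq_fun do rewrite summxE.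
apply: is_cderive_sum => c; rewrite !mxE mulrC; under eq_fun do rewrite !mxE mulrC.
by apply: is_cderiveZ; exact: is_cderive_real.
Qed.

Lemma is_mderive_comat (v : R -> 'rV[R]_4) t dv :
  is_vderive v t dv -> is_mderive (fun x => comat (cplx (v x))) t (comat (cplx dv)).
Proof.
move=> dvE p q; rewrite summxE; under eq_fun do rewrite summxE.
apply: is_cderive_sum => c; rewrite !mxE -mulrA mulrC.
under eq_fun do rewrite !mxE -mulrA mulrC.
by apply: is_cderiveZ; exact: is_cderive_real.
Qed.

Lemma is_mderiveM (M N : R -> 'M[C]_2) t dM dN :
  is_mderive M t dM -> is_mderive N t dN ->
  is_mderive (fun x => M x *m N x) t (dM *m N t + M t *m dN).
Proof.
move=> dME dNE p q; rewrite mxE [X in X + _]mxE [X in _ + X]mxE -big_split.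
under eq_fun do rewrite mxE.
by apply: is_cderive_sum => k; exact: is_cderiveM.
Qed.

Lemma is_mderive_cst M t : is_mderive (fun=> M) t 0.
Proof. by move=> p q; rewrite mxE; exact: is_cderive_cst. Qed.

Lemma is_mderiveZ z (M : R -> 'M[C]_2) t dM :
  is_mderive M t dM -> is_mderive (fun x => z *: M x) t (z *: dM).
Proof.
by move=> dME p q; rewrite mxE; under eq_fun do rewrite mxE; exact: is_cderiveZ.
Qed.

Lemma mcont_mat (T : topologicalType) (v : T -> 'rV[R]_4) :
  vcontinuous v -> mcontinuous (fun x => mat (cplx (v x))).
Proof.
move=> cv p q; under eq_fun do rewrite summxE.
apply: ccontinuous_sum => c; under eq_fun do rewrite !mxE.
by apply: ccontinuousM; [exact: ccontinuous_real|exact: ccontinuous_cst].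
Qed.

Lemma mcont_comat (T : topologicalType) (v : T -> 'rV[R]_4) :
  vcontinuous v -> mcontinuous (fun x => comat (cplx (v x))).
Proof.
move=> cv p q; under eq_fun do rewrite summxE.
apply: ccontinuous_sum => c; under eq_fun do rewrite !mxE -mulrA.
by apply: ccontinuousM; [exact: ccontinuous_real|exact: ccontinuous_cst].
Qed.

Lemma mcontM (T : topologicalType) (M N : T -> 'M[C]_2) :
  mcontinuous M -> mcontinuous N -> mcontinuous (fun x => M x *m N x).
Proof.
move=> cM cN p q; under eq_fun do rewrite mxE.
by apply: ccontinuous_sum => k; exact: ccontinuousM.
Qed.

Lemma mcontD (T : topologicalType) (M N : T -> 'M[C]_2) :
  mcontinuous M -> mcontinuous N -> mcontinuous (fun x => M x + N x).
Proof.
by move=> cM cN p q; under eq_fun do rewrite mxE; exact: ccontinuousD.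
Qed.

Lemma mcont_cst (T : topologicalType) M : mcontinuous (fun _ : T => M).
Proof. by move=> p q; exact: ccontinuous_cst. Qed.

Lemma mcontZ (T : topologicalType) z (M : T -> 'M[C]_2) :
  mcontinuous M -> mcontinuous (fun x => z *: M x).
Proof.
move=> cM p q; under eq_fun do rewrite mxE.
by apply: ccontinuousM => //; exact: ccontinuous_cst.
Qed.

End matrix_derivatives.

(** * Trading a free index for a projected one *)

Lemma mat_cplx0 (R : realType) : mat (cplx (0 : 'rV[R]_4)) = 0.
Proof. by rewrite /mat big1// => a _; rewrite !mxE scale0r. Qed.

Section slot_matrices.
Context {R : realType}.
Variable Q : 'rV[R]_4.
Hypothesis Qt : future_timelike Q.
Implicit Types (a b : R).
Local Notation C := R[i].
Local Notation q2 := (mink_form Q Q).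
Local Notation K a b := (kap Q a b).

(** On covariant spinors, the projector onto the spinor [iota_A] of [Q - kap] along
    the spinor [o_A] of [kap]; written with [kap] and [Q], it is smooth in the angles,
    whereas a dyad is not. *)
Definition slot_proj a b : 'M[C]_2 :=
  (2 / q2)%:C *: (mat (cplx (K a b)) *m comat (cplx Q)).

Let q20 : q2 != 0. Proof. by case: Qt => /gt_eqF ->. Qed.

Lemma mat_comat_kap a b : mat (cplx (K a b)) *m comat (cplx (K a b)) = 0.
Proof. by rewrite mat_comat mink_form_cplx mink_kap_kap mul0r raddf0. Qed.

Lemma mink_kap_nu a b : mink_form (K a b) (Q - K a b) = q2 / 2.
Proof.
by rewrite mink_formDr -scaleN1r mink_formZr mink_kap_kap mulr0 addr0 mink_formC mink_Q_kap.
Qed.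

(** The two terms of the Clifford relation for [kap] and [Q - kap] are the two
    complementary projectors. *)
Lemma slot_projC a b :
  (2 / q2)%:C *: (mat (cplx (Q - K a b)) *m comat (cplx (K a b))) = 1%:M - slot_proj a b.
Proof.
have := mat_comatD (cplx (K a b)) (cplx (Q - K a b)).
rewrite mink_form_cplx mink_kap_nu => H.
have e : comat (cplx Q) = comat (cplx (Q - K a b)) + comat (cplx (K a b)).
  by rewrite -comatD -cplxD subrK.
rewrite /slot_proj e mulmxDr mat_comat_kap addr0.
apply: (canRL (addrK _)); rewrite -scalerDr addrC H scale_scalar_mx -rmorphM.
have -> : 2 / q2 * (q2 / 2) = 1 by field.
by rewrite rmorph1.
Qed.

Definition slots n (j : nat) a b : 'I_n -> 'M[C]_2 :=
  fun k => if (k < j)%N then slot_proj a b else 1%:M.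

End slot_matrices.

Section transvect_expansions.
Context {R : realType} {n : nat}.
Local Notation C := R[i].
Local Notation S := (infeld R).
Implicit Types (phi : 'rV[R]_4 -> spinor_tensor R n) (A : 'I_n -> 'M[C]_2).

Definition ddir_field phi x v : spinor_tensor R n :=
  fun J => ddir (fun y => phi y J) x v.

Definition pd_field phi x a : spinor_tensor R n :=
  fun J => pd a (fun y => phi y J) x.

Lemma transvect_ddir phi x v A I :
  transvect (ddir_field phi x v) A I =
  \sum_c (v 0 c)%:C * transvect (pd_field phi x c) A I.
Proof.
rewrite -(@eq_bigr _ _ _ _ _ _ (fun c => cplx v 0 c * transvect (pd_field phi x c) A I)).
  rewrite -transvect_suml; apply: eq_bigr => J _; congr (_ * _).
  by apply: eq_bigr => c _; rewrite mxE.
by move=> c _; rewrite mxE.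
Qed.

Lemma transvect_ddir_mat phi x v w A j Y I :
  transvect (ddir_field phi x v) (upd A j (mat (cplx w) *m Y)) I =
  bilin (fun c e => transvect (pd_field phi x c) (upd A j (S e *m Y)) I) v w.
Proof.
rewrite transvect_ddir; apply: eq_bigr => c _; rewrite transvect_mat mulr_sumr.
by apply: eq_bigr => e _; rewrite mxE mulrA.
Qed.

Lemma transvect_mat2 Phi v w A j k Y Z I : j != k ->
  transvect Phi (upd (upd A j (mat (cplx v) *m Y)) k (mat (cplx w) *m Z)) I =
  bilin (fun c e => transvect Phi (upd (upd A j (S c *m Y)) k (S e *m Z)) I) v w.
Proof.
move=> jk; rewrite (eq_transvect _ _ (upd_updC _ _ _ jk)) transvect_mat.
apply: eq_bigr => c _.
rewrite -(eq_transvect _ _ (upd_updC _ _ _ jk)) transvect_mat mulr_sumr.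
by apply: eq_bigr => e _; rewrite !mxE mulrA.
Qed.

Lemma transvectB Phi A j X Y I :
  transvect Phi (upd A j (X - Y)) I =
  transvect Phi (upd A j X) I - transvect Phi (upd A j Y) I.
Proof. by rewrite transvectD -scaleN1r transvectZ mulN1r. Qed.

Lemma upd_eq A (j : 'I_n) X : upd A j X j = X.
Proof. by rewrite /upd eqxx. Qed.

Lemma upd_neq A (j k : 'I_n) X : k != j -> upd A j X k = A k.
Proof. by rewrite /upd => /negbTE ->. Qed.

(** Leibniz rule for a product of slots of which the [j]-th is special and the
    following ones are constant. *)
Lemma transvect_slot_sum (Phi : spinor_tensor R n) A (dA : 'I_n -> 'M[C]_2) (j : 'I_n) X dX I :
  (forall k : 'I_n, ~~ (k < j)%N -> dA k = 0) ->
  \sum_k transvect Phi (upd (upd A j X) k (upd dA j dX k)) I =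
  transvect Phi (upd A j dX) I +
  \sum_(k : 'I_n | (k < j)%N) transvect Phi (upd (upd A j X) k (dA k)) I.
Proof.
move=> dA0; rewrite (bigD1 j)//= upd_eq (eq_transvect _ _ (upd_upd _ _ _ _)).
congr (_ + _); rewrite (bigID (fun k : 'I_n => (k < j)%N))/= [X in _ + X]big1 ?addr0.
  apply: eq_big => k; first by rewrite -val_eqE /= ltn_neqAle andbA andbb.
  by move=> /andP[kj _]; rewrite upd_neq.
by move=> k /andP[kj kltj]; rewrite upd_neq// dA0// transvect0.
Qed.

End transvect_expansions.

Section ladder.
Context {R : realType} {n : nat}.
Local Notation C := R[i].
Local Notation S := (infeld R).
Local Notation g_ := (@inv_metric C).
Variables (Q p0 : 'rV[R]_4) (phi : 'rV[R]_4 -> spinor_tensor R n).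
Hypothesis Qt : future_timelike Q.
Hypothesis sphi : smooth_field phi.
Hypothesis phi_sym : forall x, phi x = symmetrization (phi x).
Variables (j : 'I_n) (I : spindex n).
Hypothesis phi_div : forall a b, divergence_free phi (p0 + kap Q a b) j.
Local Notation q2 := (mink_form Q Q).
Local Notation K a b := (kap Q a b).
Local Notation Kmat a b := (mat (cplx (K a b))).
Local Notation Kco a b := (comat (cplx (K a b))).
Local Notation Phi a b := (phi (p0 + K a b)).
Local Notation D a b v := (ddir_field phi (p0 + K a b) v).
Local Notation P a b := (slots Q j a b).

Let Xa a b := mat (cplx (sin a *: kap_a Q a b)) *m Kco a b.
Let Xb a b := mat (cplx (kap_b Q a b)) *m Kco a b.
Let dXa a b := mat (cplx (kap_aa Q a b)) *m Kco a b +
  mat (cplx (sin a *: kap_a Q a b)) *m comat (cplx (kap_a Q a b)).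
Let dXb a b := mat (cplx (kap_bb Q a b)) *m Kco a b +
  mat (cplx (kap_b Q a b)) *m comat (cplx (sin a *: kap_b Q a b)).
Let dP (v : 'rV[R]_4) (k : 'I_n) : 'M[C]_2 := if (k < j)%N then
  (2 / q2)%:C *: (mat (cplx v) *m comat (cplx Q)) else 0.

Let fa a b := transvect (D a b (kap_a Q a b)) (upd (P a b) j (Xa a b)) I +
  \sum_k transvect (Phi a b) (upd (upd (P a b) j (Xa a b)) k
    (upd (dP (kap_a Q a b)) j (dXa a b) k)) I.

Let fb a b := transvect (D a b (sin a *: kap_b Q a b)) (upd (P a b) j (Xb a b)) I +
  \sum_k transvect (Phi a b) (upd (upd (P a b) j (Xb a b)) k
    (upd (dP (sin a *: kap_b Q a b)) j (dXb a b) k)) I.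

Let T a b X := transvect (Phi a b) (upd (P a b) j X) I.

(** The functions [fa] and [fb] are the derivatives in [a] and [b] of the field
    transformed by the projector in the slots before [j], and by [sin a kap_a]
    (resp. [kap_b]) times the adjugate of [kap] in slot [j]. By [rank2_completeness] each
    pair of tangent vectors is replaced by [kap] and [Q - kap] up to a trace. The
    trace vanishes by the massless equation when the field is differentiated, and
    by the Fierz identity when one of the [j] projectors is; the derivative of slot
    [j] is computed by [kap_divergence]. The three contributions to the
    coefficient of the complementary projector are thus [D_kap phi], [j phi] and
    [2 phi]; the last one comes with the field itself, subtracted. *)
Lemma ladder_pointwise a b :
  fa a b + fb a b = (q2 / 4 * area_weight Q a b)%:C *
    (transvect (D a b (K a b)) (upd (P a b) j (1%:M - slot_proj Q a b)) I
     + j.+2%:R * T a b (1%:M - slot_proj Q a b) - T a b 1%:M).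
Proof.
have q20 : q2 != 0 by case: Qt => /gt_eqF ->.
have E : q2 / 4 * area_weight Q a b = sin a * kap_radius Q a b ^+ 2.
  have -> : q2 / 4 * area_weight Q a b = (area_weight Q a b * q2) / 4 by ring.
  by rewrite area_weightE//; field.
set u := slot_proj Q a b.
have uC : 1%:M - u = (2 / q2)%:C *: (mat (cplx (Q - K a b)) *m Kco a b).
  by rewrite slot_projC.
(* the terms where the field is differentiated *)
have H1 : transvect (D a b (kap_a Q a b)) (upd (P a b) j (Xa a b)) I +
    transvect (D a b (sin a *: kap_b Q a b)) (upd (P a b) j (Xb a b)) I =
    (sin a * kap_radius Q a b ^+ 2)%:C *
    transvect (D a b (K a b)) (upd (P a b) j (1%:M - u)) I.
  have -> : transvect (D a b (kap_a Q a b)) (upd (P a b) j (Xa a b)) I =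
      (sin a)%:C * transvect (D a b (kap_a Q a b)) (upd (P a b) j
         (mat (cplx (kap_a Q a b)) *m Kco a b)) I.
    by rewrite /Xa cplxZ matZ -scalemxAl transvectZ.
  have -> : transvect (D a b (sin a *: kap_b Q a b)) (upd (P a b) j (Xb a b)) I =
      (sin a)%:C * transvect (D a b (kap_b Q a b)) (upd (P a b) j
         (mat (cplx (kap_b Q a b)) *m Kco a b)) I.
    rewrite !transvect_ddir mulr_sumr; apply: eq_bigr => c _.
    by rewrite mxE rmorphM mulrA.
  rewrite -mulrDr !transvect_ddir_mat bilin_completeness//.
  rewrite (@transvect_massless _ _ (pd_field phi (p0 + K a b))); last exact: phi_div.
  rewrite -!transvect_ddir_mat mat_comat_kap transvect0 addr0 subr0.
  by rewrite uC transvectZ [X in _ = X * _]rmorphM; ring.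
(* the terms where slot [j] is differentiated *)
have H2 : T a b (dXa a b) + T a b (dXb a b) = (sin a * kap_radius Q a b ^+ 2)%:C *
    (2 * T a b (1%:M - u) - T a b 1%:M).
  rewrite /T -transvectD.
  have -> : dXa a b + dXb a b = (sin a * kap_radius Q a b ^+ 2)%:C *:
      (2 *: (1%:M - u) - 1%:M).
    have h1 : mat (cplx (Q - 2 *: K a b)) *m Kco a b = (q2 / 2)%:C *: (1%:M - u).
      have -> : Q - 2 *: K a b = Q - K a b + (- 1) *: K a b.
        by rewrite scaleN1r scaler_nat mulr2n opprD addrA.
      rewrite cplxD matD mulmxDl (cplxZ (- 1)) matZ -scalemxAl mat_comat_kap scaler0 addr0.
      rewrite uC scalerA -rmorphM.
      have -> : q2 / 2 * (2 / q2) = 1 by field.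
      by rewrite scale1r.
    have h2 (v : 'rV[R]_4) : mink_form v v = - kap_radius Q a b ^+ 2 ->
        mat (cplx v) *m comat (cplx v) = (- (kap_radius Q a b ^+ 2 / 2))%:C *: 1%:M.
      move=> vv; rewrite mat_comat mink_form_cplx vv scale_scalar_mx mulr1; congr (_%:M).
      by rewrite -(mulNr _ 2^-1) [RHS]rmorphM fmorphV rmorph_nat.
    rewrite /dXa /dXb addrACA -mulmxDl -matD -cplxD kap_divergence//.
    rewrite (cplxZ (area_weight Q a b)) !(cplxZ (sin a)) !matZ comatZ -!scalemxAl -scalemxAr -scalerDr h1.
    rewrite (h2 _ (mink_kap_a_kap_a _ _ _)) (h2 _ (mink_kap_b_kap_b _ _ _)).
    have e1 : (area_weight Q a b)%:C * (q2 / 2)%:C =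
        (sin a * kap_radius Q a b ^+ 2)%:C * 2 :> C.
      by rewrite -(rmorph_nat (real_complex R)) -!rmorphM; congr (_%:C); rewrite -E; field.
    have e2 : (sin a)%:C * ((- (kap_radius Q a b ^+ 2 / 2))%:C +
        (- (kap_radius Q a b ^+ 2 / 2))%:C) = - (sin a * kap_radius Q a b ^+ 2)%:C :> C.
      by rewrite -rmorphD -rmorphM -rmorphN; congr (_%:C); field.
    by rewrite -scalerDl; move: (1%:M - u) => V; rewrite scalerBr !scalerA e1 e2 scaleNr.
  by rewrite transvectZ transvectB transvectZ.
(* the terms where one of the projectors is differentiated *)
have H3 : \sum_(k : 'I_n | (k < j)%N)
     transvect (Phi a b) (upd (upd (P a b) j (Xa a b)) k (dP (kap_a Q a b) k)) I +
   \sum_(k : 'I_n | (k < j)%N)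
     transvect (Phi a b) (upd (upd (P a b) j (Xb a b)) k (dP (sin a *: kap_b Q a b) k)) I
   = (sin a * kap_radius Q a b ^+ 2)%:C * (j%:R * T a b (1%:M - u)).
  rewrite -big_split /=.
  rewrite (eq_bigr (fun=> (sin a * kap_radius Q a b ^+ 2)%:C * T a b (1%:M - u))).
    rewrite (big_ord_narrow (ltnW (ltn_ord j))) sumr_const card_ord.
    by rewrite -mulr_natl; ring.
  move=> k kj.
  have jk : j != k by rewrite -val_eqE /= gt_eqF.
  pose B c e := transvect (Phi a b)
    (upd (upd (P a b) j (S c *m Kco a b)) k (S e *m comat (cplx Q))) I.
  have BE v w : transvect (Phi a b) (upd (upd (P a b) j (mat (cplx v) *m Kco a b)) k
      ((2 / q2)%:C *: (mat (cplx w) *m comat (cplx Q)))) I = (2 / q2)%:C * bilin B v w.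
    by rewrite transvectZ; congr (_ * _); exact: transvect_mat2.
  have B0 : \sum_c g_ c * B c c = 0.
    by apply: transvect_fierz => // J; exact: symmetrization_perm.
  have BK w : (2 / q2)%:C * bilin B (K a b) w = 0.
    by rewrite -BE mat_comat_kap (eq_transvect _ _ (upd_updC _ _ _ jk)) transvect0.
  have BN : (2 / q2)%:C * bilin B (Q - K a b) (K a b) =
      T a b (mat (cplx (Q - K a b)) *m Kco a b).
    rewrite -BE; apply: eq_transvect => l; rewrite /upd.
    by case: eqP => [->|//]; rewrite (eq_sym k) (negbTE jk) /slots kj.
  have Ea : transvect (Phi a b) (upd (upd (P a b) j (Xa a b)) k (dP (kap_a Q a b) k)) I =
      (sin a)%:C * ((2 / q2)%:C * bilin B (kap_a Q a b) (kap_a Q a b)).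
    by rewrite /dP kj (BE (sin a *: kap_a Q a b)) bilinZl mulrCA.
  have Eb : transvect (Phi a b) (upd (upd (P a b) j (Xb a b)) k
      (dP (sin a *: kap_b Q a b) k)) I =
      (sin a)%:C * ((2 / q2)%:C * bilin B (kap_b Q a b) (kap_b Q a b)).
    by rewrite /dP kj (BE (kap_b Q a b)) bilinZr mulrCA.
  have Eab : bilin B (kap_a Q a b) (kap_a Q a b) + bilin B (kap_b Q a b) (kap_b Q a b) =
      (kap_radius Q a b ^+ 2)%:C * ((2 / q2)%:C *
        (bilin B (K a b) (Q - K a b) + bilin B (Q - K a b) (K a b))).
    by rewrite (bilin_completeness B a b Qt) B0 subr0.
  have Tu : T a b (1%:M - u) = (2 / q2)%:C * ((2 / q2)%:C * bilin B (Q - K a b) (K a b)).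
    by rewrite BN /T uC transvectZ.
  apply: etrans (congr2 +%R Ea Eb) _.
  rewrite Tu -mulrDr -mulrDr Eab.
  have -> : (sin a * kap_radius Q a b ^+ 2)%:C = (sin a)%:C * (kap_radius Q a b ^+ 2)%:C :> C.
    by rewrite -rmorphM.
  have := BK (Q - K a b).
  move: (bilin B _ _) (bilin B _ _) (2 / q2)%:C => x y t xE.
  by ring: xE.
have dP0 v (k : 'I_n) : ~~ (k < j)%N -> dP v k = 0 by rewrite /dP => /negbTE ->.
have -> := congr1 (+%R _) (transvect_slot_sum (Phi a b) (P a b) (Xa a b) (dXa a b) I
  (dP0 (kap_a Q a b))) : fa a b = _.
have -> := congr1 (+%R _) (transvect_slot_sum (Phi a b) (P a b) (Xb a b) (dXb a b) I
  (dP0 (sin a *: kap_b Q a b))) : fb a b = _.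
rewrite addrACA H1 addrACA H2 H3 E -(natr1 j.+1) -(natr1 j); ring.
Qed.

Lemma shifted_kap_vda a b :
  is_vderive (fun x => p0 + K x b) a (kap_a Q a b).
Proof.
move=> c; have := is_deriveD_fun (is_derive_cst (p0 0 c) a 1) (kap_vda Qt a b c).
under [X in _ -> is_derive _ _ X _]eq_fun do rewrite mxE.
by rewrite add0r.
Qed.

Lemma shifted_kap_vdb a b :
  is_vderive (fun x => p0 + K a x) b (sin a *: kap_b Q a b).
Proof.
move=> c; have := is_deriveD_fun (is_derive_cst (p0 0 c) b 1) (kap_vdb Qt a b c).
under [X in _ -> is_derive _ _ X _]eq_fun do rewrite mxE.
by rewrite add0r.
Qed.

Let cfst : continuous (fun p : R * R => p.1). Proof. by move=> p; exact: cvg_fst. Qed.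
Let csnd : continuous (fun p : R * R => p.2). Proof. by move=> p; exact: cvg_snd. Qed.

Lemma vcont_kap2 : vcontinuous (fun p : R * R => K p.1 p.2).
Proof. by apply: vcont_kap => //; exact: vcont_cst. Qed.

Lemma ccont_Phi J : ccontinuous (fun p : R * R => Phi p.1 p.2 J).
Proof.
apply: (@ccontinuous_comp _ _ _ (fun p : R * R => p0 + K p.1 p.2) (fun x => phi x J)).
  apply: vcontinuous_continuous; apply: vcontD; first exact: vcont_cst.
  exact: vcont_kap2.
by apply: csmooth_ccontinuous; exact: sphi.
Qed.

Lemma ccont_D (v : R * R -> 'rV[R]_4) J : vcontinuous v ->
  ccontinuous (fun p : R * R => D p.1 p.2 (v p) J).
Proof.
move=> cv; apply: ccontinuous_sum => c; apply: ccontinuousM.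
  exact: ccontinuous_real.
apply: (@ccontinuous_comp _ _ _ (fun p : R * R => p0 + K p.1 p.2)
  (pd c (fun x => phi x J))).
  apply: vcontinuous_continuous; apply: vcontD; first exact: vcont_cst.
  exact: vcont_kap2.
by apply: csmooth_ccontinuous; apply: csmooth_pd; exact: sphi.
Qed.

Lemma mcont_slots (i : nat) (k : 'I_n) : mcontinuous (fun p : R * R => slots Q i p.1 p.2 k : 'M[C]_2).
Proof.
rewrite /slots; case: (k < i)%N; last exact: mcont_cst.
apply: mcontZ; apply: mcontM; last exact: mcont_cst.
by apply: mcont_mat; exact: vcont_kap2.
Qed.

Lemma mcont_upd (A : R * R -> 'I_n -> 'M[C]_2) (X : R * R -> 'M[C]_2) k :
  (forall l, mcontinuous (fun p => A p l)) -> mcontinuous X ->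
  forall l, mcontinuous (fun p => upd (A p) k (X p) l).
Proof. by move=> cA cX l; rewrite /upd; case: (l == k). Qed.

Lemma mderive_slots_a a b k :
  is_mderive (fun x => slots Q j x b k) a (dP (kap_a Q a b) k).
Proof.
rewrite /slots /dP; case: (k < j)%N; last exact: is_mderive_cst.
apply: is_mderiveZ; have := is_mderiveM (is_mderive_mat (kap_vda Qt a b))
  (is_mderive_cst (comat (cplx Q)) a).
by rewrite mulmx0 addr0.
Qed.

Lemma mderive_slots_b a b k :
  is_mderive (fun x => slots Q j a x k) b (dP (sin a *: kap_b Q a b) k).
Proof.
rewrite /slots /dP; case: (k < j)%N; last exact: is_mderive_cst.
apply: is_mderiveZ; have := is_mderiveM (is_mderive_mat (kap_vdb Qt a b))
  (is_mderive_cst (comat (cplx Q)) b).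
by rewrite mulmx0 addr0.
Qed.

Let vca : vcontinuous (fun p : R * R => kap_a Q p.1 p.2).
Proof. by apply: vcont_kap_a => //; exact: vcont_cst. Qed.
Let vcb : vcontinuous (fun p : R * R => kap_b Q p.1 p.2).
Proof. by apply: vcont_kap_b => //; exact: vcont_cst. Qed.
Let csin : continuous (fun p : R * R => sin p.1 : R).
Proof. exact: cont_sin. Qed.

Let cXa : mcontinuous (fun p : R * R => Xa p.1 p.2).
Proof.
apply: mcontM; last by apply: mcont_comat; exact: vcont_kap2.
by apply: mcont_mat; apply: vcontZ.
Qed.

Let cXb : mcontinuous (fun p : R * R => Xb p.1 p.2).
Proof.
apply: mcontM; last by apply: mcont_comat; exact: vcont_kap2.
exact: mcont_mat.
Qed.

Let cdP (v : R * R -> 'rV[R]_4) k : vcontinuous v -> mcontinuous (fun p => dP (v p) k).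
Proof.
move=> cv; rewrite /dP; case: (k < j)%N; last exact: mcont_cst.
by apply: mcontZ; apply: mcontM; [exact: mcont_mat|exact: mcont_cst].
Qed.

Let cfa : ccontinuous2 fa.
Proof.
apply: ccontinuousD.
  apply: ccontinuous_transvect => [J|k]; first exact: ccont_D.
  by apply: mcont_upd => [l|]; [exact: mcont_slots|exact: cXa].
apply: ccontinuous_sum => k; apply: ccontinuous_transvect => [J|l].
  exact: ccont_Phi.
apply: mcont_upd => [{}l|].
  by apply: mcont_upd => [{}l|]; [exact: mcont_slots|exact: cXa].
apply: (mcont_upd _ _ _ k) => [{}l|]; first exact: cdP.
apply: mcontD; apply: mcontM.
- by apply: mcont_mat; exact: vcont_kap_aa.
- by apply: mcont_comat; exact: vcont_kap2.
- by apply: mcont_mat; apply: vcontZ.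
- exact: mcont_comat.
Qed.

Let cfb : ccontinuous2 fb.
Proof.
have vsb : vcontinuous (fun p : R * R => sin p.1 *: kap_b Q p.1 p.2) by exact: vcontZ.
apply: ccontinuousD.
  apply: ccontinuous_transvect => [J|k]; first exact: ccont_D.
  by apply: mcont_upd => [l|]; [exact: mcont_slots|exact: cXb].
apply: ccontinuous_sum => k; apply: ccontinuous_transvect => [J|l].
  exact: ccont_Phi.
apply: mcont_upd => [{}l|].
  by apply: mcont_upd => [{}l|]; [exact: mcont_slots|exact: cXb].
apply: (mcont_upd _ _ _ k) => [{}l|]; first exact: cdP.
apply: mcontD; apply: mcontM.
- by apply: mcont_mat; exact: vcont_kap_bb.
- by apply: mcont_comat; exact: vcont_kap2.
- exact: mcont_mat.
- exact: mcont_comat.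
Qed.

Lemma ladder_a : rect_cintegral fa = 0.
Proof.
apply: (@rect_cintegral_da _ (fun a b => transvect (Phi a b) (upd (P a b) j (Xa a b)) I)).
- apply: ccontinuous_transvect => [J|k]; first exact: ccont_Phi.
  by apply: mcont_upd => [l|]; [exact: mcont_slots|exact: cXa].
- exact: cfa.
- move=> a b.
  apply: (@is_cderive_transvect _ _ (fun x => Phi x b) (D a b (kap_a Q a b))
    (fun x => upd (P x b) j (Xa x b))) => [J|k].
    by apply: (chain_rule (sphi J)); exact: shifted_kap_vda.
  rewrite /upd; case: (k == j); last exact: mderive_slots_a.
  apply: is_mderiveM; [apply: is_mderive_mat|apply: is_mderive_comat].
    exact: kap_a_vda.
  exact: kap_vda.
- move=> b; rewrite /Xa sin0 scale0r.
  by rewrite mat_cplx0 mul0mx transvect0.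
- move=> b; rewrite /Xa sinpi scale0r.
  by rewrite mat_cplx0 mul0mx transvect0.
Qed.

Lemma null_vec_periodic a : null_vec a (pi *+ 2) = null_vec a 0 :> 'rV[R]_4.
Proof. by rewrite /null_vec cos2pi sin2pi cos0 sin0. Qed.

Lemma long_vec_periodic : long_vec (pi *+ 2) = long_vec 0 :> 'rV[R]_4.
Proof. by rewrite /long_vec cos2pi sin2pi cos0 sin0. Qed.

Lemma kap_periodic a : K a (pi *+ 2) = K a 0.
Proof. by rewrite /kap /kap_radius null_vec_periodic. Qed.

Lemma kap_b_periodic a : kap_b Q a (pi *+ 2) = kap_b Q a 0.
Proof. by rewrite /kap_b /kap_radius null_vec_periodic long_vec_periodic. Qed.

Lemma ladder_b : rect_cintegral fb = 0.
Proof.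
apply: (@rect_cintegral_db _ (fun a b => transvect (Phi a b) (upd (P a b) j (Xb a b)) I)).
- exact: cfb.
- move=> a b.
  apply: (@is_cderive_transvect _ _ (fun x => Phi a x) (D a b (sin a *: kap_b Q a b))
    (fun x => upd (P a x) j (Xb a x))) => [J|k].
    by apply: (chain_rule (sphi J)); exact: shifted_kap_vdb.
  rewrite /upd; case: (k == j); last exact: mderive_slots_b.
  apply: is_mderiveM; [apply: is_mderive_mat|apply: is_mderive_comat].
    exact: kap_b_vdb.
  exact: kap_vdb.
- move=> a; rewrite /Xb kap_periodic kap_b_periodic.
  by apply: eq_transvect => k; rewrite /upd /slots /slot_proj kap_periodic.
Qed.

(** After [i] steps the coefficient of the field has become [i + 1]. *)
Definition rung (i : nat) : C := rect_cintegral (fun a b => (area_weight Q a b)%:C *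
  (transvect (D a b (K a b)) (slots Q i a b) I + i.+1%:R * transvect (Phi a b) (slots Q i a b) I)).

Lemma ccont_rung (i : nat) : ccontinuous2 (fun a b => (area_weight Q a b)%:C *
  (transvect (D a b (K a b)) (slots Q i a b) I + i.+1%:R * transvect (Phi a b) (slots Q i a b) I)).
Proof.
apply: ccontinuousM.
  by apply: ccontinuous_real; apply: cont_weight => //; exact: vcont_cst.
apply: ccontinuousD; last (apply: ccontinuousM; first exact: ccontinuous_cst).
  apply: ccontinuous_transvect => [J|k]; last exact: mcont_slots.
  by apply: ccont_D; exact: vcont_kap2.
apply: ccontinuous_transvect => [J|k]; last exact: mcont_slots.
exact: ccont_Phi.
Qed.

(** Write the complementary projector in [ladder_pointwise] as [1 - slot_proj] and
    integrate: the two terms are consecutive rungs. *)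
Lemma rung_step : rung j = rung j.+1.
Proof.
have q20 : q2 != 0 by case: Qt => /gt_eqF ->.
have P0 a b : upd (P a b) j 1%:M =1 P a b.
  by move=> k; rewrite /upd; case: eqP => // ->; rewrite /slots ltnn.
have P1 a b : upd (P a b) j (slot_proj Q a b) =1 slots Q j.+1 a b.
  move=> k; rewrite /upd /slots; case: (altP (k =P j)) => [->|kj]; first by rewrite ltnSn.
  have kj' : (k == j :> nat) = false by apply: contraNF kj => /eqP/val_inj ->.
  by rewrite ltnS [in RHS]leq_eqVlt kj'.
have cneg : ccontinuous2 (fun a b => -1 * ((area_weight Q a b)%:C *
  (transvect (D a b (K a b)) (slots Q j.+1 a b) I + j.+2%:R * transvect (Phi a b) (slots Q j.+1 a b) I))).
  by apply: ccontinuousM; [exact: ccontinuous_cst|exact: ccont_rung].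
apply/eqP; rewrite -subr_eq0 -mulN1r -rect_cintegralZ; last exact: ccont_rung.
rewrite -(rect_cintegralD (ccont_rung j) cneg).
have total : rect_cintegral (fun a b => fa a b + fb a b) = 0 :=
  etrans (rect_cintegralD cfa cfb) (etrans (congr2 +%R ladder_a ladder_b) (addr0 0)).
suff E : rect_cintegral (fun a b => fa a b + fb a b) = (q2 / 4)%:C *
    rect_cintegral (fun a b => (area_weight Q a b)%:C *
      (transvect (D a b (K a b)) (slots Q j a b) I + j.+1%:R * transvect (Phi a b) (slots Q j a b) I)
      + -1 * ((area_weight Q a b)%:C * (transvect (D a b (K a b)) (slots Q j.+1 a b) I
        + j.+2%:R * transvect (Phi a b) (slots Q j.+1 a b) I))).
  move: total; rewrite E => /eqP; rewrite mulf_eq0 => /orP[|//].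
  rewrite -(rmorph0 (real_complex R)) (inj_eq (@complexI R)) mulf_eq0 invr_eq0.
  by rewrite (negbTE q20) pnatr_eq0.
rewrite -(rect_cintegralZ _ (ccontinuousD (ccont_rung j) cneg)); apply: rect_cintegral_eq.
move=> a b _; rewrite ladder_pointwise /T !transvectB.
rewrite !(eq_transvect _ _ (P0 a b)) !(eq_transvect _ _ (P1 a b)).
rewrite rmorphM -(natr1 j.+1); ring.
Qed.

End ladder.

(** * Total weight of the cut *)

Section total_weight.
Context {R : realType}.
Implicit Types (Q : 'rV[R]_4).
Local Notation g_ := (@inv_metric R).

Let cfst : continuous (fun p : R * R => p.1). Proof. by move=> p; exact: cvg_fst. Qed.
Let csnd : continuous (fun p : R * R => p.2). Proof. by move=> p; exact: cvg_snd. Qed.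

(** The integral of the divergence of the tangent frame. *)
Lemma weighted_mean Q c : future_timelike Q ->
  rect_integral (fun a b => area_weight Q a b * (Q - 2 *: kap Q a b) 0 c) = 0.
Proof.
move=> Qt.
have ca : continuous2 (fun a b => kap_aa Q a b 0 c) by apply: vcont_kap_aa.
have cb : continuous2 (fun a b => kap_bb Q a b 0 c) by apply: vcont_kap_bb.
rewrite (@rect_integral_eq _ _ (fun a b => kap_aa Q a b 0 c + kap_bb Q a b 0 c)); last first.
  move=> a b _; have := kap_divergence Qt a b => /rowP/(_ c).
  by rewrite mxE [RHS]mxE.
rewrite rect_integralD//.
have vQ : vcontinuous (fun _ : R * R => Q) by exact: vcont_cst.
have ia : rect_integral (fun a b => kap_aa Q a b 0 c) = 0.
  apply: (@rect_integral_da _ (fun a b => (sin a *: kap_a Q a b) 0 c)).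
  - suff : vcontinuous (fun p : R * R => sin p.1 *: kap_a Q p.1 p.2) by exact.
    by apply: vcontZ; [exact: cont_sin|exact: vcont_kap_a].
  - exact: ca.
  - by move=> a b; exact: kap_a_vda.
  - by move=> b; rewrite sin0 scale0r mxE.
  - by move=> b; rewrite sinpi scale0r mxE.
rewrite ia add0r.
apply: (@rect_integral_db _ (fun a b => kap_b Q a b 0 c)).
- exact: cb.
- by move=> a b; exact: kap_b_vdb.
- by move=> a; rewrite kap_b_periodic.
Qed.

Lemma is_derive_mink2 (u v : R -> 'rV[R]_4) (t : R) du dv :
  is_vderive u t du -> is_vderive v t dv ->
  is_derive t 1 (fun x => mink_form (u x) (v x)) (mink_form du (v t) + mink_form (u t) dv).
Proof.
move=> duE dvE; rewrite !mink_formE -big_split /=.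
under eq_fun do rewrite mink_formE.
have H c : is_derive t 1 (fun x => g_ c * (u x 0 c * v x 0 c))
    (g_ c * (du 0 c * v t 0 c) + g_ c * (u t 0 c * dv 0 c)).
  have := is_deriveM_fun (is_derive_cst (g_ c) t 1) (is_deriveM_fun (duE c) (dvE c)).
  by move/is_derive_eq; apply; rewrite mul0r add0r mulrDr.
have := is_derive_sum H; rewrite (_ : (\sum_(i < 4) _) =
  (fun x => \sum_c g_ c * (u x 0 c * v x 0 c)))//.
by apply/funext => x; rewrite fct_sumE.
Qed.

Lemma rect_integral_mink Q' (v : R -> R -> 'rV[R]_4) (w : R -> R -> R) :
  (forall c, continuous2 (fun a b => w a b * v a b 0 c)) ->
  rect_integral (fun a b => w a b * mink_form Q' (v a b)) =
  \sum_c g_ c * Q' 0 c * rect_integral (fun a b => w a b * v a b 0 c).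
Proof.
move=> cw.
rewrite (@rect_integral_eq _ _ (fun a b => \sum_c (g_ c * Q' 0 c) * (w a b * v a b 0 c))); last first.
  move=> a b _; rewrite mink_formE mulr_sumr; apply: eq_bigr => c _; ring.
elim: (index_enum _) => [|c r IH].
  rewrite big_nil (@rect_integral_eq _ _ (fun a b => 0 * w 0 0)).
    by rewrite rect_integralZ ?mul0r//; exact: cont_cst.
  by move=> a b _; rewrite big_nil mul0r.
rewrite big_cons -IH -rect_integralZ// -rect_integralD//; last 2 first.
- exact: continuous2Z.
- elim: r {IH} => [|d r IH].
    by rewrite /continuous2; under eq_fun do rewrite big_nil; exact: cont_cst.
  rewrite /continuous2; under eq_fun do rewrite big_cons.
  apply: contD; [apply: contM; [exact: cont_cst|exact: (cw d)]|exact: IH].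
by apply: rect_integral_eq => a b _; rewrite big_cons.
Qed.

(** The combination [Q - 2 kap] is the one of which [weighted_mean] says that the
    integral vanishes. *)
Lemma is_derive_weight (Q : R -> 'rV[R]_4) (dQ : 'rV[R]_4) (s a b : R) :
  future_timelike (Q s) -> is_vderive Q s dQ ->
  is_derive s 1 (fun x => area_weight (Q x) a b)
    (2 / mink_form (Q s) (Q s) *
     (area_weight (Q s) a b * mink_form dQ (Q s - 2 *: kap (Q s) a b))).
Proof.
move=> Qt dQE.
have dn : mink_form (Q s) (null_vec a b) != 0 by rewrite gt_eqF// timelike_null_gt0.
have q20 : mink_form (Q s) (Q s) != 0 by case: Qt => /gt_eqF ->.
have k0 : is_vderive (fun=> null_vec a b) s 0.
  by move=> c; rewrite [X in is_derive _ _ _ X]mxE; exact: is_derive_cst.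
have dd := is_derive_mink2 dQE k0.
have dq := is_derive_mink2 dQE dQE.
have dn2 := mulf_neq0 dn dn.
have H := is_deriveM_fun (is_deriveM_fun dq (is_derive_cst (sin a) s 1))
  (is_deriveV (f := fun x => mink_form (Q x) (null_vec a b) * mink_form (Q x) (null_vec a b))
     dn2 (is_deriveM_fun dd dd)).
rewrite /area_weight; under eq_fun do rewrite expr2.
apply: is_derive_eq H _.
have -> : mink_form (Q s) 0 = 0 by rewrite -(scale0r 0) mink_formZr mul0r.
rewrite -scaleNr mink_formDr /kap !mink_formZr /kap_radius (mink_formC (Q s) dQ) /GRing.scale /=.
field; by rewrite q20 dn.
Qed.

(** A path from the time axis to [Q], reached at [pi / 2]. The sine keeps the path
    among timelike vectors for every parameter. *)
Definition boost_path Q (s : R) := (Q 0 0) *: time_vec + sin s *: (Q - (Q 0 0) *: time_vec).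

Lemma boost_path_timelike Q s : future_timelike Q -> future_timelike (boost_path Q s).
Proof.
move=> [q2 Q0].
have tt : mink_form time_vec time_vec = 1 :> R.
  by rewrite mink_time mxE.
have e0 : boost_path Q s 0 0 = Q 0 0.
  rewrite -[LHS]mink_time /boost_path mink_formDl !mink_formZl mink_formDl -scaleNr.
  by rewrite mink_formZl tt mink_time; ring.
split; last by rewrite e0.
have -> : mink_form (boost_path Q s) (boost_path Q s) =
    Q 0 0 ^+ 2 - sin s ^+ 2 * (Q 0 0 ^+ 2 - mink_form Q Q).
  rewrite /boost_path -scaleN1r !mink_formDl !mink_formDr !mink_formZl !mink_formZr.
  rewrite !mink_formDl !mink_formDr !mink_formZl !mink_formZr.
  by rewrite (mink_formC time_vec Q) tt mink_time; ring.
have s1 : sin s ^+ 2 <= 1 by rewrite sin2cos2 lerBlDr lerDl sqr_ge0.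
have := sqr_ge0 (sin s); move: (sin s ^+ 2) s1 => x x1 x0.
have y0 : 0 < Q 0 0 ^+ 2 by rewrite exprn_gt0.
have -> : Q 0 0 ^+ 2 - x * (Q 0 0 ^+ 2 - mink_form Q Q) =
  (1 - x) * Q 0 0 ^+ 2 + x * mink_form Q Q by ring.
case: (ltgtP x 0) x0 => // [xp|->] _; last by rewrite subr0 mul1r mul0r addr0.
by rewrite ltr_wpDl ?mulr_gt0// mulr_ge0 ?subr_ge0// ltW.
Qed.

Lemma boost_path_vderive Q s :
  is_vderive (boost_path Q) s (cos s *: (Q - (Q 0 0) *: time_vec)).
Proof.
move=> c.
pose A := (Q 0 0 *: time_vec : 'rV[R]_4) 0 c; pose B := (Q - Q 0 0 *: time_vec) 0 c.
have E x : boost_path Q x 0 c = A + sin x * B.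
  by rewrite /boost_path mxE; congr (_ + _); rewrite mxE.
have -> : (cos s *: (Q - Q 0 0 *: time_vec)) 0 c = cos s * B by rewrite mxE.
under eq_fun do rewrite E.
have := is_deriveD_fun (is_derive_cst A s 1)
  (is_deriveM_fun (is_derive_sin s) (is_derive_cst B s 1)).
by move/is_derive_eq; apply; rewrite mulr0 addr0 add0r.
Qed.

(** Independent of [Q] along [boost_path], by [is_derive_weight] and
    [weighted_mean]; for [Q] along the time axis the weight is [sin a]. *)
Lemma total_weight Q : future_timelike Q ->
  rect_integral (area_weight Q) = 4 * pi.
Proof.
move=> Qt.
pose V s := rect_integral (area_weight (boost_path Q s)).
have bt s := boost_path_timelike s Qt.
pose dQ s := cos s *: (Q - (Q 0 0) *: time_vec).
have c1 : continuous (fun p : R * R * R => p.1.1).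
  by move=> p; apply: (@continuous_comp _ _ _ fst fst); exact: cvg_fst.
have c2 : continuous (fun p : R * R * R => p.1.2).
  by move=> p; apply: (@continuous_comp _ _ _ fst snd); [exact: cvg_fst|exact: cvg_snd].
have c3 : continuous (fun p : R * R * R => p.2) by move=> p; exact: cvg_snd.
have cQ : vcontinuous (fun p : R * R * R => boost_path Q p.1.1).
  by apply: vcontD; [exact: vcont_cst|apply: vcontZ; [exact: cont_sin|exact: vcont_cst]].
have cdQ : vcontinuous (fun p : R * R * R => dQ p.1.1).
  by apply: vcontZ; [exact: cont_cos|exact: vcont_cst].
have cW : continuous (fun p : R * R * R => area_weight (boost_path Q p.1.1) p.1.2 p.2).
  by apply: cont_weight.
have cK : vcontinuous (fun p : R * R * R =>
    boost_path Q p.1.1 - 2 *: kap (boost_path Q p.1.1) p.1.2 p.2).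
  by apply: vcontB => //; apply: vcontZ; [exact: cont_cst|exact: vcont_kap].
have dV (s : R) : is_derive s 1 V 0.
  have := @is_derive_rect_integral R (fun s => area_weight (boost_path Q s))
    (fun s a b => 2 / mink_form (boost_path Q s) (boost_path Q s) *
     (area_weight (boost_path Q s) a b * mink_form (dQ s)
        (boost_path Q s - 2 *: kap (boost_path Q s) a b))) s.
  move=> H; have {}H := H cW.
  have cD : continuous (fun p : R * R * R =>
    2 / mink_form (boost_path Q p.1.1) (boost_path Q p.1.1) *
     (area_weight (boost_path Q p.1.1) p.1.2 p.2 * mink_form (dQ p.1.1)
        (boost_path Q p.1.1 - 2 *: kap (boost_path Q p.1.1) p.1.2 p.2))).
    apply: contM; first apply: contM; first exact: cont_cst.
      apply: contV => [p|]; last exact: cont_mink.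
      by case: (bt p.1.1) => /gt_eqF ->.
    by apply: contM => //; exact: cont_mink.
  have {}H := H cD (fun s a b => is_derive_weight a b (bt s) (boost_path_vderive Q s)).
  apply: is_derive_eq H _.
  have cWK c : continuous2 (fun a b => area_weight (boost_path Q s) a b *
      (boost_path Q s - 2 *: kap (boost_path Q s) a b) 0 c).
    have vQ : vcontinuous (fun _ : R * R => boost_path Q s) by exact: vcont_cst.
    apply: contM; first by apply: cont_weight.
    suff : vcontinuous (fun p : R * R => boost_path Q s - 2 *: kap (boost_path Q s) p.1 p.2) by exact.
    by apply: vcontB => //; apply: vcontZ; [exact: cont_cst|exact: vcont_kap].
  rewrite rect_integralZ; last first.
    have vQ : vcontinuous (fun _ : R * R => boost_path Q s) by exact: vcont_cst.
    apply: contM; first by apply: cont_weight.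
    apply: cont_mink; first exact: vcont_cst.
    by apply: vcontB => //; apply: vcontZ; [exact: cont_cst|exact: vcont_kap].
  rewrite rect_integral_mink// big1 ?mulr0// => c _.
  by rewrite weighted_mean// mulr0.
have V1 : V (pi / 2) = rect_integral (area_weight Q).
  by rewrite /V /boost_path sin_pihalf scale1r addrC subrK.
rewrite -V1 (is_derive_0_is_cst _ 0 dV) /V.
have b0 : boost_path Q 0 = Q 0 0 *: time_vec by rewrite /boost_path sin0 scale0r addr0.
have Q0 : Q 0 0 != 0 by case: Qt => _ /gt_eqF ->.
rewrite (@rect_integral_eq _ _ (fun a b => sin a)); last first.
  move=> a b _; rewrite b0 /area_weight !mink_formZl mink_formZr.
  have -> : mink_form time_vec time_vec = 1 :> R by rewrite mink_time mxE.
  have -> : mink_form time_vec (null_vec a b) = 1.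
    by rewrite mink_formC mink_time mxE.
  by field.
have inner (a : R) : \int[lebesgue_measure]_(b in `[0, pi *+ 2]) sin a = sin a * (pi *+ 2).
  have H (t : R) : is_derive t 1 (fun b => sin a * b) (sin a).
    have := is_deriveM_fun (is_derive_cst (sin a) t 1) (is_derive_id t 1).
    by move/is_derive_eq; apply; rewrite mul0r add0r mulr1.
  have cs : continuous (fun _ : R => sin a) by exact: cont_cst.
  by rewrite (integral_derive (pi2_ge0 (R := R)) cs H) mulr0 subr0.
rewrite /rect_integral; under eq_Rintegral do rewrite inner.
have H (t : R) : is_derive t 1 (fun a => - 1 * (cos a * (pi *+ 2))) (sin t * (pi *+ 2)).
  have := is_deriveM_fun (is_derive_cst (-1 : R) t 1)
    (is_deriveM_fun (is_derive_cos t) (is_derive_cst (pi *+ 2 : R) t 1)).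
  by move/is_derive_eq; apply; rewrite mul0r add0r mulr0 addr0 mulN1r mulNr opprK.
have cs : continuous (fun a : R => sin a * (pi *+ 2)).
  by apply: contM; [apply: cont_sin => x; exact: cvg_id|exact: cont_cst].
rewrite (integral_derive (pi_ge0 R) cs H) cospi cos0; ring.
Qed.

End total_weight.

(** * The Kirchhoff formula *)

Section kirchhoff.
Context {R : realType}.
Local Notation C := R[i].
Local Notation g_ := (@inv_metric C).
Variables (Q p0 : 'rV[R]_4) (f : 'rV[R]_4 -> C).
Hypothesis Qt : future_timelike Q.
Hypothesis sf : csmooth_in setT f.
Hypothesis wave : forall x, chrono_future p0 x -> \sum_a g_ a * pd a (pd a f) x = 0.
Local Notation q2 := (mink_form Q Q).
Local Notation K a b := (kap Q a b).

Let pt (s a b : R) := p0 + Q - s *: (Q - K a b).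
Let hess x := fun c e => pd e (pd c f) x.

Let fa s a b := ddir f (pt s a b) (kap_aa Q a b) +
  (sin a * s)%:C * bilin (hess (pt s a b)) (kap_a Q a b) (kap_a Q a b).
Let fb s a b := ddir f (pt s a b) (kap_bb Q a b) +
  (sin a * s)%:C * bilin (hess (pt s a b)) (kap_b Q a b) (kap_b Q a b).
Let mean s a b := (area_weight Q a b)%:C *
  (s%:C * ddir f (pt s a b) (K a b) + f (pt s a b)).
Let dmean s a b := (area_weight Q a b)%:C *
  (ddir f (pt s a b) (K a b) - s%:C * bilin (hess (pt s a b)) (K a b) (Q - K a b)
   - ddir f (pt s a b) (Q - K a b)).

Lemma ddirD x u v : ddir f x (u + v) = ddir f x u + ddir f x v.
Proof.
by rewrite /ddir -big_split; apply: eq_bigr => c _; rewrite mxE rmorphD mulrDl.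
Qed.

Lemma ddirZ (F : 'rV[R]_4 -> C) x r v : ddir F x (r *: v) = r%:C * ddir F x v.
Proof.
by rewrite /ddir mulr_sumr; apply: eq_bigr => c _; rewrite mxE rmorphM mulrA.
Qed.

Lemma ddirN (F : 'rV[R]_4 -> C) x v : ddir F x (- v) = - ddir F x v.
Proof. by rewrite -scaleN1r ddirZ rmorphN rmorph1 mulN1r. Qed.

Lemma bilinE x u v : bilin (hess x) u v = \sum_c (u 0 c)%:C * ddir (pd c f) x v.
Proof.
by apply: eq_bigr => c _; rewrite mulr_sumr; apply: eq_bigr => e _; rewrite mulrA.
Qed.

Lemma bilinC x u v : bilin (hess x) u v = bilin (hess x) v u.
Proof.
rewrite /bilin exchange_big; apply: eq_bigr => c _; apply: eq_bigr => e _.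
by rewrite /hess pdC// [X in X * _]mulrC.
Qed.

(** Before the segment reaches the cone the wave equation is available. *)
Lemma pt_timelike s a b : 0 <= s -> s < 1 -> chrono_future p0 (pt s a b).
Proof.
move=> s0 s1.
have -> : pt s a b = p0 + ((1 - s) *: Q + s *: K a b).
  by rewrite /pt scalerBr scalerBl scale1r -addrA; congr (_ + _); rewrite opprB addrA addrAC.
have k0 : 0 < K a b 0 0.
  by rewrite /kap mxE [X in _ * X]mxE mulr1 kap_radius_gt0.
have := mink_kap_kap Q a b; have := mink_Q_kap Qt a b; move: (K a b) k0 => k k0 Qk kk.
have s1' : 0 < 1 - s by rewrite subr_gt0.
apply: chrono_futureE; case: Qt => q0 Q0; split; last first.
  by rewrite mxE [X in X + _]mxE [X in _ + X]mxE ltr_pwDl ?mulr_gt0// mulr_ge0// ltW.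
rewrite !mink_formDl !mink_formDr !mink_formZl !mink_formZr kk (mink_formC k Q) Qk.
rewrite !mulr0 addr0 -addrA ltr_pwDl ?mulr_gt0//.
by rewrite addr_ge0// !mulr_ge0// ltW.
Qed.

(** Decompose the inverse metric in the wave equation by [bilin_completeness]: the
    mixed second derivative along [kap] and [Q - kap] becomes tangential, and the
    first order terms are matched by [kap_divergence]. *)
Lemma dmean_divergence s a b : 0 < s -> s < 1 ->
  dmean s a b = - 1 * (fa s a b + fb s a b).
Proof.
move=> s0 s1.
have q20 : q2 != 0 by case: Qt => /gt_eqF ->.
have E : q2 / 4 * area_weight Q a b = sin a * kap_radius Q a b ^+ 2.
  have -> : q2 / 4 * area_weight Q a b = (area_weight Q a b * q2) / 4 by ring.
  by rewrite area_weightE//; field.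
have -> : fa s a b + fb s a b = ddir f (pt s a b) (kap_aa Q a b + kap_bb Q a b) +
   (sin a * s)%:C * (bilin (hess (pt s a b)) (kap_a Q a b) (kap_a Q a b) +
    bilin (hess (pt s a b)) (kap_b Q a b) (kap_b Q a b)).
  by rewrite ddirD /fa /fb; ring.
rewrite bilin_completeness// wave; last by apply: pt_timelike => //; exact: ltW.
rewrite subr0 kap_divergence// ddirZ (bilinC _ (Q - _)) /dmean.
have -> : ddir f (pt s a b) (Q - 2 *: K a b) =
    ddir f (pt s a b) (Q - K a b) - ddir f (pt s a b) (K a b).
  have -> : Q - 2 *: K a b = (Q - K a b) + (-1) *: K a b.
    by rewrite scaleN1r scaler_nat mulr2n opprD addrA.
  by rewrite [LHS]ddirD (ddirZ f _ (-1)) rmorphN rmorph1 mulN1r.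
have e : (sin a * s)%:C * (kap_radius Q a b ^+ 2)%:C * (2 / q2)%:C * 2 =
   (area_weight Q a b)%:C * s%:C :> C.
  rewrite -(rmorph_nat (real_complex R)) -!rmorphM; congr (_%:C).
  have -> : sin a * s * kap_radius Q a b ^+ 2 * (2 / q2) * 2 =
    sin a * kap_radius Q a b ^+ 2 * (4 * s / q2) by field.
  by rewrite -E; field.
move: e; move: (ddir f _ (K a b)) (ddir f _ (Q - K a b)) (bilin _ _ _) => X Y Z.
move: (area_weight Q a b)%:C s%:C (sin a * s)%:C (kap_radius Q a b ^+ 2)%:C (2 / q2)%:C.
move=> w t u v z e.
transitivity (w * (X - Y) - (w * t) * Z); first by ring.
by rewrite -e; ring.
Qed.

Lemma pt_vds s a b : is_vderive (fun x => pt x a b) s (- (Q - K a b)).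
Proof.
by have := line_vderive (p0 + Q) (- (Q - K a b)) s; under eq_fun do rewrite scalerN.
Qed.

Lemma pt_vda s a b : is_vderive (fun x => pt s x b) a (s *: kap_a Q a b).
Proof.
move=> c; rewrite mxE.
have E x : pt s x b 0 c = (p0 + Q - s *: Q) 0 c + s * K x b 0 c.
  have -> : pt s x b = (p0 + Q - s *: Q) + s *: K x b.
    by rewrite /pt scalerBr opprB addrA addrAC.
  by rewrite mxE [X in _ + X]mxE.
under eq_fun do rewrite E.
have := is_deriveD_fun (is_derive_cst ((p0 + Q - s *: Q) 0 c) a 1)
  (is_deriveM_fun (is_derive_cst s a 1) (kap_vda Qt a b c)).
by move/is_derive_eq; apply; rewrite mul0r !add0r.
Qed.

Lemma pt_vdb s a b : is_vderive (pt s a) b (s *: (sin a *: kap_b Q a b)).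
Proof.
move=> c; rewrite mxE.
have E x : pt s a x 0 c = (p0 + Q - s *: Q) 0 c + s * K a x 0 c.
  have -> : pt s a x = (p0 + Q - s *: Q) + s *: K a x.
    by rewrite /pt scalerBr opprB addrA addrAC.
  by rewrite mxE [X in _ + X]mxE.
under eq_fun do rewrite E.
have := is_deriveD_fun (is_derive_cst ((p0 + Q - s *: Q) 0 c) b 1)
  (is_deriveM_fun (is_derive_cst s b 1) (kap_vdb Qt a b c)).
by move/is_derive_eq; apply; rewrite mul0r !add0r.
Qed.

Section cont.
Variables (T : topologicalType) (s a b : T -> R).
Hypotheses (cs : continuous s) (ca : continuous a) (cb : continuous b).

Lemma vcont_K : vcontinuous (fun x => K (a x) (b x)).
Proof. by apply: vcont_kap => //; exact: vcont_cst. Qed.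

Lemma cont_pt : continuous (fun x => pt (s x) (a x) (b x)).
Proof.
apply: vcontinuous_continuous; apply: vcontB; first exact: vcont_cst.
by apply: vcontZ => //; apply: vcontB; [exact: vcont_cst|exact: vcont_K].
Qed.

Lemma cont_at (F : 'rV[R]_4 -> C) : csmooth_in setT F ->
  ccontinuous (fun x => F (pt (s x) (a x) (b x))).
Proof.
move=> sF; apply: (@ccontinuous_comp _ _ _ (fun x => pt (s x) (a x) (b x)) F).
  exact: cont_pt.
exact: csmooth_ccontinuous.
Qed.

Lemma cont_ddir (v : T -> 'rV[R]_4) : vcontinuous v ->
  ccontinuous (fun x => ddir f (pt (s x) (a x) (b x)) (v x)).
Proof.
move=> cv; apply: ccontinuous_sum => c; apply: ccontinuousM.
  exact: ccontinuous_real.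
by apply: cont_at; exact: csmooth_pd.
Qed.

Lemma cont_bilin (u v : T -> 'rV[R]_4) : vcontinuous u -> vcontinuous v ->
  ccontinuous (fun x => bilin (hess (pt (s x) (a x) (b x))) (u x) (v x)).
Proof.
move=> cu cv; apply: ccontinuous_sum => c; apply: ccontinuous_sum => e.
apply: ccontinuousM; last by apply: cont_at; do 2 apply: csmooth_pd.
by apply: ccontinuousM; exact: ccontinuous_real.
Qed.

Lemma cont_mean : ccontinuous (fun x => mean (s x) (a x) (b x)).
Proof.
apply: ccontinuousM.
  by apply: ccontinuous_real; apply: cont_weight => //; exact: vcont_cst.
apply: ccontinuousD; last exact: cont_at.
by apply: ccontinuousM; [exact: ccontinuous_real|apply: cont_ddir; exact: vcont_K].
Qed.

Lemma cont_dmean : ccontinuous (fun x => dmean (s x) (a x) (b x)).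
Proof.
have cB (g h : T -> C) : ccontinuous g -> ccontinuous h -> ccontinuous (fun x => g x - h x).
  move=> cg ch; under eq_fun do rewrite -mulN1r.
  by apply: ccontinuousD => //; apply: ccontinuousM => //; exact: ccontinuous_cst.
have cK := vcont_K.
have cN : vcontinuous (fun x => Q - K (a x) (b x)).
  by apply: vcontB => //; exact: vcont_cst.
apply: ccontinuousM.
  by apply: ccontinuous_real; apply: cont_weight => //; exact: vcont_cst.
apply: (cB _ _); last exact: cont_ddir.
apply: (cB _ _); first exact: cont_ddir.
by apply: ccontinuousM; [exact: ccontinuous_real|exact: cont_bilin].
Qed.

Lemma cont_fa : ccontinuous (fun x => fa (s x) (a x) (b x)).
Proof.
have cA : vcontinuous (fun x => kap_a Q (a x) (b x)).
  by apply: vcont_kap_a => //; exact: vcont_cst.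
apply: ccontinuousD; first by apply: cont_ddir; exact: vcont_kap_aa.
apply: ccontinuousM; last exact: cont_bilin.
by apply: ccontinuous_real; apply: contM => //; exact: cont_sin.
Qed.

Lemma cont_fb : ccontinuous (fun x => fb (s x) (a x) (b x)).
Proof.
have cB : vcontinuous (fun x => kap_b Q (a x) (b x)).
  by apply: vcont_kap_b => //; exact: vcont_cst.
apply: ccontinuousD; first by apply: cont_ddir; exact: vcont_kap_bb.
apply: ccontinuousM; last exact: cont_bilin.
by apply: ccontinuous_real; apply: contM => //; exact: cont_sin.
Qed.

End cont.

Let cfst : continuous (fun p : R * R => p.1). Proof. by move=> p; exact: cvg_fst. Qed.
Let csnd : continuous (fun p : R * R => p.2). Proof. by move=> p; exact: cvg_snd. Qed.

Lemma ddir0 x : ddir f x 0 = 0.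
Proof. by rewrite -[0 in LHS](scale0r (0 : 'rV[R]_4)) ddirZ mul0r. Qed.

Lemma fa_integral s : rect_cintegral (fa s) = 0.
Proof.
have cs (r : R) : continuous (fun _ : R * R => r) by exact: cont_cst.
apply: (@rect_cintegral_da _ (fun a b => ddir f (pt s a b) (sin a *: kap_a Q a b))).
- apply: (@cont_ddir _ (fun=> s) fst snd) => //.
  apply: vcontZ; first exact: cont_sin.
  by apply: vcont_kap_a => //; exact: vcont_cst.
- exact: (@cont_fa _ (fun=> s) fst snd).
- move=> a b; apply: is_cderive_eq.
    apply: is_cderive_sum => c; apply: is_cderiveM.
      by apply: is_cderive_real; exact: kap_a_vda.
    by apply: chain_rule; [exact: csmooth_pd|exact: pt_vda].
  rewrite big_split /= /fa; congr (_ + _).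
  rewrite bilinE mulr_sumr; apply: eq_bigr => c _.
  by rewrite ddirZ mxE !rmorphM; ring.
- by move=> b; rewrite sin0 scale0r ddir0.
- by move=> b; rewrite sinpi scale0r ddir0.
Qed.

Lemma fb_integral s : rect_cintegral (fb s) = 0.
Proof.
have cs (r : R) : continuous (fun _ : R * R => r) by exact: cont_cst.
apply: (@rect_cintegral_db _ (fun a b => ddir f (pt s a b) (kap_b Q a b))).
- exact: (@cont_fb _ (fun=> s) fst snd).
- move=> a b; apply: is_cderive_eq.
    apply: is_cderive_sum => c; apply: is_cderiveM.
      by apply: is_cderive_real; exact: kap_b_vdb.
    by apply: chain_rule; [exact: csmooth_pd|exact: pt_vdb].
  rewrite big_split /= /fb; congr (_ + _).
  rewrite bilinE mulr_sumr; apply: eq_bigr => c _.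
  by rewrite !ddirZ !rmorphM; ring.
- by move=> a; rewrite /pt kap_periodic kap_b_periodic.
Qed.

Lemma mean_derive s : is_cderive (fun s => rect_cintegral (mean s)) s
  (rect_cintegral (dmean s)).
Proof.
have c1 : continuous (fun p : R * R * R => p.1.1).
  by move=> p; apply: (@continuous_comp _ _ _ fst fst); exact: cvg_fst.
have c2 : continuous (fun p : R * R * R => p.1.2).
  by move=> p; apply: (@continuous_comp _ _ _ fst snd); [exact: cvg_fst|exact: cvg_snd].
have c3 : continuous (fun p : R * R * R => p.2) by move=> p; exact: cvg_snd.
apply: is_cderive_rect_cintegral.
- exact: (@cont_mean _ (fun p : R * R * R => p.1.1) (fun p => p.1.2) snd).
- exact: (@cont_dmean _ (fun p : R * R * R => p.1.1) (fun p => p.1.2) snd).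
move=> {}s a b; apply: is_cderive_eq.
  apply: is_cderiveZ; apply: is_cderiveD; last by apply: (chain_rule sf); exact: pt_vds.
  apply: is_cderiveM; first by apply: is_cderive_real; exact: is_derive_id.
  apply: is_cderive_sum => c; apply: is_cderiveZ.
  by apply: chain_rule; [exact: csmooth_pd|exact: pt_vds].
rewrite /dmean /= mul1r ddirN; congr (_ * (_ + _ + _)).
rewrite bilinE -mulrN; congr (_ * _); rewrite -sumrN; apply: eq_bigr => c _.
by rewrite ddirN mulrN.
Qed.

Lemma is_derive0_segment (h : R -> R) (dh : R -> R) :
  (forall s : R, is_derive s 1 h (dh s)) -> (forall s, 0 < s -> s < 1 -> dh s = 0) ->
  h 1 = h 0.
Proof.
move=> hd h0.
have ch : continuous h.
  move=> t; apply: differentiable_continuous; apply/derivable1_diffP.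
  by apply: ex_derive; exact: hd.
have [c] := @MVT R h dh 0 1 ltr01 (fun x _ => hd x) (continuous_subspaceT ch).
rewrite in_itv /= => /andP[c0 c1]; rewrite h0// mul0r => /eqP.
by rewrite subr_eq0 => /eqP.
Qed.

Lemma is_cderive0_segment (h : R -> C) (dh : R -> C) :
  (forall s, is_cderive h s (dh s)) -> (forall s, 0 < s -> s < 1 -> dh s = 0) ->
  h 1 = h 0.
Proof.
move=> hd h0; apply: complex_ext.
  apply: (@is_derive0_segment (fun s => complex.Re (h s)) (fun s => complex.Re (dh s))).
    by move=> s; exact: (hd s).1.
  by move=> s s0 s1; rewrite h0.
apply: (@is_derive0_segment (fun s => complex.Im (h s)) (fun s => complex.Im (dh s))).
  by move=> s; exact: (hd s).2.
by move=> s s0 s1; rewrite h0.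
Qed.

(** The integral of [mean s] is constant on [0, 1]; at [s = 1] it lives on the cut
    and at [s = 0] at the vertex. *)
Lemma kirchhoff : rect_cintegral (fun a b => (area_weight Q a b)%:C *
    (ddir f (p0 + K a b) (K a b) + f (p0 + K a b))) = (4 * pi)%:C * f (p0 + Q).
Proof.
have cs (r : R) : continuous (fun _ : R * R => r) by exact: cont_cst.
have H := is_cderive0_segment mean_derive.
have e1 : rect_cintegral (mean 1) = rect_cintegral (fun a b => (area_weight Q a b)%:C *
    (ddir f (p0 + K a b) (K a b) + f (p0 + K a b))).
  apply: rect_cintegral_eq => a b _; rewrite /mean rmorph1 mul1r.
  have -> // : pt 1 a b = p0 + K a b.
  by rewrite /pt scale1r opprB addrACA subrr addr0.
rewrite -e1 H.
  have -> : rect_cintegral (mean 0) =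
      rect_cintegral (fun a b => f (p0 + Q) * (area_weight Q a b)%:C).
    apply: rect_cintegral_eq => a b _; rewrite /mean rmorph0 mul0r add0r mulrC.
    by rewrite /pt scale0r subr0.
  rewrite rect_cintegralZ; last first.
    by apply: ccontinuous_real; apply: cont_weight => //; exact: vcont_cst.
  rewrite mulrC; congr (_ * _); apply: complex_ext => /=.
    by rewrite -(total_weight Qt).
  rewrite (@rect_integral_eq _ _ (fun a b => 0 * 0)); last by move=> a b _; rewrite mul0r.
  by rewrite rect_integralZ ?mul0r//; exact: cont_cst.
move=> s s0 s1.
have ca : ccontinuous2 (fa s) by exact: (@cont_fa _ (fun=> s) fst snd).
have cb : ccontinuous2 (fb s) by exact: (@cont_fb _ (fun=> s) fst snd).
rewrite (@rect_cintegral_eq _ _ (fun a b => - 1 * (fa s a b + fb s a b))); last first.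
  by move=> a b _; exact: dmean_divergence.
rewrite (rect_cintegralZ _ (ccontinuousD ca cb)) (rect_cintegralD ca cb).
by rewrite fa_integral fb_integral addr0 mulr0.
Qed.

End kirchhoff.

(** * Spin dyads adapted to the cut *)

Section spin_frame.
Context {R : realType}.
Local Notation C := R[i].
Implicit Types (k m o i : 'rV[C]_2) (x y : 'rV[C]_4).

Lemma conjcE (z : C) : complex.Re z -i* complex.Im z = conjc z.
Proof. by case: z. Qed.

Lemma cconjE p q (A : 'M[C]_(p, q)) u v : cconj A u v = conjc (A u v).
Proof. by rewrite mxE conjcE. Qed.

Lemma mat_svec k m : mat (svec k m) = k^T *m cconj m.
Proof. exact: svecP. Qed.

Lemma mat_svecE k m A A' : mat (svec k m) A A' = k 0 A * conjc (m 0 A').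
Proof. by rewrite mat_svec mxE big_ord1 mxE cconjE. Qed.

Lemma comatE x : [/\ comat x 0 0 = mat x 1 1, comat x 0 1 = - mat x 0 1,
  comat x 1 0 = - mat x 1 0 & comat x 1 1 = mat x 0 0].
Proof.
have E1 A A' : mat x A A' = \sum_a x 0 a * (((Num.sqrt 2)^-1)%:C * pauli a A A').
  by rewrite /mat summxE; apply: eq_bigr => a _; rewrite mxE infeldE.
have E2 A A' : comat x A A' = \sum_a x 0 a * @inv_metric C a *
    (((Num.sqrt 2)^-1)%:C * pauli a A A').
  by rewrite /comat summxE; apply: eq_bigr => a _; rewrite mxE infeldE.
rewrite !E1 !E2 !(big_ord_recl, big_ord0) /inv_metric /pauli /=.
by split; ring.
Qed.

Lemma spairE k m : spair k m = k 0 0 * m 0 1 - k 0 1 * m 0 0.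
Proof.
have e1 : lift ord0 ord0 = 1 :> 'I_2 by apply/val_inj.
rewrite /spair !(big_ord_recl, big_ord0) e1 /lower /epsilon !mxE.
rewrite !(big_ord_recl, big_ord0) e1 !mxE /=; ring.
Qed.

Lemma lowerE k : lower k 0 0 = - k 0 1 /\ lower k 0 1 = k 0 0.
Proof.
have e1 : lift ord0 ord0 = 1 :> 'I_2 by apply/val_inj.
rewrite /lower /epsilon !mxE !(big_ord_recl, big_ord0) e1 !mxE /=.
by split; ring.
Qed.

Lemma spair_self k : spair k k = 0.
Proof. by rewrite spairE; ring. Qed.

Lemma mink_svec k m k' m' :
  mink_form (svec k m) (svec k' m') = spair k k' * conjc (spair m m').
Proof. by rewrite mink_form_svec conjcE. Qed.

Lemma mink_flag_flag o i : mink_form (flag o) (flag i) = complex.Re (spair o i * conjc (spair o i)).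
Proof. by rewrite -mink_svec -!cplx_flag mink_form_cplx. Qed.

Lemma mink_flag_self o : mink_form (flag o) (flag o) = 0.
Proof. by rewrite mink_flag_flag spair_self mul0r. Qed.

(** With [o_A iota^A = 1], lowering the indices of [iota iota-bar] and contracting
    the primed ones with [o o-bar] leaves [o^A iota_B], up to sign. *)
Lemma mat_flag_comat o i : spair o i = 1 ->
  mat (cplx (flag o)) *m comat (cplx (flag i)) = - (o^T *m lower i).
Proof.
move=> oi; have oic : conjc (o 0 0) * conjc (i 0 1) = 1 + conjc (o 0 1) * conjc (i 0 0).
  have := congr1 conjc oi; rewrite spairE !rmorphB !rmorphM rmorph1.
  by move/eqP; rewrite subr_eq => /eqP.
rewrite !cplx_flag; have [c00 c01 c10 c11] := comatE (svec i i).
have [l0 l1] := lowerE i.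
have e1 : lift ord0 ord0 = 1 :> 'I_2 by apply/val_inj.
apply/matrixP => A B; rewrite [RHS]mxE [in RHS]mxE big_ord1 [X in _ = - (X * _)]mxE.
rewrite [LHS]mxE !(big_ord_recl, big_ord0) e1 addr0 !mat_svecE.
have [->|->] := ord2 B; rewrite ?c00 ?c01 ?c10 ?c11 ?l0 ?l1 !mat_svecE; ring: oic.
Qed.

Lemma mink_dyad (Q' l n : 'rV[R]_4) (s t : R) : Q' = s *: l + t *: n ->
  mink_form l l = 0 -> mink_form n n = 0 -> mink_form l n = 1 ->
  mink_form Q' l = t /\ mink_form Q' Q' = 2 * (s * t).
Proof.
move=> -> ll nn ln; rewrite !mink_formDl !mink_formDr !mink_formZl !mink_formZr.
by rewrite (mink_formC n l) ll nn ln; split; ring.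
Qed.

Lemma dyad_projection o i (Q : 'rV[R]_4) (s t : R) : s != 0 -> t != 0 ->
  spair o i = 1 -> Q = s *: flag o + t *: flag i ->
  (2 / mink_form Q Q)%:C *: (mat (cplx (s *: flag o)) *m comat (cplx Q)) =
  - (o^T *m lower i).
Proof.
move=> s0 t0 oi QE.
have ln : mink_form (flag o) (flag i) = 1 by rewrite mink_flag_flag oi rmorph1 mulr1.
have [_ ->] := mink_dyad QE (mink_flag_self o) (mink_flag_self i) ln.
have e1 := mat_flag_comat oi.
have e2 : mat (cplx (flag o)) *m comat (cplx (flag o)) = 0.
  by rewrite mat_comat mink_form_cplx mink_flag_self mul0r raddf0.
rewrite {}QE; move: (flag o) (flag i) e1 e2 => l m e1 e2.
rewrite cplxD !cplxZ comatD matZ !comatZ -scalemxAl mulmxDr -!scalemxAr e1 e2.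
rewrite scaler0 add0r !scalerA -!rmorphM.
have -> : 2 / (2 * (s * t)) * s * t = 1 by field; rewrite s0 t0.
by rewrite rmorph1 scale1r.
Qed.

End spin_frame.

Section adapted_frame.
Context {R : realType}.
Local Notation C := R[i].
Variables (p0 q : 'rV[R]_4) (o iota : 'rV[R]_3 -> 'rV[C]_2) (r0 r : 'rV[R]_3 -> R).
Hypothesis ho : generator_spinors o.
Hypothesis hq : chrono_future p0 q.
Hypothesis had : adapted_to p0 q o iota r0 r.
Local Notation Q := (q - p0).
Local Notation q2 := (mink_form Q Q).

Let Qt : future_timelike Q := chrono_future_sub hq.

Lemma Q_decomposition w : unit_sphere w ->
  Q = r0 w *: flag (o w) + r w *: flag (iota w).
Proof.
by move=> uw; rewrite {1}(adapted_q had uw) addrAC (addrAC p0) subrr add0r.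
Qed.

Lemma mink_l_n w : unit_sphere w -> mink_form (flag (o w)) (flag (iota w)) = 1.
Proof. by move=> uw; rewrite mink_flag_flag (adapted_dyad had uw) rmorph1 mulr1. Qed.

Lemma mink_Q_l w : unit_sphere w -> mink_form Q (flag (o w)) = r w.
Proof.
move=> uw; have [] // := mink_dyad (Q_decomposition uw) (mink_flag_self (o w))
  (mink_flag_self (iota w)) (mink_l_n uw).
Qed.

Lemma mink_Q_Q w : unit_sphere w -> q2 = 2 * (r0 w * r w).
Proof.
move=> uw; have [] // := mink_dyad (Q_decomposition uw) (mink_flag_self (o w))
  (mink_flag_self (iota w)) (mink_l_n uw).
Qed.

Lemma spherical_unit (a b : R) : unit_sphere (spherical a b).
Proof.
rewrite /unit_sphere /= /enorm !(big_ord_recl, big_ord0) !mxE /=.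
have -> : (sin a * cos b) ^+ 2 + ((sin a * sin b) ^+ 2 + (cos a ^+ 2 + 0)) = 1.
  by have ha := cosM_sinM a; have hb := cosM_sinM b; ring: ha hb.
by rewrite sqrtr1.
Qed.

Lemma null_direction_spherical (a b : R) :
  null_direction (spherical a b) = null_vec a b.
Proof.
apply/rowP => c; rewrite [RHS]mxE /null_direction.
case: (splitP (c : 'I_(1 + 3))) => j cj.
  have -> : c = lshift 3 j by apply/val_inj.
  apply: (etrans (row_mxEl (1%:M : 'M[R]_1) (spherical a b) 0 j)).
  by rewrite mxE (ord1 j) /=.
have -> : c = rshift 1 j by apply/val_inj.
apply: (etrans (row_mxEr (1%:M : 'M[R]_1) (spherical a b) 0 j)); rewrite mxE /=.
by case: j {cj} => [[|[|[|//]]] ?].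
Qed.

(** Both are the multiple of the null direction with [(Q - x)^2 = 0], so the scale
    of [o] drops out. *)
Lemma r0_flag_kap (a b : R) :
  r0 (spherical a b) *: flag (o (spherical a b)) = kap Q a b.
Proof.
have uw := spherical_unit a b; set w := spherical a b.
have [c c0 lE] := generator_dir ho uw; rewrite -/w in lE.
have Qk : r w = c * mink_form Q (null_vec a b).
  by rewrite -mink_Q_l// lE mink_formZr null_direction_spherical.
have d0 : mink_form Q (null_vec a b) != 0 by rewrite gt_eqF// timelike_null_gt0.
have r00 : r0 w != 0 by rewrite gt_eqF// (adapted_r0 had uw).
rewrite lE null_direction_spherical scalerA /kap /kap_radius; congr (_ *: _).
by rewrite (mink_Q_Q uw) Qk; field.
Qed.

Lemma slot_proj_dyad (a b : R) : let w := spherical a b in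
  slot_proj Q a b = - ((o w)^T *m lower (iota w)).
Proof.
move=> w; have uw : unit_sphere w := spherical_unit a b.
have r00 : r0 w != 0 by rewrite gt_eqF// (adapted_r0 had uw).
have r1 : r w != 0 by rewrite gt_eqF// (adapted_r had uw).
rewrite /slot_proj -r0_flag_kap -/w.
exact: dyad_projection r00 r1 (adapted_dyad had uw) (Q_decomposition uw).
Qed.

Lemma vderive_derive1 (v : R -> 'rV[R]_4) (t : R) dv :
  is_vderive v t dv -> derive1 v t = dv.
Proof. by move=> /is_vderive_differentiable[df dE]; rewrite derive1E'. Qed.

(** The tangent vectors [kap_a] and [kap_b] are orthogonal of equal length
    [kap_radius]. *)
Lemma area_density_kap (a b : R) : 0 <= sin a ->
  area_density (fun s t => p0 + r0 (spherical s t) *: flag (o (spherical s t))) a b =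
  sin a * kap_radius Q a b ^+ 2.
Proof.
move=> sa; rewrite (_ : (fun s t => _) = (fun s t => p0 + kap Q s t)); last first.
  by apply/funext => s; apply/funext => t; rewrite r0_flag_kap.
rewrite /area_density (vderive_derive1 (shifted_kap_vda p0 Qt a b)).
rewrite (vderive_derive1 (shifted_kap_vdb p0 Qt a b)).
have := mink_kap_a_kap_a Q a b; have := mink_kap_b_kap_b Q a b; have := mink_kap_a_kap_b Q a b.
move: (kap_a Q a b) (kap_b Q a b) (kap_radius Q a b) => u v t uv vv uu.
rewrite mink_formZl !mink_formZr uu vv uv.
have -> : - t ^+ 2 * (sin a * (sin a * - t ^+ 2)) - (sin a * 0) ^+ 2 =
  (sin a * t ^+ 2) ^+ 2 by ring.
by rewrite sqrtr_sqr ger0_norm// mulr_ge0// sqr_ge0.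
Qed.

Lemma csphere_integral_kap (F : 'rV[R]_3 -> C) :
  csphere_integral (fun w => p0 + r0 w *: flag (o w)) F =
  rect_cintegral (fun a b => (sin a * kap_radius Q a b ^+ 2)%:C * F (spherical a b)).
Proof.
apply: complex_ext; apply: rect_integral_eq => a b sa; rewrite (area_density_kap b sa).
  by rewrite complexReM /= mul0r subr0 mulrC.
by rewrite complexImM /= mul0r addr0 mulrC.
Qed.

Lemma cderive1E (f : R -> C) (s : R) d : is_cderive f s d -> cderive1 f s = d.
Proof.
move=> [dr di]; apply: complex_ext; rewrite /cderive1 /= derive1E.
  exact: (@derive_val _ _ _ _ _ _ _ dr).
exact: (@derive_val _ _ _ _ _ _ _ di).
Qed.

End adapted_frame.

(** * Variation of the generators off the cone *)

Section complex_inverse.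
Context {R : realType}.
Local Notation C := R[i].

Lemma is_cderiveV_ex (f : R -> C) (t : R) d : is_cderive f t d -> f t != 0 ->
  exists e, is_cderive (fun x => (f x)^-1) t e.
Proof.
move=> [fr fi] f0.
pose N x := complex.Re (f x) * complex.Re (f x) + complex.Im (f x) * complex.Im (f x).
have N0 : N t != 0.
  apply: contra f0 => /eqP N0; apply/eqP.
  move: N0; rewrite /N -!expr2; case: (f t) => x y /= /eqP.
  by rewrite paddr_eq0 ?sqr_ge0// !sqrf_eq0 => /andP[/eqP-> /eqP->].
have dN := is_deriveV (f := N) N0
  (is_deriveD_fun (is_deriveM_fun fr fr) (is_deriveM_fun fi fi)).
have ReV (z : C) : complex.Re z^-1 =
    complex.Re z * (complex.Re z * complex.Re z + complex.Im z * complex.Im z)^-1.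
  by case: z.
have ImV (z : C) : complex.Im z^-1 = -1 * (complex.Im z *
    (complex.Re z * complex.Re z + complex.Im z * complex.Im z)^-1).
  by case: z => x y /=; rewrite mulN1r.
have Hr := is_deriveM_fun fr dN.
have Hi := is_deriveM_fun (is_derive_cst (-1 : R) t 1) (is_deriveM_fun fi dN).
eexists (_ +i* _); split.
  by under eq_fun do rewrite ReV; exact: Hr.
by under eq_fun do rewrite ImV; exact: Hi.
Qed.

Lemma is_cderive_near_eq (f g : R -> C) (t : R) d :
  (\forall s \near t, f s = g s) -> is_cderive f t d -> is_cderive g t d.
Proof.
move=> fg [dr di]; split.
  by apply: near_eq_is_derive dr; near=> s; rewrite (near fg s).
by apply: near_eq_is_derive di; near=> s; rewrite (near fg s).
Unshelve. all: by end_near. Qed.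

Lemma derive_line (F : 'rV[R]_4 -> R) (x v : 'rV[R]_4) :
  'D_v F x = 'D_1 (fun t : R => F (x + t *: v)) 0.
Proof.
rewrite /derive; congr (lim (_ @ 0^')); apply/funext => h /=.
by rewrite scale0r !addr0 [h%:A]mulr1 [x + _]addrC.
Qed.

Lemma pd_line (F : 'rV[R]_4 -> C) x a d :
  is_cderive (fun t => F (x + t *: delta_mx 0 a)) 0 d -> pd a F x = d.
Proof.
move=> [dr di]; rewrite /pd !derive_line; apply: complex_ext => /=.
  exact: (@derive_val _ _ _ _ _ _ _ dr).
exact: (@derive_val _ _ _ _ _ _ _ di).
Qed.

End complex_inverse.

Section unit_directions.
Context {R : realType}.
Implicit Types (y w : 'rV[R]_3).

Lemma enormZ (s : R) y : enorm (s *: y) = `|s| * enorm y.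
Proof.
rewrite /enorm -sqrtr_sqr -sqrtrM ?sqr_ge0//; congr (Num.sqrt _).
by rewrite mulr_sumr; apply: eq_bigr => j _; rewrite mxE exprMn.
Qed.

Lemma enorm_sqr y : enorm y ^+ 2 = \sum_(j < 3) y 0 j ^+ 2.
Proof. by rewrite sqr_sqrtr// sumr_ge0// => j _; exact: sqr_ge0. Qed.

Lemma enorm_gt0 y : y != 0 -> 0 < enorm y.
Proof.
move=> y0; rewrite lt_neqAle sqrtr_ge0 andbT eq_sym; apply: contra y0 => /eqP n0.
have /eqP := enorm_sqr y; rewrite n0 expr0n /= eq_sym psumr_eq0; last first.
  by move=> j _; exact: sqr_ge0.
move=> /allP H; apply/eqP/rowP => j; rewrite mxE.
by have := H j (mem_index_enum j); rewrite sqrf_eq0 => /eqP.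
Qed.

Lemma normalize_unit y : y != 0 -> unit_sphere (normalize y).
Proof.
move=> y0; have n0 := enorm_gt0 y0.
by rewrite /unit_sphere /= /normalize enormZ ger0_norm ?invr_ge0 ?ltW// mulVf ?gt_eqF.
Qed.

Lemma normalizeZ (s : R) w : 0 < s -> unit_sphere w -> normalize (s *: w) = w.
Proof.
move=> s0 w1; rewrite /normalize enormZ (w1 : enorm w = 1) mulr1 gtr0_norm//.
by rewrite scalerA mulVf ?scale1r ?gt_eqF.
Qed.

Lemma unit_sphere_sum w : unit_sphere w -> \sum_(j < 3) w 0 j ^+ 2 = 1.
Proof. by move=> w1; rewrite -enorm_sqr (w1 : enorm w = 1) expr1n. Qed.

Definition space_part (x : 'rV[R]_4) : 'rV[R]_3 := rsubmx (x : 'rV_(1 + 3)).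

Lemma space_partE x j : space_part x 0 j = x 0 (lift ord0 j).
Proof. by rewrite mxE; congr (x 0 _); apply/val_inj. Qed.

Lemma null_direction_time w : null_direction w 0 0 = 1.
Proof.
rewrite /null_direction (_ : 0 = lshift 3 (0 : 'I_1)); last exact/val_inj.
by apply: (etrans (row_mxEl (1%:M : 'M[R]_1) w 0 0)); rewrite mxE.
Qed.

Lemma null_direction_space w j : null_direction w 0 (lift ord0 j) = w 0 j.
Proof.
rewrite /null_direction (_ : lift ord0 j = rshift 1 j); last exact/val_inj.
exact: (row_mxEr (1%:M : 'M[R]_1) w 0 j).
Qed.

End unit_directions.

Section row_entries.
Context {K : pzRingType} {n : nat}.
Implicit Types (u v : 'rV[K]_n) (j : 'I_n).
Lemma rowZE c v j : (c *: v) 0 j = c * v 0 j. Proof. by rewrite mxE. Qed.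

Lemma rowDE u v j : (u + v) 0 j = u 0 j + v 0 j. Proof. by rewrite mxE. Qed.

Lemma rowNE v j : (- v) 0 j = - v 0 j. Proof. by rewrite mxE. Qed.
End row_entries.

Section generator_variation.
Context {R : realType}.
Local Notation C := R[i].
Variables (p0 : 'rV[R]_4) (o : 'rV[R]_3 -> 'rV[C]_2).
Hypothesis ho : generator_spinors o.
Variables (w : 'rV[R]_3) (s0 : R).
Hypothesis uw : unit_sphere w.
Hypothesis s0_gt0 : 0 < s0.
Local Notation l := (flag (o w)).
Let x0 := p0 + s0 *: l.
(** The null vector [l], extended off the cone by radial constancy. Unlike the
    spinor [o] itself, it is smooth. *)
Definition gen_field (x : 'rV[R]_4) : 'rV[R]_4 := flag (o (dir p0 x)).
Local Notation e_ a := (delta_mx 0 a : 'rV[R]_4).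

Lemma dirE x : dir p0 x = normalize (space_part (x - p0)).
Proof. by []. Qed.

Lemma space_part_null_direction (c : R) : space_part (c *: null_direction w) = c *: w.
Proof. by apply/rowP => j; rewrite space_partE !rowZE null_direction_space. Qed.

Lemma space_part_x0 : exists2 c, 0 < c /\ l = c *: null_direction w &
  space_part (x0 - p0) = (s0 * c) *: w.
Proof.
have [c c0 lE] := generator_dir ho uw; exists c => //.
by rewrite /x0 addrC addKr lE scalerA space_part_null_direction.
Qed.

Lemma unit_neq0 : w != 0.
Proof.
apply/eqP => w0; have := unit_sphere_sum uw; rewrite w0 big1; last first.
  by move=> j _; rewrite mxE expr0n.
by move/eqP; rewrite eq_sym oner_eq0.
Qed.

Lemma space_part_x0_neq0 : space_part (x0 - p0) != 0.
Proof.
have [c [c0 _] ->] := space_part_x0.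
by rewrite scaler_eq0 negb_or unit_neq0 andbT mulf_neq0 ?gt_eqF.
Qed.

Lemma dir_x0 : dir p0 x0 = w.
Proof.
have [c [c0 _] xE] := space_part_x0.
by rewrite dirE xE normalizeZ// mulr_gt0.
Qed.

Lemma gen_field_x0 : gen_field x0 = l.
Proof. by rewrite /gen_field dir_x0. Qed.

Lemma gen_field_collinear x i j : space_part (x - p0) != 0 ->
  gen_field x 0 (lift ord0 i) * (x - p0) 0 (lift ord0 j) =
  gen_field x 0 (lift ord0 j) * (x - p0) 0 (lift ord0 i).
Proof.
move=> xn; have ud := normalize_unit xn; rewrite -dirE in ud.
have [c _ lE] := generator_dir ho ud.
rewrite /gen_field lE !rowZE !null_direction_space.
rewrite -!space_partE dirE /normalize !rowZE; ring.
Qed.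

Lemma gen_field_differentiable c : differentiable (fun x => gen_field x 0 c) x0.
Proof.
have [_ sm] := ho.
have [df _] := sm c 1%N.
have dx := df _ space_part_x0_neq0.
have ds : differentiable (fun x : 'rV[R]_4 => space_part (x - p0)) x0.
  apply: (@differentiable_comp _ _ _ _ (fun x : 'rV[R]_4 => x - p0) (@space_part R)).
    by apply: differentiableB; [exact: ex_diff|exact: differentiable_cst].
  exact: (@differentiable_rsubmx R 1 1 3).
exact: (@differentiable_comp _ _ _ _ (fun x : 'rV[R]_4 => space_part (x - p0))
  (fun y => flag (o (normalize y)) 0 c) x0 ds dx).
Qed.

Definition dgen (a : 'I_4) : 'rV[R]_4 := \row_c 'D_(e_ a) (fun x => gen_field x 0 c) x0.

Lemma gen_field_vderive a :
  is_vderive (fun t => gen_field (x0 + t *: e_ a)) 0 (dgen a).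
Proof.
move=> c; have x0E : x0 + 0 *: e_ a = x0 by rewrite scale0r addr0.
have := @chain_rule_real _ (fun x => gen_field x 0 c) (fun t => x0 + t *: e_ a) 0 (e_ a).
rewrite x0E => /(_ (gen_field_differentiable c) (line_vderive _ _ _)).
move/is_derive_eq; apply; rewrite mxE (bigD1 a)//= big1 ?addr0 => [|b /negbTE ba].
  by rewrite mxE !eqxx mul1r.
by rewrite mxE ba andbF mul0r.
Qed.

Lemma space_part_near (a : 'I_4) :
  \forall t \near (0 : R), space_part (x0 + t *: e_ a - p0) != 0.
Proof.
have [j wj] : exists j, w 0 j != 0.
  apply/existsP; apply: contraR unit_neq0; rewrite negb_exists => /forallP H.
  by apply/eqP/rowP => j; rewrite mxE; have := H j; rewrite negbK => /eqP.
have cf : continuous (fun t : R => (x0 - p0) 0 (lift ord0 j) + t * (e_ a) 0 (lift ord0 j)).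
  by apply: contD; [exact: cont_cst|apply: contM; [move=> t; exact: cvg_id|exact: cont_cst]].
have f0 : (x0 - p0) 0 (lift ord0 j) + 0 * (e_ a) 0 (lift ord0 j) != 0.
  rewrite mul0r addr0 -space_partE; have [c [c0 _] ->] := space_part_x0.
  by rewrite rowZE mulf_neq0// mulf_neq0 ?gt_eqF.
near=> t.
apply/eqP => /rowP/(_ j); rewrite space_partE [RHS]mxE; apply/eqP.
have -> : (x0 + t *: e_ a - p0) 0 (lift ord0 j) =
   (x0 - p0) 0 (lift ord0 j) + t * (e_ a) 0 (lift ord0 j).
  by rewrite addrAC rowDE rowZE.
near: t.
exact: (cvgr_neq0 _ (cf 0) f0).
Unshelve. all: by end_near. Qed.

(** Differentiating nullity and collinearity with the position determines the
    derivative up to a multiple [m] of the generator: it is the orthogonal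
    projection on the sphere divided by the affine distance. *)
Lemma dgenE a : exists m : R, dgen a = m *: null_direction w +
  s0^-1 *: ((\sum_j w 0 j * (e_ a) 0 (lift ord0 j)) *: time_vec +
    (e_ a - (e_ a) 0 0 *: time_vec)).
Proof.
have [c [c0 lE] xE] := space_part_x0.
set wa := \sum_j _.
have x0w j : (x0 - p0) 0 (lift ord0 j) = s0 * c * w 0 j by rewrite -space_partE xE rowZE.
have l_s j : l 0 (lift ord0 j) = c * w 0 j by rewrite lE rowZE null_direction_space.
have l_t : l 0 0 = c by rewrite lE rowZE null_direction_time mulr1.
have s0n : s0 != 0 by rewrite gt_eqF.
have cn : c != 0 by rewrite gt_eqF.
have g0 : gen_field (x0 + 0 *: e_ a) = l by rewrite scale0r addr0 gen_field_x0.
have dg := gen_field_vderive a.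
have y0 j : (x0 + 0 *: e_ a - p0) 0 (lift ord0 j) = s0 * c * w 0 j.
  by rewrite scale0r addr0 x0w.
have dy j : is_derive (0 : R) 1 (fun t => (x0 + t *: e_ a - p0) 0 (lift ord0 j))
    ((e_ a) 0 (lift ord0 j)).
  have := line_vderive (x0 - p0) (e_ a) 0 (lift ord0 j).
  by under [X in is_derive _ _ X _ -> _]eq_fun do rewrite addrAC.
(* derivative of [g(l, l) = 0] *)
have H1 : c * dgen a 0 0 = \sum_j (c * w 0 j) * dgen a 0 (lift ord0 j).
  have := is_derive_mink2 dg dg.
  under eq_fun do rewrite mink_flag_self.
  move=> H; have := is_derive_unique H (is_derive_cst (0 : R) (0 : R) 1).
  rewrite g0 (mink_formC l) -mulr2n => /eqP; rewrite mulrn_eq0 /= => /eqP.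
  rewrite /mink_form l_t => /eqP; rewrite subr_eq0 mulrC => /eqP ->.
  by apply: eq_bigr => j _; rewrite l_s mulrC.
(* derivative of the proportionality of [l] and the position *)
have H2 i j : dgen a 0 (lift ord0 i) * (s0 * c * w 0 j) + c * w 0 i * (e_ a) 0 (lift ord0 j) =
    dgen a 0 (lift ord0 j) * (s0 * c * w 0 i) + c * w 0 j * (e_ a) 0 (lift ord0 i).
  have A := is_deriveM_fun (dg (lift ord0 i)) (dy j).
  have B := is_deriveM_fun (dg (lift ord0 j)) (dy i).
  have AB : \forall t \near (0 : R),
      gen_field (x0 + t *: e_ a) 0 (lift ord0 j) * (x0 + t *: e_ a - p0) 0 (lift ord0 i) =
      gen_field (x0 + t *: e_ a) 0 (lift ord0 i) * (x0 + t *: e_ a - p0) 0 (lift ord0 j).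
    by have := space_part_near a; apply: filterS => t ht; exact: gen_field_collinear.
  have E := is_derive_unique A (near_eq_is_derive AB B).
  by move: E; rewrite g0 !y0 !l_s.
(* Contracting with [w], of length one, solves for the spatial part. *)
have H3 i : dgen a 0 (lift ord0 i) =
    (dgen a 0 0 - s0^-1 * wa) * w 0 i + s0^-1 * (e_ a) 0 (lift ord0 i).
  have sw := unit_sphere_sum uw.
  have E : \sum_j w 0 j * (dgen a 0 (lift ord0 i) * (s0 * c * w 0 j) +
        c * w 0 i * (e_ a) 0 (lift ord0 j)) =
      \sum_j w 0 j * (dgen a 0 (lift ord0 j) * (s0 * c * w 0 i) +
        c * w 0 j * (e_ a) 0 (lift ord0 i)).
    by apply: eq_bigr => j _; rewrite H2.
  have E1 : \sum_j w 0 j * (dgen a 0 (lift ord0 i) * (s0 * c * w 0 j) +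
        c * w 0 i * (e_ a) 0 (lift ord0 j)) =
      dgen a 0 (lift ord0 i) * s0 * c * (\sum_j w 0 j ^+ 2) + c * w 0 i * wa.
    rewrite /wa !mulr_sumr -big_split; apply: eq_bigr => j _ /=; ring.
  have E2 : \sum_j w 0 j * (dgen a 0 (lift ord0 j) * (s0 * c * w 0 i) +
        c * w 0 j * (e_ a) 0 (lift ord0 i)) =
      s0 * w 0 i * (\sum_j (c * w 0 j) * dgen a 0 (lift ord0 j)) +
      c * (e_ a) 0 (lift ord0 i) * (\sum_j w 0 j ^+ 2).
    rewrite !mulr_sumr -big_split; apply: eq_bigr => j _ /=; ring.
  move: E; rewrite E1 E2 sw -H1 mulr1 => E.
  apply: (mulIf s0n); apply: (mulIf cn).
  have -> : dgen a 0 (lift ord0 i) * s0 * c =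
    s0 * w 0 i * (c * dgen a 0 0) + c * (e_ a) 0 (lift ord0 i) * 1 - c * w 0 i * wa.
    by rewrite -E; ring.
  by field.
exists (dgen a 0 0 - s0^-1 * wa).
have t0 : time_vec 0 0 = 1 :> R by rewrite mxE.
have ts j : time_vec 0 (lift ord0 j) = 0 :> R by rewrite mxE; case: j => [[|[|[|//]]] ?].
apply/rowP => b.
have [->|[j ->]] : b = 0 \/ exists j, b = lift ord0 j.
  by case: (unliftP 0 b) => [j ->|->]; [right; exists j|left].
  rewrite !(rowDE, rowNE, rowZE) null_direction_time t0. ring.
rewrite H3 !(rowDE, rowNE, rowZE) null_direction_space ts; ring.
Qed.

End generator_variation.

(** * The convergence of the generators *)

Section rho_value.
Context {R : realType}.
Local Notation C := R[i].
Variables (p0 q : 'rV[R]_4) (o iota : 'rV[R]_3 -> 'rV[C]_2) (r0 r : 'rV[R]_3 -> R).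
Hypothesis ho : generator_spinors o.
Hypothesis had : adapted_to p0 q o iota r0 r.
Local Notation Q := (q - p0).
Implicit Types (k m : 'rV[C]_2) (y : 'rV[R]_4).

(** When [y] is the flag of a spinor [k'], this is [k'] times its Hermitian product
    with [k], so the arbitrary phase of [k'] has been replaced by that of [k]. *)
Definition contract_conj (k : 'rV[C]_2) (y : 'rV[R]_4) : 'rV[C]_2 :=
  k *m (mat (cplx y))^T.

Definition hnorm (k k' : 'rV[C]_2) : C := \sum_(A < 2) k 0 A * conjc (k' 0 A).

Lemma mat_flag k : mat (cplx (flag k)) = k^T *m cconj k.
Proof. by rewrite cplx_flag mat_svec. Qed.

Lemma contract_conj_flag k k' : contract_conj k (flag k') = hnorm k k' *: k'.
Proof.
apply/rowP => A; rewrite /contract_conj mat_flag !mxE.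
rewrite /hnorm mulr_suml; apply: eq_bigr => B _.
by rewrite !mxE big_ord1 !mxE conjcE; ring.
Qed.

Lemma hphase_sqr k k' : hphase k k' ^+ 2 = hnorm k k' ^+ 2 / (hnorm k k' * conjc (hnorm k k')).
Proof.
have -> : hphase k k' = hnorm k k' / `|hnorm k k'|.
  rewrite /hphase (_ : \sum_A _ = hnorm k k')//.
  by apply: eq_bigr => A _; rewrite cconjE.
by rewrite expr_div_n sqr_normc.
Qed.

(** When [k] is the spinor [o] of a generator, contraction with [Q] yields a
    multiple of the conjugate of [iota], because [l] is annihilated. *)
Definition epsQ (k : 'rV[C]_2) : 'rV[C]_2 := lower k *m mat (cplx Q).

Lemma lower_mul k m : lower k *m m^T = (spair k m)%:M.
Proof.
apply/matrixP => i j; rewrite !ord1 [LHS]mxE [RHS]mxE mulr1n.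
by apply: eq_bigr => A _; congr (_ * _); rewrite mxE.
Qed.

Lemma epsQ_o w : unit_sphere w -> epsQ (o w) = (r w)%:C *: cconj (iota w).
Proof.
move=> uw; rewrite /epsQ (Q_decomposition had uw).
have := adapted_dyad had uw; move: (o w) (iota w) => k m km.
have := mat_flag m; have := mat_flag k; move: (flag k) (flag m) => x y ek em.
rewrite cplxD matD !cplxZ !matZ ek em mulmxDr -!scalemxAr !mulmxA !lower_mul.
by rewrite spair_self km raddf0 mul0mx scaler0 add0r mul1mx.
Qed.

(** An expression of [m], with its phase fixed, as a rational function of the null
    vector [y], for a fixed reference spinor [k]. It is differentiable although no regularity of [o] and
    [iota] is known. *)
Definition mfield_mx (k : 'rV[C]_2) (y : 'rV[R]_4) : 'M[C]_2 :=
  (hnorm (contract_conj k y) k * (mink_form Q y)%:C)^-1 *: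
    ((contract_conj k y)^T *m epsQ (contract_conj k y)).

Lemma epsQZ z k : epsQ (z *: k) = z *: epsQ k.
Proof. by rewrite /epsQ /lower -!scalemxAl. Qed.

Lemma conj_hnorm k k' : conjc (hnorm k k') = hnorm k' k.
Proof.
rewrite /hnorm rmorph_sum; apply: eq_bigr => A _.
by rewrite rmorphM /= conjcK mulrC.
Qed.

Lemma trmx_scale z k : (z *: k)^T = z *: k^T.
Proof. by apply/matrixP => i j; rewrite !mxE. Qed.

Lemma hnormZ z k k' : hnorm (z *: k) k' = z * hnorm k k'.
Proof.
by rewrite /hnorm mulr_sumr; apply: eq_bigr => A _; rewrite mxE mulrA.
Qed.

(** By [contract_conj_flag] and [epsQ_o], numerator and denominator of [mfield_mx]
    reduce to the dyad, the moduli being absorbed by the normalization of the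
    phase. *)
Lemma mfield_formula k w : unit_sphere w ->
  hphase k (o w) ^+ 2 *: svec (o w) (iota w) = vec_of_mx (mfield_mx k (flag (o w))).
Proof.
move=> uw; rewrite hphase_sqr conj_hnorm /mfield_mx contract_conj_flag epsQZ epsQ_o//.
have r1 : (r w)%:C != 0 :> C.
  by rewrite -(rmorph0 (real_complex R)) (inj_eq (@complexI R)) gt_eqF// (adapted_r had uw).
rewrite (mink_Q_l had uw) hnormZ.
have -> : (hnorm k (o w) * hnorm (o w) k * (r w)%:C)^-1 *:
    ((hnorm k (o w) *: o w)^T *m (hnorm k (o w) *: ((r w)%:C *: cconj (iota w)))) =
   (hnorm k (o w) ^+ 2 / (hnorm k (o w) * hnorm (o w) k)) *: ((o w)^T *m cconj (iota w)).
  rewrite trmx_scale -scalemxAl -!scalemxAr !scalerA; congr (_ *: _).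
  by rewrite invfM -[RHS]mulr1 -(mulVf r1); ring.
apply/rowP => a; rewrite /svec mxE [RHS]mxE [X in _ * X]mxE mulr_sumr; apply: eq_bigr => A _.
rewrite mulr_sumr; apply: eq_bigr => A' _; rewrite [X in _ = _ * X]mxE; ring.
Qed.

Definition dual_pair (k v : 'rV[C]_2) : C :=
  conjc (k 0 0) * v 0 1 - conjc (k 0 1) * v 0 0.

Lemma mink_flag_mx k (u v : 'rV[C]_2) :
  mink_form (cplx (flag k)) (vec_of_mx (u^T *m v)) = spair k u * dual_pair k v.
Proof.
have -> : vec_of_mx (u^T *m v) = svec u (cconj v).
  rewrite /svec; congr (vec_of_mx (_ *m _)); apply/matrixP => i j.
  by rewrite !cconjE conjcK.
rewrite cplx_flag mink_svec; congr (_ * _).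
by rewrite spairE rmorphB !rmorphM !cconjE /= !conjcK.
Qed.

Lemma mink_vec_of_mxZ (l : 'rV[C]_4) z (M : 'M[C]_2) :
  mink_form l (vec_of_mx (z *: M)) = z * mink_form l (vec_of_mx M).
Proof.
rewrite -mink_formZr; congr (mink_form _ _); apply/rowP => a.
rewrite mxE [RHS]mxE [X in _ * X]mxE mulr_sumr; apply: eq_bigr => A _.
by rewrite mulr_sumr; apply: eq_bigr => A' _; rewrite [X in _ * X]mxE; ring.
Qed.

Lemma mink_mfield_mx k y :
  mink_form (cplx (flag k)) (vec_of_mx (mfield_mx k y)) =
  spair k (contract_conj k y) *
  ((hnorm (contract_conj k y) k * (mink_form Q y)%:C)^-1 *
   dual_pair k (epsQ (contract_conj k y))).
Proof. by rewrite mink_vec_of_mxZ mink_flag_mx; ring. Qed.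

(** The pairing of [k] with the transported spinor, as a linear form in the null
    vector; it vanishes at the flag of [k]. *)
Definition shear_form (k : 'rV[C]_2) (y : 'rV[C]_4) : C := (lower k *m mat y *m k^T) 0 0.

Lemma shear_formD k (x y : 'rV[C]_4) : shear_form k (x + y) = shear_form k x + shear_form k y.
Proof. by rewrite /shear_form matD mulmxDr mulmxDl mxE. Qed.

Lemma shear_formZ k z (y : 'rV[C]_4) : shear_form k (z *: y) = z * shear_form k y.
Proof. by rewrite /shear_form matZ -scalemxAr -scalemxAl mxE. Qed.

Lemma spair_contract_conj k y : spair k (contract_conj k y) = shear_form k (cplx y).
Proof.
have /matrixP/(_ 0 0) := lower_mul k (contract_conj k y).
rewrite [RHS]mxE mulr1n => <-.
by rewrite /shear_form /contract_conj trmx_mul trmxK mulmxA.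
Qed.

Lemma shear_form_flag k : shear_form k (cplx (flag k)) = 0.
Proof. by rewrite /shear_form mat_flag mulmxA lower_mul spair_self raddf0 !mul0mx mxE. Qed.

Lemma shear_form_svec k m : spair k m = 1 -> shear_form k (svec m k) = hnorm k k.
Proof.
move=> km; rewrite /shear_form mat_svec mulmxA lower_mul km mul1mx mxE.
by apply: eq_bigr => A _; rewrite cconjE mxE mulrC.
Qed.

Lemma contract_conj_derive k (v : R -> 'rV[R]_4) t dv A : is_vderive v t dv ->
  is_cderive (fun s => contract_conj k (v s) 0 A) t (contract_conj k dv 0 A).
Proof.
move=> dvE; rewrite /contract_conj mxE; under eq_fun do rewrite mxE.
apply: is_cderive_sum => B; apply: is_cderiveZ; rewrite mxE.
by under eq_fun do rewrite mxE; exact: is_mderive_mat.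
Qed.

(** For factors of which the derivative is multiplied by zero in the end, existence
    is enough. *)
Definition cderivable (f : R -> C) t := exists d, is_cderive f t d.

Lemma cderivableM f g t : cderivable f t -> cderivable g t ->
  cderivable (fun x => f x * g x) t.
Proof. by move=> [df fd] [dg gd]; exists (df * g t + f t * dg); exact: is_cderiveM. Qed.

Lemma cderivableB f g t : cderivable f t -> cderivable g t ->
  cderivable (fun x => f x - g x) t.
Proof.
move=> [df fd] [dg gd]; exists (df + -1 * dg).
under eq_fun do rewrite -mulN1r.
by apply: is_cderiveD => //; exact: is_cderiveZ.
Qed.

Lemma cderivableZ z f t : cderivable f t -> cderivable (fun x => z * f x) t.
Proof. by move=> [df fd]; exists (z * df); exact: is_cderiveZ. Qed.

Lemma cderivable_sum (I : finType) (f : I -> R -> C) t :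
  (forall i, cderivable (f i) t) -> cderivable (fun x => \sum_i f i x) t.
Proof. by move=> /choice[d fd]; exists (\sum_i d i); exact: is_cderive_sum. Qed.

Lemma cderivable_eq (f g : R -> C) t : f =1 g -> cderivable f t -> cderivable g t.
Proof. by move=> /funext ->. Qed.

Section at_point.
Variables (k : 'rV[C]_2) (v : R -> 'rV[R]_4) (dv : 'rV[R]_4).
Hypothesis dvE : is_vderive v 0 dv.
Hypothesis v0 : v 0 = flag k.
Hypothesis k0 : hnorm k k != 0.
Hypothesis Qv0 : mink_form Q (v 0) != 0.

Lemma cderivable_contract A : cderivable (fun t => contract_conj k (v t) 0 A) 0.
Proof. by eexists; exact: contract_conj_derive. Qed.

Lemma cderivable_epsQ A : cderivable (fun t => epsQ (contract_conj k (v t)) 0 A) 0.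
Proof.
rewrite /epsQ /lower; under eq_fun do rewrite -mulmxA mxE.
apply: cderivable_sum => B.
apply: (@cderivable_eq (fun x => (epsilon R *m mat (cplx Q)) B A * contract_conj k (v x) 0 B)).
  by move=> x; rewrite mulrC.
by apply: cderivableZ; exact: cderivable_contract.
Qed.

Lemma cderivable_denominator :
  cderivable (fun t => (hnorm (contract_conj k (v t)) k * (mink_form Q (v t))%:C)^-1) 0.
Proof.
have [d dd] : cderivable (fun t => hnorm (contract_conj k (v t)) k * (mink_form Q (v t))%:C) 0.
  apply: cderivableM; last first.
    by eexists; apply: is_cderive_real; exact: is_derive_mink.
  apply: cderivable_sum => A.
  apply: (@cderivable_eq (fun x => conjc (k 0 A) * contract_conj k (v x) 0 A)).
    by move=> x; rewrite mulrC.
  by apply: cderivableZ; exact: cderivable_contract.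
apply: (is_cderiveV_ex dd).
rewrite {1}v0 contract_conj_flag hnormZ !mulf_neq0//.
by rewrite -(rmorph0 (real_complex R)) (inj_eq (@complexI R)).
Qed.

Lemma cderivable_mfield_mx b :
  cderivable (fun t => vec_of_mx (mfield_mx k (v t)) 0 b) 0.
Proof.
rewrite /vec_of_mx; under eq_fun do rewrite mxE.
apply: cderivable_sum => A; apply: cderivable_sum => A'.
apply: cderivableZ; rewrite /mfield_mx; under eq_fun do rewrite mxE.
apply: cderivableM; first exact: cderivable_denominator.
under eq_fun do rewrite mxE big_ord1 mxE.
by apply: cderivableM; [exact: cderivable_contract|exact: cderivable_epsQ].
Qed.

(** The product [g(l, m)] has the factor [shear_form], which vanishes at the
    generator, so that only this factor need be differentiated. *)
Lemma mink_mfield_mx_derive :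
  is_cderive (fun t => mink_form (cplx (flag k)) (vec_of_mx (mfield_mx k (v t)))) 0
    (shear_form k (cplx dv) *
     ((hnorm k k * hnorm k k * (mink_form Q (v 0))%:C)^-1 *
      (hnorm k k * dual_pair k (epsQ k)))).
Proof.
have [d dd] : cderivable (fun t => (hnorm (contract_conj k (v t)) k * (mink_form Q (v t))%:C)^-1 *
   dual_pair k (epsQ (contract_conj k (v t)))) 0.
  apply: cderivableM; first exact: cderivable_denominator.
  by apply: cderivableB; apply: cderivableZ; exact: cderivable_epsQ.
have ds : is_cderive (fun t => spair k (contract_conj k (v t))) 0 (shear_form k (cplx dv)).
  under eq_fun do rewrite spair_contract_conj.
  rewrite /shear_form mxE; under eq_fun do rewrite mxE.
  apply: is_cderive_sum => A; rewrite mulrC; under eq_fun do rewrite mulrC.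
  apply: is_cderiveZ; rewrite mxE; under eq_fun do rewrite mxE.
  by apply: is_cderive_sum => B; apply: is_cderiveZ; exact: (is_mderive_mat dvE).
under eq_fun do rewrite mink_mfield_mx.
apply: is_cderive_eq (is_cderiveM ds dd) _.
have s0 : spair k (contract_conj k (v 0)) = 0.
  by rewrite v0 spair_contract_conj shear_form_flag.
have c0 : contract_conj k (v 0) = hnorm k k *: k by rewrite v0 contract_conj_flag.
rewrite s0 mul0r addr0 c0 hnormZ epsQZ; congr (_ * (_ * _)).
by rewrite /dual_pair ![(_ *: epsQ k) _ _]mxE; ring.
Qed.

End at_point.

Lemma is_cderive_mink_row (x : 'rV[C]_4) (V : 'I_4 -> R -> 'rV[C]_4) (t : R)
    (d : 'I_4 -> 'I_4 -> C) (a : 'I_4) :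
  (forall b, is_cderive (fun s => V a s 0 b) t (d a b)) ->
  is_cderive (fun s => mink_form x (V a s)) t (\sum_b @inv_metric C b * (x 0 b * d a b)).
Proof.
move=> dE; under eq_fun do rewrite mink_formE.
by apply: is_cderive_sum => b; apply: is_cderiveZ; exact: is_cderiveZ.
Qed.

(** The vector [X] stands for [m-bar], orthogonal to [l]. *)
Lemma null_direction_orthogonal w (X : 'rV[C]_4) (c : R) : c != 0 ->
  flag (o w) = c *: null_direction w ->
  mink_form (cplx (flag (o w))) X = 0 ->
  \sum_j (w 0 j)%:C * X 0 (lift ord0 j) = X 0 0.
Proof.
move=> c0 -> ; rewrite cplxZ mink_formZl => /eqP; rewrite mulf_eq0.
rewrite -{1}(rmorph0 (real_complex R)) (inj_eq (@complexI R)) (negbTE c0) /=.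
rewrite /mink_form subr_eq0 [cplx _ 0 0]mxE null_direction_time rmorph1 mul1r => /eqP ->.
by apply: eq_bigr => j _; rewrite [in RHS]mxE null_direction_space.
Qed.

Lemma hnorm_neq0 k m : spair k m = 1 -> hnorm k k != 0.
Proof.
move=> km; apply/eqP => N0.
have k0 A : k 0 A = 0.
  have H : \sum_(B < 2) `|k 0 B| ^+ 2 = 0 :> C.
    by rewrite -[RHS]N0; apply: eq_bigr => B _; rewrite sqr_normc.
  have /eqP := H; rewrite psumr_eq0; last by move=> B _; rewrite exprn_ge0.
  by move=> /allP/(_ A (mem_index_enum A)); rewrite sqrf_eq0 normr_eq0 => /eqP.
by move: km; rewrite spairE !k0 !mul0r subrr => /eqP; rewrite eq_sym oner_eq0.
Qed.

Lemma shear_form_sum k (x : 'rV[C]_4) :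
  shear_form k x = \sum_a x 0 a * shear_form k (cplx (delta_mx 0 a : 'rV[R]_4)).
Proof.
have -> : shear_form k x = shear_form k (\sum_a x 0 a *: cplx (delta_mx 0 a : 'rV[R]_4)).
  congr shear_form; rewrite {1}(row_sum_delta x); apply: eq_bigr => a _; congr (_ *: _).
  by apply/rowP => b; rewrite !mxE rmorph_nat.
elim: (index_enum _) => [|a s IH].
  by rewrite !big_nil -(scale0r 0) shear_formZ mul0r.
by rewrite !big_cons shear_formD shear_formZ IH.
Qed.

(** By [dgenE] the derivative of [l] in the direction of [m-bar] is [m-bar / r0] up to a
    combination of [l] and of components that cancel because [m-bar] is orthogonal
    to [l]; then [shear_form] of [m-bar] is the Hermitian norm of [o], which the
    normalization divides out. *)
Lemma rho_eq w : unit_sphere w ->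
  rho p0 o iota w (p0 + r0 w *: flag (o w)) = - (r0 w)^-1%:C.
Proof.
move=> uw; have r00 := adapted_r0 had uw; have r1 := adapted_r had uw.
set x0 := p0 + r0 w *: flag (o w).
set k := o w.
have [c c0 lE] := generator_dir ho uw.
have km : spair k (iota w) = 1 := adapted_dyad had uw.
(* the vector [m-bar] *)
pose X := svec (iota w) k.
pose v a (t : R) := gen_field p0 o (x0 + t *: delta_mx 0 a).
have v0 a : v a 0 = flag k by rewrite /v scale0r addr0 gen_field_x0.
have N0 : hnorm k k != 0 by exact: hnorm_neq0 km.
have Q0 a : mink_form Q (v a 0) != 0 by rewrite v0 (mink_Q_l had uw) gt_eqF.
have dv a := gen_field_vderive p0 ho uw r00 a.
have mE (a : 'I_4) : \forall t \near (0 : R),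
    vec_of_mx (mfield_mx k (v a t)) = mfield p0 o iota w (x0 + t *: delta_mx 0 a).
  have := space_part_near p0 ho uw r00 a; apply: filterS => t ht.
  by rewrite -mfield_formula//; apply: normalize_unit.
have /choice[d dE] : forall ab : 'I_4 * 'I_4, exists d, is_cderive
    (fun t => mfield p0 o iota w (x0 + t *: delta_mx 0 ab.1) 0 ab.2) 0 d.
  move=> [a b].
  have [d dE] := cderivable_mfield_mx (dv a) (v0 a) N0 (Q0 a) b.
  exists d; apply: is_cderive_near_eq dE.
  by have := mE a; apply: filterS => t ->.
have G a : \sum_b @inv_metric C b * (cplx (flag k) 0 b * d (a, b)) =
    shear_form k (cplx (dgen p0 o w (r0 w) a)) / hnorm k k.
  have H1 := @is_cderive_mink_row (cplx (flag k))
    (fun a t => mfield p0 o iota w (x0 + t *: delta_mx 0 a)) 0 (fun a b => d (a, b)) a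
    (fun b => dE (a, b)).
  have H2 := mink_mfield_mx_derive (dv a) (v0 a) N0 (Q0 a).
  have NE : \forall t \near (0 : R),
      mink_form (cplx (flag k)) (vec_of_mx (mfield_mx k (v a t))) =
      mink_form (cplx (flag k)) (mfield p0 o iota w (x0 + t *: delta_mx 0 a)).
    by have := mE a; apply: filterS => t ->.
  have H3 := is_cderive_near_eq NE H2.
  rewrite (is_cderive_unique H1 H3); congr (_ * _).
  have v0' : gen_field p0 o (x0 + 0 *: delta_mx 0 a) = flag k := v0 a.
  rewrite v0' (mink_Q_l had uw) epsQ_o//.
  have rn : (r w)%:C != 0 :> C.
    by rewrite -(rmorph0 (real_complex R)) (inj_eq (@complexI R)) gt_eqF.
  have -> : dual_pair k ((r w)%:C *: cconj (iota w)) = (r w)%:C * conjc (spair k (iota w)).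
    by rewrite /dual_pair !mxE !conjcE spairE rmorphB !rmorphM /=; ring.
  by rewrite km rmorph1; field; rewrite N0.
have pdE a b : pd a (fun y => mfield p0 o iota w y 0 b) x0 = d (a, b).
  by apply: pd_line; exact: (dE (a, b)).
have X0 : \sum_j (w 0 j)%:C * X 0 (lift ord0 j) = X 0 0.
  apply: (null_direction_orthogonal _ lE); first by rewrite gt_eqF.
  by rewrite cplx_flag mink_svec spair_self rmorph0 mulr0.
have nd0 : shear_form k (cplx (null_direction w)) = 0.
  have : shear_form k (cplx (flag k)) = 0 by exact: shear_form_flag.
  rewrite lE cplxZ shear_formZ => /eqP; rewrite mulf_eq0.
  by rewrite -{1}(rmorph0 (real_complex R)) (inj_eq (@complexI R)) gt_eqF//= => /eqP.
pose s a := shear_form k (cplx (delta_mx 0 a : 'rV[R]_4)).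
have tE : time_vec = delta_mx 0 0 :> 'rV[R]_4.
  by apply/rowP => b; rewrite !mxE eqxx /=; case: b => [[|[|[|[|//]]]] ?].
have dg a : shear_form k (cplx (dgen p0 o w (r0 w) a)) = (r0 w)^-1%:C *
    ((\sum_j w 0 j * (delta_mx 0 a : 'rV[R]_4) 0 (lift ord0 j))%:C * s 0 +
     (s a - ((delta_mx 0 a : 'rV[R]_4) 0 0)%:C * s 0)).
  have [m ->] := dgenE p0 ho uw r00 a.
  rewrite tE -scaleNr !(cplxD, cplxZ, shear_formD, shear_formZ) nd0 mulr0 add0r.
  by rewrite rmorphN mulNr.
have dE0 (a b : 'I_4) : (delta_mx 0 a : 'rV[R]_4) 0 b = (b == a)%:R by rewrite mxE eqxx.
(* The two time components cancel, since [X] is orthogonal to [l]. *)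
have main : \sum_a X 0 a * shear_form k (cplx (dgen p0 o w (r0 w) a)) =
    (r0 w)^-1%:C * hnorm k k.
  rewrite -(shear_form_svec km) -/X (shear_form_sum _ X).
  transitivity ((r0 w)^-1%:C * ((\sum_a X 0 a * (\sum_j w 0 j *
      (delta_mx 0 a : 'rV[R]_4) 0 (lift ord0 j))%:C) * s 0 + (\sum_a X 0 a * s a) -
     (\sum_a X 0 a * ((delta_mx 0 a : 'rV[R]_4) 0 0)%:C) * s 0)).
    rewrite !mulr_suml -big_split -sumrB mulr_sumr; apply: eq_bigr => a _ /=.
    by rewrite dg; ring.
  have -> : \sum_a X 0 a * ((delta_mx 0 a : 'rV[R]_4) 0 0)%:C = X 0 0.
    rewrite (bigD1 0)//= big1 ?addr0 => [|a a0]; first by rewrite dE0 eqxx rmorph1 mulr1.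
    by rewrite dE0 eq_sym (negbTE a0) rmorph0 mulr0.
  have -> : \sum_a X 0 a * (\sum_j w 0 j *
      (delta_mx 0 a : 'rV[R]_4) 0 (lift ord0 j))%:C = X 0 0.
    rewrite -X0; under eq_bigr do rewrite rmorph_sum mulr_sumr.
    rewrite exchange_big; apply: eq_bigr => j _ /=.
    rewrite (bigD1 (lift ord0 j))//= big1 ?addr0 => [|a aj].
      by rewrite dE0 eqxx mulr1 mulrC.
    by rewrite dE0 eq_sym (negbTE aj) mulr0 rmorph0 mulr0.
  by rewrite [_ + \sum_a _]addrC addrK.
rewrite /rho mink_formE -/k.
have -> : \sum_a @inv_metric C a * (cplx (flag k) 0 a *
    nabla (svec (iota w) k) (mfield p0 o iota w) x0 0 a) =
  \sum_a X 0 a * (\sum_b @inv_metric C b * (cplx (flag k) 0 b * d (a, b))).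
  under [RHS]eq_bigr do rewrite mulr_sumr.
  rewrite [RHS]exchange_big; apply: eq_bigr => b _ /=.
  rewrite [nabla _ _ _ _ _]mxE !mulr_sumr; apply: eq_bigr => a _.
  by rewrite pdE /X; ring.
under eq_bigr do rewrite G mulrA.
by rewrite -mulr_suml main mulfK.
Qed.

End rho_value.

(** * The integral formula *)

Section assembly.
Context {R : realType} {n : nat}.
Local Notation C := R[i].

Lemma transvect_id (Phi : spinor_tensor R n) I : transvect Phi (fun=> 1%:M) I = Phi I.
Proof.
rewrite /transvect (bigD1 I)//= [X in _ + X]big1 => [|J JI].
  by rewrite addr0 big1 ?mulr1// => k _; rewrite mxE eqxx.
have [k Jk] : exists k, J k != I k.
  apply/existsP; apply: contraR JI; rewrite negb_exists => /forallP H.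
  by apply/eqP/ffunP => k; have := H k; rewrite negbK => /eqP.
by rewrite (bigD1 k)//= mxE (negbTE Jk) mulr0n mul0r mulr0.
Qed.

(** Each slot contributes one sign. *)
Lemma contract_all_dyad (Phi : spinor_tensor R n) (k m : 'rV[C]_2) (I : spindex n) :
  contract_all Phi k * \prod_(j < n) lower m 0 (I j) =
  (-1) ^+ n * transvect Phi (fun=> - (k^T *m lower m)) I.
Proof.
rewrite /contract_all /transvect mulr_suml mulr_sumr; apply: eq_bigr => J _.
have -> : \prod_(l < n) (- (k^T *m lower m)) (J l) (I l) =
   (-1) ^+ n * (\prod_(l < n) k 0 (J l) * \prod_(l < n) lower m 0 (I l)).
  rewrite -[X in (-1) ^+ X](card_ord n) -prodr_const -!big_split; apply: eq_bigr => l _ /=.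
  by rewrite mxE mxE big_ord1 mxE mulN1r.
have sgn2 : ((-1) ^+ n) * ((-1) ^+ n) = 1 :> C.
  by rewrite -exprD addnn -mul2n exprM sqrrN expr1n expr1n.
by ring: sgn2.
Qed.

End assembly.

Theorem proposition3p14 (R : realType) (n : nat) (n_ge2 : (2 <= n)%N)
    (p0 : 'rV[R]_4)
    (o : 'rV[R]_3 -> 'rV[R[i]]_2) (ho : generator_spinors o)
    (theta : 'rV[R]_4 -> spinor_tensor R n)
    (theta_smooth : smooth_data (cone_future p0) theta)
    (theta_supp : compactly_supported (cone_future p0) theta)
    (phi : 'rV[R]_4 -> spinor_tensor R n)
    (phi_smooth : smooth_field phi)
    (phi_sym : forall x, phi x = symmetrization (phi x))
    (phi_massless : forall x, chrono_future p0 x -> massless_at phi x)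
    (phi_cone : forall x, cone_future p0 x -> phi x = theta x)
    (q : 'rV[R]_4) (hq : chrono_future p0 q)
    (iota : 'rV[R]_3 -> 'rV[R[i]]_2) (r0 r : 'rV[R]_3 -> R)
    (hadapted : adapted_to p0 q o iota r0 r)
    (I : spindex n) :
  let p := fun w => p0 + r0 w *: flag (o w) in
  phi q I =
  (-1) ^+ n *
  csphere_integral p (fun w =>
    (cderive1 (phi0 phi p0 o w) (r0 w)
       - n.+1%:R * rho p0 o iota w (p w) * phi0 phi p0 o w (r0 w))
    * (\prod_(j < n) lower (iota w) 0 (I j))
    / (2 * pi * r w)%:C).
Proof.
move=> p.
have n0 : (0 < n)%N by exact: ltnW.
pose Q := q - p0; have Qt : future_timelike Q := chrono_future_sub hq.
have q20 : mink_form Q Q != 0 by case: Qt => /gt_eqF ->.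
have div_in j y : chrono_future p0 y -> divergence_free phi y j.
  by move=> hy; apply: massless_divergence_free => //; exact: phi_massless.
have div_cone j a b : divergence_free phi (p0 + kap Q a b) j.
  apply: (@divergence_free_closed _ _ _ _ _ Q) => // t t0.
  apply: div_in; rewrite -addrA; apply: chrono_futureE.
  have k0 : 0 < kap Q a b 0 0 by rewrite rowZE mxE mulr1 kap_radius_gt0.
  have := mink_kap_kap Q a b; have := mink_Q_kap Qt a b.
  move: (kap Q a b) k0 => k k0 Qk kk; case: Qt => Q2 Q0.
  split; last by rewrite rowDE rowZE addr_gt0// mulr_gt0.
  rewrite !mink_formDl !mink_formDr !mink_formZl !mink_formZr kk (mink_formC k Q) Qk.
  by rewrite add0r !addr_gt0// !mulr_gt0// invr_gt0 ltr0n.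
have rungE (i : nat) : (i <= n)%N -> rung Q p0 phi I i = rung Q p0 phi I 0.
  elim: i => [_|i IH ni]; first by reflexivity.
  have stp : rung Q p0 phi I i = rung Q p0 phi I i.+1.
    exact: (@rung_step _ _ Q p0 phi Qt phi_smooth phi_sym (Ordinal ni) I (div_cone _)).
  exact: (etrans (esym stp) (IH (ltnW ni))).
have rung0 : rung Q p0 phi I 0 = (4 * pi)%:C * phi q I.
  have wave x : chrono_future p0 x ->
      \sum_a @inv_metric R[i] a * pd a (pd a (fun y => phi y I)) x = 0.
    exact: (@massless_wave _ _ phi p0 x I (Ordinal n0) phi_smooth (div_in _)).
  have := @kirchhoff _ Q p0 (fun y => phi y I) Qt (phi_smooth I) wave.
  rewrite [X in phi X I](_ : _ = q); last by rewrite /Q addrC subrK.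
  move=> <-; apply: rect_cintegral_eq => a b _; congr (_ * _).
  have S0 : slots Q 0 a b =1 (fun _ : 'I_n => 1%:M) by [].
  by rewrite !(eq_transvect _ _ S0) !transvect_id mul1r.
have pi0 : pi != 0 :> R by rewrite gt_eqF// pi_gt0.
rewrite /p (csphere_integral_kap ho hq hadapted).
rewrite (@rect_cintegral_eq _ _ (fun a b => ((-1) ^+ n * ((4 * pi)^-1)%:C) *
  ((area_weight Q a b)%:C *
  (transvect (ddir_field phi (p0 + kap Q a b) (kap Q a b)) (slots Q n a b) I +
   n.+1%:R * transvect (phi (p0 + kap Q a b)) (slots Q n a b) I)))).
  rewrite rect_cintegralZ; last exact: ccont_rung.
  rewrite -/(rung Q p0 phi I n) (rungE n (leqnn n)) rung0 -!mulrA [_%:C * (_%:C * _)]mulrA -rmorphM.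
  rewrite mulVf ?mulf_neq0 ?pnatr_eq0// rmorph1 mul1r mulrA -exprD addnn -mul2n exprM.
  by rewrite sqrrN expr1n expr1n mul1r.
move=> a b sa; set w := spherical a b.
have uw : unit_sphere w := spherical_unit a b.
have kE : r0 w *: flag (o w) = kap Q a b := r0_flag_kap ho hq hadapted a b.
have r00 := adapted_r0 hadapted uw; have r1 := adapted_r hadapted uw.
rewrite (rho_eq ho hadapted uw).
have dphi0 : cderive1 (phi0 phi p0 o w) (r0 w) =
    contract_all (ddir_field phi (p0 + kap Q a b) (flag (o w))) (o w).
  apply: cderive1E; rewrite -kE; apply: is_cderive_sum => J.
  rewrite mulrC; under eq_fun do rewrite mulrC; apply: is_cderiveZ.
  apply: (@chain_rule _ (fun y => phi y J) (fun s => p0 + s *: flag (o w))).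
    exact: phi_smooth.
  exact: line_vderive.
have -> : phi0 phi p0 o w (r0 w) = contract_all (phi (p0 + kap Q a b)) (o w).
  by rewrite /phi0 kE.
have slE : slots Q n a b =1 (fun _ : 'I_n => - ((o w)^T *m lower (iota w))).
  by move=> k; rewrite /slots ltn_ord (slot_proj_dyad ho hq hadapted).
rewrite dphi0 !(eq_transvect _ _ slE).
have -> : transvect (ddir_field phi (p0 + kap Q a b) (kap Q a b))
    (fun _ : 'I_n => - ((o w)^T *m lower (iota w))) I =
  (r0 w)%:C * transvect (ddir_field phi (p0 + kap Q a b) (flag (o w)))
    (fun _ : 'I_n => - ((o w)^T *m lower (iota w))) I.
  rewrite -transvectZl; apply: eq_bigr => J _; congr (_ * _).
  by rewrite /ddir_field -{2}kE ddirZ.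
rewrite mulrN mulNr opprK; set c := (sin a * _)%:C.
have := contract_all_dyad (ddir_field phi (p0 + kap Q a b) (flag (o w))) (o w) (iota w) I.
have := contract_all_dyad (phi (p0 + kap Q a b)) (o w) (iota w) I.
set P := \prod_(j < n) _; move: (contract_all _ _) (contract_all _ _) => X Y.
move: (transvect _ _ _) (transvect _ _ _) => X' Y' EX EY.
(* The weight times [r0] is [2 / r] times the area density. *)
have coef : sin a * kap_radius Q a b ^+ 2 / (2 * pi * r w) =
    (4 * pi)^-1 * area_weight Q a b * r0 w.
  have := area_weightE a b q20; rewrite (mink_Q_Q hadapted uw) => WE.
  have -> : sin a * kap_radius Q a b ^+ 2 = area_weight Q a b * (r0 w * r w) / 2.
    by apply: (mulfI (_ : 4 != 0 :> R)); rewrite ?pnatr_eq0// -WE; field.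
  have rw0 : r w != 0 by rewrite gt_eqF.
  by move: (pi) pi0 rw0 => z z0 rw0; field; rewrite rw0 z0.
have r0C : (r0 w)%:C * (r0 w)^-1%:C = 1 :> R[i].
  by rewrite -rmorphM mulfV ?rmorph1 ?gt_eqF.
have coefC : c * ((2 * pi * r w)^-1)%:C =
    ((4 * pi)^-1)%:C * (area_weight Q a b)%:C * (r0 w)%:C.
  by rewrite /c -!rmorphM coef.
have -> : ((2 * pi * r w)%:C)^-1 = ((2 * pi * r w)^-1)%:C :> R[i] by rewrite fmorphV.
move: coefC r0C EX EY; clear.
move: (_^-1)%:C (_^-1)%:C (_^-1)%:C (area_weight Q a b)%:C (r0 w)%:C ((-1) ^+ n) n.+1%:R.
move=> u v s W t e m; rewrite /c; clear; move: (_%:C) => {}c cE tE EY EX.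
transitivity (c * s * (X * P + m * u * (Y * P))); first by ring.
by rewrite cE EX EY; ring: tE.
Qed.
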